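(* Let $\sigma=0$. Let $X$ be the moderate solution on $[0,T]$ with initial condition $\overline X\in L^2(\Omega;H^\alpha)$, with $\alpha\ge-1$. Then $X\in L^2([0,T]\times\Omega;H^\beta)$ for all $\beta<\min(1,\alpha+1)$, with norm bounded by a constant depending on $\beta$ and the law $\mathcal L_{\overline X}$ of $\overline X$, but not on $T$: $$\|X\|_{L^2([0,T]\times\Omega;H^\beta)}\le C_{\beta,\mathcal L_{\overline X}}<\infty.$$ In particular: (i) for all initial conditions (in $L^2(\Omega;H^{-1})$), $X\in L^2([0,T]\times\Omega;H^\beta)$ for all $\beta<0$; (ii) if $\overline X\in L^2(\Omega;H^\alpha)$ for some $\alpha>-1$, then $X\in L^2([0,T]\times\Omega;l^2)$; (iii) if $\overline X\in L^2(\Omega;l^2)$, then $X\in L^2([0,T]\times\Omega;H^\beta)$ for all $\beta<1$; (iv) for all initial conditions (in $L^2(\Omega;H^{-1})$), $X\in L^2([\epsilon,T]\times\Omega;H^\beta)$ for all $\epsilon>0$ and $\beta<1$.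
   Context: Fix $\lambda>1$, $k_n:=\lambda^n$ for $n\ge0$, a constant $\sigma\ge0$, a time $T>0$, a filtered probability space $(\Omega,\mathcal F,\mathcal F_t,P)$ and independent Brownian motions $(W_n)_{n\ge0}$ on it. For $s\in\mathbb R$, $H^s:=\{x\in\mathbb R^{\mathbb N}:\|x\|_{H^s}:=(\sum_{n\ge1}k_n^{2s}x_n^2)^{1/2}<\infty\}$; $H^0=l^2$. All initial conditions are $\mathcal F_0$-measurable. The linear stochastic dyadic model with forcing $\sigma$ is the It\^o system $$dX_1=\sigma\,dW_0-k_1X_2\,dW_1-\tfrac12k_1^2X_1\,dt,$$ $$dX_n=k_{n-1}X_{n-1}\,dW_{n-1}-k_nX_{n+1}\,dW_n-\tfrac12(k_{n-1}^2+k_n^2)X_n\,dt,\quad n\ge2,$$ with $X(0)=\overline X$, where $\overline X$ takes values in some $H^s$. A process $X=(X_n(t))_{n\ge1,t\in[0,T]}$ is a componentwise solution with initial condition $\overline X$ if it has adapted, continuous components and satisfies this system. A componentwise solution is a proper solution if $X\in L^2([0,T]\times\Omega;l^2)$ and $X_n\in L^4([0,T]\times\Omega)$ for all $n\ge1$. A componentwise solution $X$ is a moderate solution with initial condition $\overline X$ if $\overline X\in L^2(\Omega;H^{-1})$, $X\in L^2([0,T]\times\Omega;H^{-1})$, and there is a sequence $(X^{(N)})_{N\ge1}$ of proper solutions converging to $X$ in $L^2([0,T]\times\Omega;H^{-1})$ whose initial conditions $\overline X^{(N)}$ converge to $\overline X$ in $L^2(\Omega;H^{-1})$. For every $\overline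 X\in L^2(\Omega;H^{-1})$ a moderate solution exists and is unique. *)

(* Defs.v *)
From HB Require Import structures.
From mathcomp Require Import all_boot all_order all_algebra.
From mathcomp Require Import all_classical all_reals all_analysis.

Set Implicit Arguments.
Unset Strict Implicit.
Unset Printing Implicit Defensive.

Import Order.TTheory GRing.Theory Num.Theory.
Import numFieldNormedType.Exports.

Local Open Scope classical_set_scope.
Local Open Scope ring_scope.

(* Sequences (x_n)_{n >= 1} are encoded as x : nat -> R with x n standing for
   x_{n+1}; the indices of k_n and of the Brownian motions W_n are unshifted. *)

Section SequenceSpaces.
Context {R : realType}.

Definition k (lam : R) (n : nat) : R := lam ^+ n.

Definition Hnorm (lam s : R) (x : nat -> R) : \bar R :=
  sqrte (\sum_(0 <= n <oo) (k lam n.+1 `^ (2 * s) * x n ^+ 2)%:E)%E.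

Definition L2Hnorm d (S : measurableType d) (mu : set S -> \bar R) (D : set S)
    (lam s : R) (x : S -> nat -> R) : \bar R :=
  sqrte (\int[mu]_(z in D) (Hnorm lam s (x z) ^+ 2))%E.

Definition in_L2H d (S : measurableType d) (mu : set S -> \bar R) (D : set S)
    (lam s : R) (x : S -> nat -> R) : Prop :=
  (forall n, measurable_fun D (fun z => x z n)) /\
  (L2Hnorm mu D lam s x < +oo)%E.

Definition in_L4 d (S : measurableType d) (mu : set S -> \bar R) (D : set S)
    (f : S -> R) : Prop :=
  measurable_fun D f /\ (\int[mu]_(z in D) (`|f z| ^+ 4)%:E < +oo)%E.

Definition cylinders : set (set (nat -> R)) :=
  [set A | exists n (B : set R), measurable B /\ A = [set x | B (x n)]].

(* R^N with its product sigma-algebra *)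
Definition Rseq := g_sigma_algebraType cylinders.

Definition has_law d (Omega : measurableType d) (P : probability Omega R)
    (Y : Omega -> nat -> R) (mu : probability Rseq R) : Prop :=
  forall A : set Rseq, measurable A -> P (Y @^-1` A) = mu A.

End SequenceSpaces.

Section StochasticBasis.
Context {R : realType} {d : measure_display} {Omega : measurableType d}.
Variables (T : R) (P : probability Omega R) (F : R -> set (set Omega)).

Definition filtration : Prop :=
  (forall t : R, 0 <= t <= T -> sigma_algebra setT (F t) /\ F t `<=` measurable) /\
  (forall s t : R, 0 <= s -> s <= t -> t <= T -> F s `<=` F t).

Definition measurable_at (t : R) (Y : Omega -> R) : Prop :=
  forall B : set R, measurable B -> F t (Y @^-1` B).

Record brownian_motion (W : R -> Omega -> R) : Prop := {
  bm_adapted : forall t : R, 0 <= t <= T -> measurable_at t (W t);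
  bm_start : {ae P, forall w, W 0 w = 0};
  bm_continuous : {ae P, forall w, {within `[0, T], continuous (W ^~ w)}};
  (* the second argument of [normal_prob] is the standard deviation *)
  bm_gaussian : forall s t : R, 0 <= s -> s < t -> t <= T ->
    forall B : set R, measurable B ->
    P [set w | B (W t w - W s w)] = normal_prob 0 (Num.sqrt (t - s)) B;
  bm_indep : forall s t : R, 0 <= s -> s < t -> t <= T ->
    forall (A : set Omega) (B : set R), F s A -> measurable B ->
    P (A `&` [set w | B (W t w - W s w)]) =
      (P A * P [set w | B (W t w - W s w)%R])%E }.

Definition sigma_of_process (W : R -> Omega -> R) : set (set Omega) :=
  <<s [set A | exists t (B : set R),
        [/\ 0 <= t <= T, measurable B & A = W t @^-1` B]] >>.

Definition independent_processes (W : nat -> R -> Omega -> R) : Prop :=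
  forall (J : seq nat) (A : nat -> set Omega), uniq J ->
    (forall j, j \in J -> sigma_of_process (W j) (A j)) ->
    P (\big[setI/setT]_(j <- J) A j) = (\prod_(j <- J) P (A j))%E.

Definition stochastic_basis (W : nat -> R -> Omega -> R) : Prop :=
  [/\ filtration, forall n, brownian_motion (W n) & independent_processes W].

(* the process \sum_(i < sp_size) sp_val i * 1_{]sp_time i, sp_time i.+1]} *)
Record simple_process := SimpleProcess {
  sp_size : nat;
  sp_time : nat -> R;
  sp_val : nat -> Omega -> R }.

Definition simple_adapted (t : R) (S : simple_process) : Prop :=
  [/\ 0 <= sp_time S 0,
      forall i, (i < sp_size S)%N -> sp_time S i <= sp_time S i.+1,
      sp_time S (sp_size S) <= t &
      forall i, (i < sp_size S)%N ->
        measurable_at (sp_time S i) (sp_val S i) /\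
        exists M : R, forall w, `|sp_val S i w| <= M].

Definition sp_eval (S : simple_process) (s : R) (w : Omega) : R :=
  \sum_(i < sp_size S)
    sp_val S i w * \1_(`]sp_time S i, sp_time S i.+1]) s.

Definition sp_integral (W : R -> Omega -> R) (S : simple_process)
    (w : Omega) : R :=
  \sum_(i < sp_size S) sp_val S i w * (W (sp_time S i.+1) w - W (sp_time S i) w).

Definition to0_in_probability (D : nat -> Omega -> \bar R) : Prop :=
  forall eps : R, 0 < eps ->
    (fun m => P [set w | (eps%:E <= D m w)%E]) @ \oo --> 0%E.

(* [Y] is a version of the Ito integral of [H] against [W] over [0, t]: the
   limit in probability of the integrals of simple adapted processes [S m] such
   that \int_0^t |S m - H|^2 ds -> 0 in probability. *)
Definition ito_integral (W H : R -> Omega -> R) (t : R) (Y : Omega -> R) : Prop :=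
  measurable_fun setT Y /\
  exists S : nat -> simple_process,
    [/\ forall m, simple_adapted t (S m),
        to0_in_probability (fun m w =>
          (\int[lebesgue_measure]_(s in `[0%R, t])
             (`|sp_eval (S m) s w - H s w| ^+ 2)%:E)%E) &
        to0_in_probability (fun m w => `|sp_integral W (S m) w - Y w|%:E)].

End StochasticBasis.

Section DyadicModel.
Context {R : realType} {d : measure_display} {Omega : measurableType d}.
Variables (lam sigma T : R) (P : probability Omega R).
Variables (F : R -> set (set Omega)) (W : nat -> R -> Omega -> R).

(* In the equation of X_{n+1}: integrand of dW_n, of -dW_{n+1}, and the factor
   of -X_{n+1} dt. *)
Definition gain (X : R -> Omega -> nat -> R) (n : nat) (s : R) (w : Omega) : R :=
  if n is m.+1 then k lam n * X s w m else sigma.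

Definition loss (X : R -> Omega -> nat -> R) (n : nat) (s : R) (w : Omega) : R :=
  k lam n.+1 * X s w n.+1.

Definition damping (n : nat) : R :=
  2^-1 * ((if n is 0 then 0 else k lam n ^+ 2) + k lam n.+1 ^+ 2).

(* The integral equation is required almost surely at each time; paths being
   continuous, this is the same as requiring it almost surely at all times. *)
Record componentwise_solution (X0 : Omega -> nat -> R)
    (X : R -> Omega -> nat -> R) : Prop := {
  cs_initial_measurable : forall n, measurable_at F 0 (fun w => X0 w n);
  cs_initial_space : exists s : R, {ae P, forall w, (Hnorm lam s (X0 w) < +oo)%E};
  cs_adapted : forall n (t : R), 0 <= t <= T -> measurable_at F t (fun w => X t w n);
  cs_continuous : forall n w, {within `[0, T], continuous (fun t => X t w n)};
  cs_initial : {ae P, forall w, X 0 w = X0 w};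
  cs_equation : forall n (t : R), 0 <= t <= T ->
    exists I J : Omega -> R,
      [/\ ito_integral P F (W n) (gain X n) t I,
          ito_integral P F (W n.+1) (loss X n) t J &
          {ae P, forall w, X t w n = X0 w n + I w - J w
             - \int[lebesgue_measure]_(s in `[0, t]) (damping n * X s w n)}] }.

Definition timeP : set (measurableTypeR R * Omega) -> \bar R :=
  (@lebesgue_measure R \x P)%E.

Definition slab (a b : R) : set (measurableTypeR R * Omega) :=
  `[a, b] `*` [set: Omega].

Definition proc (X : R -> Omega -> nat -> R) (z : measurableTypeR R * Omega) :
  nat -> R := X z.1 z.2.

Record proper_solution (X0 : Omega -> nat -> R)
    (X : R -> Omega -> nat -> R) : Prop := {
  ps_solution : componentwise_solution X0 X;
  ps_L2 : in_L2H timeP (slab 0 T) lam 0 (proc X);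
  ps_L4 : forall n, in_L4 timeP (slab 0 T) (fun z => proc X z n) }.

Record moderate_solution (X0 : Omega -> nat -> R)
    (X : R -> Omega -> nat -> R) : Prop := {
  ms_solution : componentwise_solution X0 X;
  ms_initial : in_L2H P setT lam (-1) X0;
  ms_L2 : in_L2H timeP (slab 0 T) lam (-1) (proc X);
  ms_approx : exists (Y0 : nat -> Omega -> nat -> R)
                     (Y : nat -> R -> Omega -> nat -> R),
    [/\ forall N, proper_solution (Y0 N) (Y N),
        forall N, in_L2H P setT lam (-1) (Y0 N),
        (fun N => L2Hnorm timeP (slab 0 T) lam (-1)
                    (fun z n => proc (Y N) z n - proc X z n)) @ \oo --> 0%E &
        (fun N => L2Hnorm P setT lam (-1) (fun w n => Y0 N w n - X0 w n))
          @ \oo --> 0%E] }.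

End DyadicModel.

(* Main.v *)
Require Import Defs.
From HB Require Import structures.
From mathcomp Require Import all_boot all_order all_algebra.
From mathcomp Require Import all_classical all_reals all_analysis.
From mathcomp Require Import measurable_realfun ring lra.

(** Only second moments matter. Write v_n(t) = E X_n(t)^2 for a proper solution.
The damping rates are half the squares of the noise intensities, so that v
solves the forward equation of a birth and death chain with rates k_n^2,
  v_n' = k_(n-1)^2 v_(n-1) + k_n^2 v_(n+1) - (k_(n-1)^2 + k_n^2) v_n,
which transports energy between neighbours without creating any. With
U_n(t) = \int_0^t v_n and the equations summed up to n, the exchanges below n
cancel and only the flux through the edge (n, n+1) is left:
  \sum_(j <= n) v_j(t) + k_n^2 (U_n(t) - U_(n+1)(t)) = \sum_(j <= n) v_j(0).
Square integrability in l^2 makes U_n vanish at infinity, and summing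
U_n - U_(n+1) downwards from infinity gives [proper_energy],
  U_n(T) <= c \sum_j k_(max(n,j))^(-2) E X_j(0)^2,
where c is the sum of a geometric series and T has disappeared. For
-1 <= alpha <= 0 and beta < alpha + 1 one has k_n^(2 beta) k_(max(n,j))^(-2)
<= k_n^(2 (beta - alpha - 1)) k_j^(2 alpha), and summing over n turns the
bound into an estimate of the H^beta norm by the H^alpha norm of the initial
condition ([green_sum_lty], [green_regularity]).

The kernel k_(max(n,j))^(-2) is at most k_j^(-2), which is the weight of
H^(-1). The component bounds are therefore stable under the convergence that
defines moderate solutions, at the price of a factor 4 ([energy_limit]). They
involve the initial condition only through its second moments, hence only
through its law ([cenergy_law]).

After a positive time no regularity of the initial condition is needed. The
flux argument on [s, T], averaged over s in [0, t], bounds the energies on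
[t, T] by the same kernel applied to the energies on [0, t]
([proper_late_energy]). The latter are finite in every H^alpha with alpha < 0
by the first estimate, and alpha close to 0 reaches every beta < 1.

The equation for v_n ([moment_equation]) is derived from the Ito isometry
alone, without an Ito formula. A component satisfies X_n(t) + d_n \int_0^t X_n
= N(t), where N collects the initial value and the stochastic integrals, and
the isometry gives E N(s)N(t) = E N(s)^2 for s <= t. In a linear Volterra
equation this orthogonality passes from N to the solution, and yields
E X_n(t)^2 + 2 d_n \int_0^t E X_n^2 = E N(t)^2 ([volterra_energy]).

The integrals are limits in probability of integrals of simple processes,
while the isometry needs limits in mean square. Switching a simple process off
once its energy exceeds a level keeps the approximation and bounds the
energies, and a version of the lemma of Fatou for convergence in probability
concludes ([ito_approx]). The products of two different motions are handled by
the vanishing of their covariation along partitions ([ip_present_indep]). *)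

Import Order.TTheory GRing.Theory Num.Theory.
Import numFieldNormedType.Exports.

Local Open Scope classical_set_scope.
Local Open Scope ring_scope.

Set Implicit Arguments.
Unset Strict Implicit.
Unset Printing Implicit Defensive.

(** * Square-integrable functions *)

Section SquareIntegrable.
Context {d : measure_display} {S : measurableType d} {R : realType}.
Variable mu : {measure set S -> \bar R}.

Definition sqi (f : S -> R) : Prop :=
  measurable_fun setT f /\
  mu.-integrable setT (EFin \o (fun x => f x ^+ 2)).

Definition ip (f g : S -> R) : R := \int[mu]_x (f x * g x).

Lemma sqi_mul_integrable (f g : S -> R) :
  sqi f -> sqi g -> mu.-integrable setT (EFin \o (fun x => f x * g x)).
Proof.
move=> [mf if2] [mg ig2].
have := integrableD measurableT if2 ig2.
apply: le_integrable => //.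
  by apply/measurable_EFinP; exact: measurable_funM.
move=> x _ /=; rewrite lee_fin [leRHS]ger0_norm ?addr_ge0 ?sqr_ge0//.
by rewrite ler_norml; apply/andP; split; nra.
Qed.

Lemma sqi0 : sqi (fun=> 0).
Proof.
split; first exact: measurable_cst.
rewrite (_ : _ \o _ = cst 0%E); first exact: integrable0.
by apply/funext => x /=; rewrite expr0n.
Qed.

Lemma sqiZ (c : R) (f : S -> R) : sqi f -> sqi (fun x => c * f x).
Proof.
move=> [mf if2]; split; first exact: measurable_funM.
have := integrableZl measurableT (c ^+ 2) if2.
apply: eq_integrable => // x _ /=.
by rewrite -EFinM exprMn.
Qed.

Lemma sqiD (f g : S -> R) : sqi f -> sqi g -> sqi (fun x => f x + g x).
Proof.
move=> sf sg; split; first by apply: measurable_funD; [case: sf|case: sg].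
have i1 := integrableZl measurableT 2 (sqi_mul_integrable sf sg).
have := integrableD measurableT (integrableD measurableT sf.2 sg.2) i1.
apply: eq_integrable => // x _ /=.
by rewrite -EFinM -!EFinD; congr EFin; ring.
Qed.

Lemma sqiN (f : S -> R) : sqi f -> sqi (fun x => - f x).
Proof.
by move=> /(sqiZ (-1)); congr sqi; apply/funext => x; rewrite mulN1r.
Qed.

Lemma sqiB (f g : S -> R) : sqi f -> sqi g -> sqi (fun x => f x - g x).
Proof. by move=> sf /sqiN; exact: sqiD. Qed.

Lemma sqi_sum (I : Type) (r : seq I) (p : pred I) (f : I -> S -> R) :
  (forall i, p i -> sqi (f i)) -> sqi (fun x => \sum_(i <- r | p i) f i x).
Proof.
move=> sf; elim: r => [|i r IH].
  rewrite (_ : (fun _ => _) = fun=> 0); first exact: sqi0.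
  by apply/funext => x; rewrite big_nil.
rewrite (_ : (fun _ => _) = fun x => (if p i then f i x else 0)
    + \sum_(i <- r | p i) f i x); last first.
  by apply/funext => x; rewrite big_cons; case: (p i); rewrite ?add0r.
apply: sqiD => //; have [pi|_] := boolP (p i); [exact: sf|exact: sqi0].
Qed.

Lemma eq_ip (f f' g g' : S -> R) : f =1 f' -> g =1 g' -> ip f g = ip f' g'.
Proof. by move=> e e'; apply: eq_Rintegral => x _; rewrite e e'. Qed.

Lemma ipC (f g : S -> R) : ip f g = ip g f.
Proof. by apply: eq_Rintegral => x _; rewrite mulrC. Qed.

Lemma ipDl (f f' g : S -> R) : sqi f -> sqi f' -> sqi g ->
  ip (fun x => f x + f' x) g = ip f g + ip f' g.
Proof.
move=> sf sf' sg; rewrite -RintegralD//; try exact: sqi_mul_integrable.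
by apply: eq_Rintegral => x _; rewrite mulrDl.
Qed.

Lemma ipZl (c : R) (f g : S -> R) : sqi f -> sqi g ->
  ip (fun x => c * f x) g = c * ip f g.
Proof.
move=> sf sg; rewrite -RintegralZl//; last exact: sqi_mul_integrable.
by apply: eq_Rintegral => x _; rewrite mulrA.
Qed.

Lemma ip0l (g : S -> R) : ip (fun=> 0) g = 0.
Proof.
transitivity (\int[mu]_x (0 : R)); last by rewrite Rintegral_cst ?mul0r.
apply: eq_Rintegral => x _.
by rewrite mul0r.
Qed.

Lemma ipBl (f f' g : S -> R) : sqi f -> sqi f' -> sqi g ->
  ip (fun x => f x - f' x) g = ip f g - ip f' g.
Proof.
move=> sf sf' sg; rewrite -RintegralB//; try exact: sqi_mul_integrable.
by apply: eq_Rintegral => x _; rewrite mulrBl.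
Qed.

Lemma ipDr (f g g' : S -> R) : sqi f -> sqi g -> sqi g' ->
  ip f (fun x => g x + g' x) = ip f g + ip f g'.
Proof. by move=> *; rewrite ipC ipDl// !(ipC f). Qed.

Lemma ipBr (f g g' : S -> R) : sqi f -> sqi g -> sqi g' ->
  ip f (fun x => g x - g' x) = ip f g - ip f g'.
Proof. by move=> *; rewrite ipC ipBl// !(ipC f). Qed.

Lemma ipZr (c : R) (f g : S -> R) : sqi f -> sqi g ->
  ip f (fun x => c * g x) = c * ip f g.
Proof. by move=> *; rewrite ipC ipZl// ipC. Qed.

Lemma ip_suml (I : Type) (r : seq I) (p : pred I) (f : I -> S -> R)
    (g : S -> R) : (forall i, p i -> sqi (f i)) -> sqi g ->
  ip (fun x => \sum_(i <- r | p i) f i x) g = \sum_(i <- r | p i) ip (f i) g.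
Proof.
move=> sf sg; elim: r => [|i r IH].
  by rewrite big_nil -[RHS](ip0l g); apply: eq_ip => // x; rewrite big_nil.
rewrite big_cons -IH.
have [pi|pi] := boolP (p i).
  rewrite -ipDl//; try by [exact: sf|exact: sqi_sum].
  by apply: eq_ip => // x; rewrite big_cons pi.
by apply: eq_ip => // x; rewrite big_cons (negbTE pi).
Qed.

Lemma ip_sumr (I : Type) (r : seq I) (p : pred I) (f : I -> S -> R)
    (g : S -> R) : (forall i, p i -> sqi (f i)) -> sqi g ->
  ip g (fun x => \sum_(i <- r | p i) f i x) = \sum_(i <- r | p i) ip g (f i).
Proof.
by move=> sf sg; rewrite ipC ip_suml//; apply: eq_bigr => i pi; rewrite ipC.
Qed.

Lemma ip_ge0 (f : S -> R) : 0 <= ip f f.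
Proof. by apply: Rintegral_ge0 => x _; rewrite -expr2 sqr_ge0. Qed.

Lemma ip_ge0_EFin (f : S -> R) : sqi f ->
  (\int[mu]_x (f x ^+ 2)%:E)%E = (ip f f)%:E.
Proof.
move=> sf; rewrite /ip /Rintegral fineK; last first.
  by apply: integrable_fin_num => //; exact: sqi_mul_integrable.
by apply: eq_integral => x _; rewrite expr2.
Qed.

Lemma sqiP (f : S -> R) : measurable_fun setT f ->
  (\int[mu]_x (f x ^+ 2)%:E < +oo)%E -> sqi f.
Proof.
move=> mf foo; split=> //; apply/integrableP; split.
  by apply/measurable_EFinP; exact: measurable_funX.
rewrite (le_lt_trans _ foo)// ge0_le_integral//.
- apply/measurable_EFinP; apply: measurableT_comp => //.
  exact: measurable_funX.
- by apply/measurable_EFinP; exact: measurable_funX.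
- by move=> x _ /=; rewrite lee_fin ger0_norm// sqr_ge0.
Qed.

Lemma ipDD (f g : S -> R) : sqi f -> sqi g ->
  ip (fun x => f x + g x) (fun x => f x + g x) =
  ip f f + 2 * ip f g + ip g g.
Proof.
move=> sf sg; have sfg := sqiD sf sg.
by rewrite ipDl// !ipDr// (ipC g f); ring.
Qed.

Lemma ipBB (f g : S -> R) : sqi f -> sqi g ->
  ip (fun x => f x - g x) (fun x => f x - g x) =
  ip f f - 2 * ip f g + ip g g.
Proof.
move=> sf sg; have sfg := sqiB sf sg.
by rewrite ipBl// !ipBr// (ipC g f); ring.
Qed.

(** The form |a f + b g|^2 is nonnegative; at (a, b) = (|g|^2, - <f, g>) it is
|g|^2 times the defect in the inequality. *)
Lemma CauchySchwarz (f g : S -> R) : sqi f -> sqi g ->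
  ip f g ^+ 2 <= ip f f * ip g g.
Proof.
move=> sf sg.
have key (a b : R) :
    0 <= a ^+ 2 * ip f f + 2 * (a * b * ip f g) + b ^+ 2 * ip g g.
  have := ip_ge0 (fun x => a * f x + b * g x).
  have sa := sqiZ a sf; have sb := sqiZ b sg.
  by rewrite ipDD// !(ipZl, ipZr)//; congr (_ <= _); ring.
have ff := ip_ge0 f; have gg := ip_ge0 g.
have [g0|g0] := eqVneq (ip g g) 0.
  have [->|h0] := eqVneq (ip f g) 0; first by rewrite expr0n mulr_ge0.
  (* with |g| = 0 the form is affine in its second argument *)
  have := key 1 (- ((1 + ip f f) / ip f g)).
  rewrite g0 mulr0 addr0 expr1n !mul1r mulNr divfK// => H.
  by exfalso; lra.
have := key (ip g g) (- ip f g).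
have {}gg : 0 < ip g g by rewrite lt_neqAle eq_sym g0.
rewrite (_ : _ + _ = ip g g * (ip f f * ip g g - ip f g ^+ 2)); last by ring.
by rewrite pmulr_rge0// subr_ge0.
Qed.

Definition nrm (f : S -> R) : R := Num.sqrt (ip f f).

Lemma nrm_ge0 f : 0 <= nrm f. Proof. exact: sqrtr_ge0. Qed.

Lemma nrm_sqr f : nrm f ^+ 2 = ip f f.
Proof. by rewrite sqr_sqrtr// ip_ge0. Qed.

Lemma ip_le_nrm f g : sqi f -> sqi g -> `|ip f g| <= nrm f * nrm g.
Proof.
move=> sf sg; rewrite -sqrtrM ?ip_ge0// -sqrtr_sqr ler_sqrt ?CauchySchwarz//.
by rewrite mulr_ge0// ip_ge0.
Qed.

Lemma nrmD_le f g : sqi f -> sqi g -> nrm (fun x => f x + g x) <= nrm f + nrm g.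
Proof.
move=> sf sg; rewrite -(@ler_pXn2r _ 2)// ?nnegrE ?addr_ge0 ?nrm_ge0//.
rewrite nrm_sqr ipDD// sqrrD !nrm_sqr lerD2r lerD2l.
by have := le_trans (ler_norm _) (ip_le_nrm sf sg); lra.
Qed.

Lemma ip_sub_le f g f' g' : sqi f -> sqi g -> sqi f' -> sqi g' ->
  `|ip f g - ip f' g'| <=
  nrm f * nrm (fun x => g x - g' x) + nrm (fun x => f x - f' x) * nrm g'.
Proof.
move=> sf sg sf' sg'; have sgg := sqiB sg sg'; have sff := sqiB sf sf'.
have -> : ip f g - ip f' g' =
    ip f (fun x => g x - g' x) + ip (fun x => f x - f' x) g'.
  by rewrite ipBr// ipBl//; ring.
by rewrite (le_trans (ler_normD _ _))// lerD// ip_le_nrm.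
Qed.

Lemma ip_subsq_le f g : sqi f -> sqi g ->
  ip (fun x => f x - g x) (fun x => f x - g x) <= 2 * ip f f + 2 * ip g g.
Proof.
move=> sf sg; have := ip_ge0 (fun x => f x + g x).
rewrite ipDD// ipBl ?ipBr//; try exact: sqiB.
by rewrite (ipC g f); lra.
Qed.

End SquareIntegrable.

(** * Second moment and symmetry of the normal law *)

Section Gaussian.
Context {R : realType}.
Local Notation leb := (@lebesgue_measure R).

Lemma measurable_hypograph (f : R -> R) : measurable_fun setT f ->
  measurable ([set z | 0 <= z.2 < f z.1] : set (measurableTypeR R * measurableTypeR R)).
Proof.
move=> mf.
have m1 : measurable_fun setT
    (fun z : measurableTypeR R * measurableTypeR R => (0 <= z.2) && (z.2 < f z.1)).
  apply: measurable_and.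
    by apply: measurable_fun_ler => //; exact: measurable_snd.
  apply: measurable_fun_ltr; first exact: measurable_snd.
  by apply: measurableT_comp => //; exact: measurable_fst.
have := m1 measurableT [set true] I.
by rewrite setTI; congr measurable; apply/seteqP; split => z.
Qed.

(** Since f x is the length of [0, f x[, both sides are iterated integrals over
the region below the graph of f, taken in the other order. *)
Lemma integral_density (nu : probability (measurableTypeR R) R) (p f : R -> R) :
  measurable_fun setT p -> (forall x, 0 <= p x) ->
  (forall A, measurable A -> nu A = (\int[leb]_(x in A) (p x)%:E)%E) ->
  measurable_fun setT f -> (forall x, 0 <= f x) ->
  (\int[nu]_x (f x)%:E = \int[leb]_x (f x * p x)%:E)%E.
Proof.
move=> mp p0 nuE mf f0.
pose A : set (measurableTypeR R * measurableTypeR R) := [set z | 0 <= z.2 < f z.1].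
have mA : measurable A by exact: measurable_hypograph.
have mAf : measurable_fun setT (fun z => (\1_A z : R)%:E).
  by apply/measurable_EFinP; exact: measurable_indic.
have mAy u : measurable [set x | 0 <= u < f x].
  rewrite (_ : [set x | _] = ysection A u); first exact: measurable_ysection.
  by apply/seteqP; split => x; rewrite /ysection /= inE.
have sec x : (\int[leb]_u (\1_A (x, u))%:E = (f x)%:E)%E.
  transitivity (leb `[0, f x[%classic).
    rewrite -[in RHS](setIT `[0, f x[%classic) -integral_indic//.
  rewrite lebesgue_measure_itv/= lte_fin.
  case: ltP => [_|]; first by rewrite oppr0 adde0.
  by move=> fx; congr EFin; apply/le_anti; rewrite fx f0.
transitivity (\int[nu]_x \int[leb]_u (\1_A (x, u))%:E)%E.
  by apply: eq_integral => x _; rewrite sec.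
rewrite (@fubini_tonelli _ _ _ _ _ nu leb (fun z => (\1_A z)%:E))//.
transitivity (\int[leb]_u \int[leb]_x (\1_A (x, u) * p x)%:E)%E.
  apply: eq_integral => u _.
  transitivity (nu [set x | 0 <= u < f x]).
    rewrite -[in RHS](setIT [set x | 0 <= u < f x]) -integral_indic//.
    exact: mAy.
  rewrite (nuE _ (mAy u)) [LHS]integral_mkcond; apply: eq_integral => x _.
  rewrite patchE indicE; case: ifPn => [|].
    by rewrite inE => h; rewrite mem_set// mul1r.
  by rewrite notin_setE => h; rewrite memNset// mul0r.
rewrite -(@fubini_tonelli _ _ _ _ _ leb leb (fun z => (\1_A z * p z.1)%:E))//.
- apply: eq_integral => x _.
  transitivity (\int[leb]_u ((p x)%:E * (\1_A (x, u))%:E))%E.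
    by apply: eq_integral => u _; rewrite -EFinM mulrC.
  rewrite ge0_integralZl//; last by rewrite lee_fin.
  + by rewrite sec -EFinM mulrC.
  + apply/measurable_EFinP; apply: measurableT_comp => //.
- apply/measurable_EFinP; apply: measurable_funM; first exact: measurable_indic.
  by apply: measurableT_comp => //; exact: measurable_fst.
- by move=> z; rewrite lee_fin mulr_ge0.
Qed.

Section SecondMoment.
Variables (s : R) (s0 : 0 < s).
Local Notation p := (normal_pdf 0 s).

Let pE x : p x = normal_peak s * expR (- x ^+ 2 / (s ^+ 2 *+ 2)).
Proof. by rewrite normal_pdfE ?gt_eqF// /normal_fun subr0. Qed.

(** The function x p(x) has an explicit primitive; this evaluates the first
moment over half-lines, to which the second moment is reduced. *)
Lemma is_derive_normal_pdf (x : R) :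
  is_derive x 1 (fun y : R => - (s ^+ 2 * p y) : R^o) (x * p x).
Proof.
rewrite (_ : (fun y : R => _) =
    (fun y => (- (s ^+ 2 * normal_peak s)) * expR (- (s ^+ 2 *+ 2)^-1 * y ^+ 2))); last first.
  apply/funext => y; rewrite pE.
  rewrite (_ : - y ^+ 2 / _ = - (s ^+ 2 *+ 2)^-1 * y ^+ 2); first by ring.
  by rewrite !mulNr mulrC.
apply: is_derive_eq.
rewrite pE -[_ *: _]/(_ * _).
have -> : - (s ^+ 2 *+ 2)^-1 * x ^+ 2 = - x ^+ 2 / (s ^+ 2 *+ 2) by rewrite mulNr mulrC mulNr.
set e := expR _.
rewrite /GRing.scale /=.
have sn : s != 0 by rewrite gt_eqF.
by field.
Qed.

Lemma cvg_normal_pdf : p x @[x --> +oo] --> (0 : R).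
Proof.
rewrite (_ : (fun x => p x) = (fun x =>
    normal_peak s * expR (- (x ^+ 2 * (s ^+ 2 *+ 2)^-1)))); last first.
  by apply/funext => x; rewrite pE mulNr.
rewrite -[X in _ --> X](mulr0 (normal_peak s)).
apply: cvgM; first exact: cvg_cst.
apply: (cvg_comp (fun x => x ^+ 2 * (s ^+ 2 *+ 2)^-1) (fun x => expR (- x))).
  apply/gt0_cvgMly; last exact: cvgr_expr2.
  by rewrite invr_gt0 pmulrn_lgt0// exprn_gt0.
exact: cvgr_expR.
Qed.

Lemma integral_tail_normal (x : R) : 0 <= x ->
  (\int[leb]_(y in `[x, +oo[) (y * p y)%:E = (s ^+ 2 * p x)%:E)%E.
Proof.
move=> x0.
rewrite (@ge0_continuous_FTC2y _ _ (fun y => - (s ^+ 2 * p y)) _ 0).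
- by rewrite -EFinB sub0r opprK.
- by move=> y xy; rewrite mulr_ge0 ?normal_pdf_ge0// (le_trans x0).
- apply: continuous_subspaceT => y.
  by apply: cvgM => //; apply: continuous_normal_pdf; rewrite gt_eqF.
- rewrite -[X in _ --> X]oppr0 -[X in _ --> - X](mulr0 (s ^+ 2)).
  apply: cvgN; apply: cvgM; first exact: cvg_cst.
  exact: cvg_normal_pdf.
- by move=> y _; have := is_derive_normal_pdf y; case.
- apply: cvg_at_right_filter; apply: cvgN; apply: cvgM; first exact: cvg_cst.
  by apply: continuous_normal_pdf; rewrite gt_eqF.
- by move=> y _; rewrite derive1E; have [_ ->] := is_derive_normal_pdf y.
Qed.

(** On the half-line x^2 = x \int_0^x du; exchanging the integrals leaves the
tails of x p(x), that is s^2 p(u), whose integral is s^2 / 2. *)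
Lemma normal_second_moment_pdf :
  (\int[leb]_x (x ^+ 2 * p x)%:E = (s ^+ 2)%:E)%E.
Proof.
have mp : measurable_fun setT p by exact: measurable_normal_pdf.
have cp : continuous p by apply: continuous_normal_pdf; rewrite gt_eqF.
have ep : p =1 p \o -%R by move=> x /=; rewrite !pE sqrrN.
rewrite ge0_symfun_integralT//; last 3 first.
- by move=> x; rewrite mulr_ge0 ?sqr_ge0 ?normal_pdf_ge0.
- by move=> x; apply: cvgM; [exact: exprn_continuous|exact: cp].
- by move=> x /=; rewrite sqrrN {1}ep.
have -> : [set x : R | 0 <= x] = `[0, +oo[%classic.
  by apply/seteqP; split => x/=; rewrite in_itv/= andbT.
pose A : set (measurableTypeR R * measurableTypeR R) := [set z | 0 <= z.2 < z.1].
have mA : measurable A by exact: (@measurable_hypograph id).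
pose h (z : measurableTypeR R * measurableTypeR R) : \bar R :=
  (\1_A z * (z.1 * p z.1))%:E.
have mh : measurable_fun setT h.
  apply/measurable_EFinP; apply: measurable_funM; first exact: measurable_indic.
  apply: measurable_funM; first exact: measurable_fst.
  by apply: measurableT_comp => //; exact: measurable_fst.
have h0 z : (0 <= h z)%E.
  rewrite lee_fin /A indicE; case: (boolP (z \in _)); last by rewrite mul0r.
  rewrite inE /= => /andP[z2 /ltW z1].
  by rewrite mul1r mulr_ge0 ?normal_pdf_ge0// (le_trans z2).
have e1 : (\int[leb]_(x in `[0%R, +oo[) (x ^+ 2 * p x)%:E =
    \int[leb]_x \int[leb]_u h (x, u))%E.
  rewrite integral_mkcond; apply: eq_integral => x _; rewrite patchE.
  case: ifPn => [|]; rewrite ?notin_setE ?inE/= in_itv/= andbT => x0.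
    transitivity (\int[leb]_u ((x * p x)%:E * (\1_`[0%R, x[ u)%:E))%E.
      rewrite ge0_integralZl//.
      + rewrite integral_indic//= setIT lebesgue_measure_itv/= lte_fin.
        case: ltP => [_|x0'].
          by rewrite oppr0 adde0 -EFinM; congr EFin; ring.
        by rewrite mule0 (@le_anti _ _ x 0) ?x0 ?x0'// expr0n mul0r.
      + by apply/measurable_EFinP; exact: measurable_indic.
      + by rewrite lee_fin mulr_ge0 ?normal_pdf_ge0.
    apply: eq_integral => u _; rewrite -EFinM /h/= mulrC; congr (_ * _)%:E.
  rewrite integral0_eq// => u _; rewrite /h /= indicE memNset ?mul0r// /A /=.
  by move=> /andP[u0 ux]; apply: x0; rewrite (le_trans u0 (ltW ux)).
rewrite e1 fubini_tonelli//.
transitivity (2%:E * \int[leb]_(u in `[0%R, +oo[) (s ^+ 2 * p u)%:E)%E.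
  congr (_ * _)%E; rewrite [RHS]integral_mkcond; apply: eq_integral => u _.
  rewrite patchE; case: ifPn => [|]; rewrite ?notin_setE ?inE/= in_itv/= andbT => u0.
    rewrite -integral_tail_normal// -integral_itv_obnd_cbnd; last first.
      apply/measurable_EFinP; apply: measurable_funTS.
      exact: measurable_funM.
    rewrite [RHS]integral_mkcond; apply: eq_integral => x _.
    rewrite patchE /h /= indicE; case: ifPn => [|].
      rewrite inE /= in_itv/= andbT => ux; rewrite mem_set ?mul1r//.
      by rewrite /A /= u0.
    rewrite notin_setE /= in_itv/= andbT => ux; rewrite memNset ?mul0r//.
    by rewrite /A /= u0.
  rewrite integral0_eq// => x _; rewrite /h /= indicE memNset ?mul0r// /A /=.
  by move=> /andP[].
under eq_integral do rewrite EFinM.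
rewrite ge0_integralZl//; last 3 first.
- by apply/measurable_EFinP; exact: measurable_funTS.
- by move=> x _; rewrite lee_fin normal_pdf_ge0.
- by rewrite lee_fin sqr_ge0.
have := @integral_normal_pdf R 0 s.
rewrite ge0_symfun_integralT//; last first.
  by move=> x; exact: normal_pdf_ge0.
have -> : [set x : R | 0 <= x] = `[0, +oo[%classic.
  by apply/seteqP; split => x/=; rewrite in_itv/= andbT.
by rewrite muleCA => ->; rewrite mule1.
Qed.

End SecondMoment.

Lemma normal_second_moment (s : R) : 0 < s ->
  (\int[normal_prob 0 s]_x (x ^+ 2)%:E = (s ^+ 2)%:E)%E.
Proof.
move=> s0; rewrite (@integral_density (normal_prob 0 s) (normal_pdf 0 s))//.
- exact: normal_second_moment_pdf.
- exact: measurable_normal_pdf.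
- by move=> x; exact: normal_pdf_ge0.
- by move=> x; exact: sqr_ge0.
Qed.

Lemma normal_probN (s : R) (A : set R) : 0 < s -> measurable A ->
  normal_prob 0 s (-%R @^-1` A) = normal_prob 0 s A.
Proof.
move=> s0 mA; rewrite /normal_prob.
have mN : measurable_fun setT (-%R : measurableTypeR R -> measurableTypeR R) by exact: oppr_measurable.
rewrite [RHS](_ : _ = (\int[pushforward leb (-%R : _ -> measurableTypeR R)]_(x in A)
  (normal_pdf 0 s x)%:E)%E); last first.
  by apply: eq_measure_integral => B mB _; exact/esym/lebesgue_measureN.
rewrite ge0_integral_pushforward//.
- apply: eq_integral => x _ /=.
  by rewrite !normal_pdfE ?gt_eqF// /normal_fun !subr0 sqrrN.
- by apply/measurable_EFinP; apply: measurable_funTS; exact: measurable_normal_pdf.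
- by move=> x _; rewrite lee_fin normal_pdf_ge0.
Qed.

End Gaussian.

(** * Product measures, independence and sub-sigma-algebras *)

Lemma integral_EFin d (S : measurableType d) (R : realType)
    (mu : {measure set S -> \bar R}) (D : set S) (f : S -> R) :
  measurable D -> mu.-integrable D (EFin \o f) ->
  (\int[mu]_(x in D) (f x)%:E)%E = (\int[mu]_(x in D) f x)%:E.
Proof. by move=> mD fi; rewrite /Rintegral fineK// integrable_fin_num. Qed.

Section ProductIntegral.
Context d1 d2 (T1 : measurableType d1) (T2 : measurableType d2) (R : realType).
Variable m1 : {sigma_finite_measure set T1 -> \bar R}.
Variable m2 : {sigma_finite_measure set T2 -> \bar R}.
Variables (g : T1 -> R) (h : T2 -> R).
Hypothesis ig : m1.-integrable setT (EFin \o g).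
Hypothesis ih : m2.-integrable setT (EFin \o h).

Let mg : measurable_fun setT g.
Proof. by apply/measurable_EFinP; exact: measurable_int ig. Qed.

Let mh : measurable_fun setT h.
Proof. by apply/measurable_EFinP; exact: measurable_int ih. Qed.

Lemma tensor_integrable :
  (m1 \x m2)%E.-integrable setT (fun z => (g z.1 * h z.2)%:E).
Proof.
apply/integrable12ltyP.
  apply/measurable_EFinP; apply: measurable_funM.
    by apply: measurableT_comp => //; exact: measurable_fst.
  by apply: measurableT_comp => //; exact: measurable_snd.
rewrite (eq_integral (fun x => `|(g x)%:E| * \int[m2]_y `|(h y)%:E|)%E); last first.
  move=> x _ /=; rewrite -ge0_integralZl//.
  - by apply: eq_integral => y _; rewrite normrM EFinM.
  - by apply/measurable_EFinP; exact: measurableT_comp.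
have hf : (\int[m2]_y `|(h y)%:E| < +oo)%E by have /integrableP[] := ih.
rewrite ge0_integralZr//; last 2 first.
- by apply: measurableT_comp => //; exact/measurable_EFinP.
- by apply: integral_ge0.
have gf : (\int[m1]_y `|(g y)%:E| < +oo)%E by have /integrableP[] := ig.
rewrite lte_mul_pinfty//; first exact: integral_ge0.
by rewrite ge0_fin_numE//; exact: integral_ge0.
Qed.

Lemma tensor_integral :
  (\int[m1 \x m2]_z (g z.1 * h z.2)%:E)%E =
  ((\int[m1]_x g x) * (\int[m2]_x h x))%:E.
Proof.
rewrite -(integral12_prod_meas1 tensor_integrable) /fubini_F /=.
rewrite (eq_integral (fun x => (g x)%:E * (\int[m2]_x h x)%:E)%E); last first.
  by move=> x _; rewrite -integral_EFin// -integralZl.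
by rewrite integralZr// EFinM integral_EFin.
Qed.

End ProductIntegral.

Section Independence.
Context {d : measure_display} {Omega : measurableType d} {R : realType}.
Variable P : probability Omega R.

Definition indep_rv (f g : Omega -> R) : Prop :=
  forall A B : set R, measurable A -> measurable B ->
  P ((f @^-1` A) `&` (g @^-1` B)) = (P (f @^-1` A) * P (g @^-1` B))%E.

Lemma indep_rv_comp (f g : Omega -> R) (u v : R -> R) :
  measurable_fun setT u -> measurable_fun setT v ->
  indep_rv f g -> indep_rv (u \o f) (v \o g).
Proof.
move=> mu mv fg A B mA mB.
apply: (fg (u @^-1` A) (v @^-1` B)).
  by have := mu measurableT A mA; rewrite setTI.
by have := mv measurableT B mB; rewrite setTI.
Qed.

(** The joint law is the product of the marginal laws because the two agree on
rectangles, so Fubini factorises the expectation. *)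
Lemma indep_rv_mul (f g : Omega -> R) :
  P.-integrable setT (EFin \o f) -> P.-integrable setT (EFin \o g) ->
  indep_rv f g ->
  P.-integrable setT (EFin \o (fun w => f w * g w)) /\
  \int[P]_w (f w * g w) = (\int[P]_w f w) * (\int[P]_w g w).
Proof.
move=> fi gi fg.
have mf : measurable_fun setT f by apply/measurable_EFinP; exact: measurable_int fi.
have mg : measurable_fun setT g by apply/measurable_EFinP; exact: measurable_int gi.
pose F : {mfun Omega >-> R} :=
  HB.pack f (isMeasurableFun.Build _ _ _ _ _ mf).
pose G : {mfun Omega >-> R} :=
  HB.pack g (isMeasurableFun.Build _ _ _ _ _ mg).
have mh : measurable_fun setT
    (fun w => (f w, g w) : (R * R)%type).
  exact: measurable_fun_pair.
pose H : {mfun Omega >-> (R * R)%type} :=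
  HB.pack (fun w => (f w, g w) : (R * R)%type)
    (isMeasurableFun.Build _ _ _ _ _ mh).
have idF : (distribution P F).-integrable setT (EFin \o id).
  apply: integrable_pushforward => //.
  by apply/measurable_EFinP; exact: measurable_id.
have idG : (distribution P G).-integrable setT (EFin \o id).
  apply: integrable_pushforward => //.
  by apply/measurable_EFinP; exact: measurable_id.
have HE A : measurable A ->
    (distribution P F \x distribution P G)%E A = distribution P H A.
  apply: product_measure_unique => B C mB mC.
  by rewrite /distribution /pushforward /= -fg.
have mxy : measurable_fun setT
    (fun z : (R * R)%type => (z.1 * z.2)%:E).
  apply/measurable_EFinP; apply: measurable_funM.
    exact: measurable_fst.
  exact: measurable_snd.
have I1 : P.-integrable setT (EFin \o (fun w => f w * g w)).
  apply/integrableP; split.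
    by apply/measurable_EFinP; exact: measurable_funM.
  have /integrableP[_] := tensor_integrable idF idG.
  rewrite (@eq_measure_integral _ _ _ _ (distribution P H)); last first.
    by move=> A mA _; exact: HE.
  rewrite ge0_integral_distribution//.
  exact: measurableT_comp.
split => //.
apply: EFin_inj; rewrite -integral_EFin//.
have := tensor_integral idF idG.
rewrite (@eq_measure_integral _ _ _ _ (distribution P H)); last first.
  by move=> A mA _; exact: HE.
rewrite integral_distribution//=.
move=> ->; congr (_ * _)%:E.
  by rewrite /Rintegral integral_distribution.
by rewrite /Rintegral integral_distribution.
Qed.

End Independence.

Section SubSigmaAlgebra.
Context {T : pointedType} {R : realType}.
Variables (G : set (set T)) (sG : sigma_algebra setT G).
Implicit Types Y Z : T -> R.

Definition meas_in Y : Prop := forall B : set R, measurable B -> G (Y @^-1` B).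

(** Closure of [meas_in] under the algebraic operations is inherited from
measurable functions through this equivalence. *)
Lemma meas_inP Y :
  meas_in Y <-> measurable_fun (setT : set (g_sigma_algebraType G)) Y.
Proof.
split => [h _ B mB|h B mB].
  by rewrite setTI /measurable /= sigma_algebra_id//; exact: h.
have := h measurableT B mB.
by rewrite setTI /measurable /= sigma_algebra_id.
Qed.

Lemma meas_in_cst (c : R) : meas_in (fun=> c).
Proof. by apply/meas_inP; exact: measurable_cst. Qed.

Lemma meas_inD Y Z : meas_in Y -> meas_in Z -> meas_in (fun w => Y w + Z w).
Proof. by move=> /meas_inP hY /meas_inP hZ; apply/meas_inP; exact: measurable_funD. Qed.

Lemma meas_inB Y Z : meas_in Y -> meas_in Z -> meas_in (fun w => Y w - Z w).
Proof. by move=> /meas_inP hY /meas_inP hZ; apply/meas_inP; exact: measurable_funB. Qed.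

Lemma meas_inM Y Z : meas_in Y -> meas_in Z -> meas_in (fun w => Y w * Z w).
Proof. by move=> /meas_inP hY /meas_inP hZ; apply/meas_inP; exact: measurable_funM. Qed.

Lemma meas_in_sum (I : eqType) (r : seq I) (Y : I -> T -> R) :
  (forall i, i \in r -> meas_in (Y i)) -> meas_in (fun w => \sum_(i <- r) Y i w).
Proof.
elim: r => [|i r IH] h.
  rewrite (_ : (fun _ => _) = fun=> 0); first exact: meas_in_cst.
  by apply/funext => w; rewrite big_nil.
rewrite (_ : (fun _ => _) = fun w => Y i w + \sum_(i <- r) Y i w); last first.
  by apply/funext => w; rewrite big_cons.
apply: meas_inD; first by apply: h; rewrite mem_head.
by apply: IH => j jr; apply: h; rewrite inE jr orbT.
Qed.

Lemma meas_in_cut Y Q (K : R) : meas_in Y -> meas_in Q ->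
  meas_in (fun w => if Q w <= K then Y w else 0).
Proof.
move=> /meas_inP hY /meas_inP hQ; apply/meas_inP.
apply: measurable_fun_ifT => //.
by apply: measurable_fun_ler.
Qed.

End SubSigmaAlgebra.

(** * Increments of a Brownian motion *)

Section Brownian.
Context {R : realType} {d : measure_display} {Omega : measurableType d}.
Variables (T : R) (P : probability Omega R) (F : R -> set (set Omega)).
Hypothesis HF : filtration T F.

Lemma filtration_sigma (t : R) : 0 <= t <= T -> sigma_algebra setT (F t).
Proof. by move=> ht; have [h _] := HF; have [] := h t ht. Qed.

Lemma measurable_at_le (s t : R) (Y : Omega -> R) : 0 <= s -> s <= t -> t <= T ->
  measurable_at F s Y -> measurable_at F t Y.
Proof.
by move=> s0 st tT h B mB; have [_ +] := HF; apply; [exact: s0|exact: st|exact: tT|exact: h].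
Qed.

Lemma measurable_at_fun (t : R) (Y : Omega -> R) : 0 <= t <= T ->
  measurable_at F t Y -> measurable_fun setT Y.
Proof.
move=> ht h _ B mB; rewrite setTI.
by have [+ _] := HF => /(_ t ht)[_]; apply; exact: h.
Qed.

Definition incr (W : R -> Omega -> R) (s t : R) (w : Omega) : R := W t w - W s w.

Lemma incr_split (W : R -> Omega -> R) (s u t : R) :
  incr W s t =1 (fun w => incr W s u w + incr W u t w).
Proof. by move=> w; rewrite /incr; ring. Qed.

Lemma sqi_cst (c : R) : sqi P (fun=> c).
Proof.
split; first exact: measurable_cst.
exact: finite_measure_integrable_cst.
Qed.

Lemma sqi_integrable (f : Omega -> R) : sqi P f ->
  P.-integrable setT (EFin \o f).
Proof.
move=> /sqi_mul_integrable /(_ (sqi_cst 1)).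
by apply: eq_integrable => // x _ /=; rewrite mulr1.
Qed.

Section OneMotion.
Variable W : R -> Omega -> R.
Hypothesis HW : brownian_motion T P F W.

Lemma incr_measurable_at (s t : R) : 0 <= s -> s <= t -> t <= T ->
  measurable_at F t (incr W s t).
Proof.
move=> s0 st tT; have ht : 0 <= t <= T by rewrite tT (le_trans s0 st).
apply: (meas_inB (filtration_sigma ht)).
  exact: (bm_adapted HW).
apply: (@measurable_at_le s) => //.
by apply: (bm_adapted HW); rewrite s0 (le_trans st).
Qed.

Lemma incr_measurable (s t : R) : 0 <= s -> s <= t -> t <= T ->
  measurable_fun setT (incr W s t).
Proof.
move=> s0 st tT; have ht : 0 <= t <= T by rewrite tT (le_trans s0 st).
exact: (measurable_at_fun ht (incr_measurable_at s0 st tT)).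
Qed.

Lemma incr_same (s : R) : incr W s s = fun=> 0.
Proof. by apply/funext => w; rewrite /incr subrr. Qed.

Lemma incr_second_moment (s t : R) : 0 <= s -> s <= t -> t <= T ->
  (\int[P]_w (incr W s t w ^+ 2)%:E = (t - s)%:E)%E.
Proof.
move=> s0; rewrite le_eqVlt => /predU1P[<- _|st tT].
  rewrite incr_same subrr integral0_eq// => w _; by rewrite expr0n.
have mI := incr_measurable s0 (ltW st) tT.
have ts : 0 < t - s by rewrite subr_gt0.
have mI' : measurable_fun setT (incr W s t : Omega -> measurableTypeR R) by [].
pose X : {mfun Omega >-> measurableTypeR R} := HB.pack
  (incr W s t : Omega -> measurableTypeR R) (isMeasurableFun.Build _ _ _ _ _ mI').
transitivity (\int[distribution P X]_x (x ^+ 2)%:E)%E.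
  rewrite ge0_integral_distribution//.
    by apply/measurable_EFinP; exact: measurable_funX.
  by move=> y; rewrite lee_fin sqr_ge0.
rewrite (@eq_measure_integral _ _ _ _ (normal_prob 0 (Num.sqrt (t - s)))); last first.
  by move=> A mA _; exact: (bm_gaussian HW).
by rewrite normal_second_moment ?sqr_sqrtr ?sqrtr_gt0// ltW.
Qed.

Lemma incr_sqi (s t : R) : 0 <= s -> s <= t -> t <= T -> sqi P (incr W s t).
Proof.
move=> s0 st tT; apply: sqiP; first exact: incr_measurable.
by rewrite incr_second_moment// ltry.
Qed.

Lemma incr_ip (s t : R) : 0 <= s -> s <= t -> t <= T ->
  ip P (incr W s t) (incr W s t) = t - s.
Proof.
move=> s0 st tT; apply: EFin_inj; rewrite -ip_ge0_EFin ?incr_second_moment//.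
exact: incr_sqi.
Qed.

(** The law of an increment is symmetric, so its mean equals its own opposite. *)
Lemma incr_mean (s t : R) : 0 <= s -> s <= t -> t <= T ->
  \int[P]_w incr W s t w = 0.
Proof.
move=> s0; rewrite le_eqVlt => /predU1P[<- _|st tT].
  by rewrite incr_same Rintegral_cst// mul0r.
have mI := incr_measurable s0 (ltW st) tT.
have iI := sqi_integrable (incr_sqi s0 (ltW st) tT).
have mN : measurable_fun setT (fun w => - incr W s t w) by exact: measurableT_comp.
have iN : P.-integrable setT (EFin \o (fun w => - incr W s t w)).
  have := integrableN iI.
  by apply: eq_integrable => // x _ /=; rewrite EFinN.
have ts : 0 < Num.sqrt (t - s) by rewrite sqrtr_gt0 subr_gt0.
pose X : {mfun Omega >-> R} := HB.pack (incr W s t) (isMeasurableFun.Build _ _ _ _ _ mI).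
pose Y : {mfun Omega >-> R} := HB.pack (fun w => - incr W s t w) (isMeasurableFun.Build _ _ _ _ _ mN).
have mid : measurable_fun [set: R] (EFin \o id).
  by apply/measurable_EFinP; exact: measurable_id.
have XY : \int[P]_w incr W s t w = \int[P]_w (- incr W s t w).
  rewrite /Rintegral; congr fine.
  rewrite -(@integral_distribution _ _ _ _ _ P X (EFin \o id))//.
  rewrite -(@integral_distribution _ _ _ _ _ P Y (EFin \o id))//.
  apply: eq_measure_integral => A mA _.
  have e1 : distribution P X A = normal_prob 0 (Num.sqrt (t - s)) A.
    exact: (bm_gaussian HW).
  have mNA : measurable (-%R @^-1` A : set R).
    by have := @oppr_measurable R setT measurableT A mA; rewrite setTI.
  have e2 : distribution P Y A = normal_prob 0 (Num.sqrt (t - s)) (-%R @^-1` A).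
    exact: (bm_gaussian HW s0 st tT mNA).
  exact: etrans e1 (etrans (esym (normal_probN ts mA)) (esym e2)).
have : \int[P]_w (- incr W s t w) = - \int[P]_w incr W s t w.
  rewrite -mulN1r -RintegralZl//.
  by apply: eq_Rintegral => w _; rewrite mulN1r.
by rewrite -XY; lra.
Qed.

Lemma incr_indep (s t : R) (xi : Omega -> R) : 0 <= s -> s <= t -> t <= T ->
  measurable_at F s xi -> indep_rv P xi (incr W s t).
Proof.
move=> s0; rewrite le_eqVlt => /predU1P[<- sT|st tT] hxi A B mA mB.
  rewrite incr_same; have [B0|B0] := pselect (B 0).
    rewrite (_ : _ @^-1` B = setT) ?setIT ?probability_setT ?mule1//.
    by apply/seteqP; split.
  rewrite (_ : _ @^-1` B = set0) ?setI0 ?measure0 ?mule0//.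
  by apply/seteqP; split.
exact: (bm_indep HW s0 st tT (hxi A mA) mB).
Qed.

Lemma sqi_step (s t : R) (eta : Omega -> R) : 0 <= s -> s <= t -> t <= T ->
  measurable_at F s eta -> sqi P eta -> sqi P (fun w => eta w * incr W s t w).
Proof.
move=> s0 st tT heta seta; have sI := incr_sqi s0 st tT.
split; first by apply: measurable_funM; [exact: seta.1|exact: sI.1].
have [+ _] := @indep_rv_mul _ _ _ P (fun w => eta w ^+ 2) (fun w => incr W s t w ^+ 2)
  seta.2 sI.2 (indep_rv_comp (exprn_measurable 2) (exprn_measurable 2)
    (incr_indep s0 st tT heta)).
by apply: eq_integrable => // w _ /=; rewrite exprMn.
Qed.

(** The factor xi * eta belongs to the past of s, hence is independent of the
increment, whose mean is 0. *)
Lemma ip_future (s t : R) (xi eta : Omega -> R) : 0 <= s -> s <= t -> t <= T ->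
  measurable_at F s xi -> sqi P xi -> measurable_at F s eta -> sqi P eta ->
  ip P xi (fun w => eta w * incr W s t w) = 0.
Proof.
move=> s0 st tT hxi sxi heta seta.
have hs : 0 <= s <= T by rewrite s0 (le_trans st).
have h := meas_inM (filtration_sigma hs) hxi heta.
have [_] := indep_rv_mul (sqi_mul_integrable sxi seta)
  (sqi_integrable (incr_sqi s0 st tT)) (incr_indep s0 st tT h).
rewrite incr_mean// mulr0 => <-.
by apply: eq_Rintegral => w _; rewrite mulrA.
Qed.

(** Same factorisation as in [ip_future], with the square of the increment. *)
Lemma ip_present (s t : R) (xi eta : Omega -> R) : 0 <= s -> s <= t -> t <= T ->
  measurable_at F s xi -> sqi P xi -> measurable_at F s eta -> sqi P eta ->
  ip P (fun w => xi w * incr W s t w) (fun w => eta w * incr W s t w) =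
  (t - s) * ip P xi eta.
Proof.
move=> s0 st tT hxi sxi heta seta.
have hs : 0 <= s <= T by rewrite s0 (le_trans st).
have h := meas_inM (filtration_sigma hs) hxi heta.
have [_] := indep_rv_mul (sqi_mul_integrable sxi seta) (incr_sqi s0 st tT).2
  (indep_rv_comp (@measurable_id _ _ setT) (exprn_measurable 2)
    (incr_indep s0 st tT h)).
have -> : \int[P]_w (incr W s t w ^+ 2) = t - s.
  rewrite -(incr_ip s0 st tT); apply: eq_Rintegral => w _; by rewrite expr2.
rewrite [RHS]mulrC => <-.
by apply: eq_Rintegral => w _; ring.
Qed.

End OneMotion.

End Brownian.

(** * Independent motions have orthogonal increments *)

Section Bracket.
Context {R : realType} {d : measure_display} {Omega : measurableType d}.
Variables (T : R) (P : probability Omega R) (F : R -> set (set Omega)).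
Hypothesis HF : filtration T F.

(** The admissible values of a simple process at time t. *)
Definition bounded_at (t : R) (eta : Omega -> R) : Prop :=
  measurable_at F t eta /\ exists M : R, forall w, `|eta w| <= M.

Lemma bounded_at_sqi (t : R) (eta : Omega -> R) : 0 <= t <= T -> bounded_at t eta -> sqi P eta.
Proof.
move=> ht [meta [M etaM]].
have me := measurable_at_fun HF ht meta.
apply: sqiP => //.
apply: (@le_lt_trans _ _ (\int[P]_w (cst (M ^+ 2)%:E) w)%E); last first.
  by rewrite integral_cst//= probability_setT mule1 ltry.
apply: ge0_le_integral => //.
- by move=> w _; rewrite lee_fin sqr_ge0.
- by apply/measurable_EFinP; exact: measurable_funX.
- move=> w _; rewrite lee_fin -ler_sqrt ?sqr_ge0// !sqrtr_sqr.
  by rewrite (le_trans (etaM w))// ler_norm.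
Qed.

Lemma bounded_at_le (s t : R) (eta : Omega -> R) : 0 <= s -> s <= t -> t <= T ->
  bounded_at s eta -> bounded_at t eta.
Proof.
by move=> s0 st tT [h b]; split=> //; exact: (measurable_at_le HF s0 st tT h).
Qed.

Lemma bounded_atM (t : R) (eta xi : Omega -> R) : 0 <= t <= T ->
  bounded_at t eta -> bounded_at t xi -> bounded_at t (fun w => eta w * xi w).
Proof.
move=> ht [m1 [M1 b1]] [m2 [M2 b2]]; split.
  exact: (meas_inM (filtration_sigma HF ht)).
exists (M1 * M2) => w; rewrite normrM ler_pM//.
Qed.

Definition indep_motions (W V : R -> Omega -> R) : Prop :=
  forall A B, sigma_of_process T W A -> sigma_of_process T V B ->
  P (A `&` B) = (P A * P B)%E.

Lemma incr_meas_in (W : R -> Omega -> R) (s t : R) : 0 <= s -> s <= t -> t <= T ->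
  meas_in (sigma_of_process T W) (incr W s t).
Proof.
move=> s0 st tT; apply: meas_inB; first exact: smallest_sigma_algebra.
- move=> B mB; apply: sub_sigma_algebra; exists t, B.
  by split => //; rewrite tT (le_trans s0).
- move=> B mB; apply: sub_sigma_algebra; exists s, B.
  by split => //; rewrite s0 (le_trans st).
Qed.

Lemma indep_motions_rv (W V : R -> Omega -> R) (f g : Omega -> R) :
  indep_motions W V -> meas_in (sigma_of_process T W) f ->
  meas_in (sigma_of_process T V) g -> indep_rv P f g.
Proof. by move=> WV hf hg A B mA mB; apply: WV; [exact: hf|exact: hg]. Qed.

Lemma ip_incr_future (W : R -> Omega -> R) (s t u v : R) :
  brownian_motion T P F W -> 0 <= s -> s <= t -> t <= u -> u <= v -> v <= T ->
  ip P (incr W s t) (incr W u v) = 0.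
Proof.
move=> HW s0 st tu uv vT.
have t0 := le_trans s0 st; have u0 := le_trans t0 tu; have uT := le_trans uv vT.
have hu : 0 <= u <= T by rewrite u0.
have tT := le_trans tu uT.
rewrite -(@ip_future _ _ _ T P F HF W HW u v (incr W s t) (fun=> 1))//.
- by apply: eq_ip => // w; rewrite mul1r.
- apply: (measurable_at_le HF t0 tu uT).
  exact: (incr_measurable_at HF HW).
- exact: (incr_sqi HF HW).
- exact: (meas_in_cst (filtration_sigma HF hu)).
- exact: sqi_cst.
Qed.

Section IndependentMotions.
Variables W V : R -> Omega -> R.
Hypothesis HW : brownian_motion T P F W.
Hypothesis HV : brownian_motion T P F V.
Hypothesis WV : indep_motions W V.
Variables a b : R.
Hypotheses (a0 : 0 <= a) (ab : a <= b) (bT : b <= T).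
Variables xi eta : Omega -> R.
Hypotheses (hxi : bounded_at a xi) (heta : bounded_at a eta).

Let aT : 0 <= a <= T. Proof. by rewrite a0 (le_trans ab). Qed.

Section Partition.
Variable m : nat.
Let h : R := (b - a) / m.+1%:R.
Let t (i : nat) : R := a + h * i%:R.

Let h0 : 0 <= h. Proof. by rewrite divr_ge0// subr_ge0. Qed.

Let ta (i : nat) : a <= t i. Proof. by rewrite lerDl mulr_ge0. Qed.

Let t_ge0 (i : nat) : 0 <= t i. Proof. exact: le_trans (ta i). Qed.

Let t_le (i j : nat) : (i <= j)%N -> t i <= t j.
Proof. by move=> ij; rewrite lerD2l ler_wpM2l// ler_nat. Qed.

Let t_last : t m.+1 = b.
Proof. by rewrite /t /h divfK ?pnatr_eq0//; ring. Qed.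

Let tT (i : nat) : (i <= m.+1)%N -> t i <= T.
Proof. by move=> /t_le/le_trans; apply; rewrite t_last. Qed.

Let tS (i : nat) : t i.+1 - t i = h.
Proof. by rewrite /t -natr1; ring. Qed.

Let incr_sum (U : R -> Omega -> R) (w : Omega) :
  incr U a b w = \sum_(i < m.+1) incr U (t i) (t i.+1) w.
Proof.
rewrite -(big_mkord predT (fun i => incr U (t i) (t i.+1) w)).
rewrite telescope_sumr// t_last /t mulr0 addr0//.
Qed.

Let covariation (w : Omega) : R :=
  \sum_(i < m.+1) incr W (t i) (t i.+1) w * incr V (t i) (t i.+1) w.

Let sqi_prod (i : 'I_m.+1) :
  sqi P (fun w => incr W (t i) (t i.+1) w * incr V (t i) (t i.+1) w).
Proof.
have [[t0 tt] tT'] := (t_ge0 i, t_le (leqnSn i), tT (ltn_ord i)).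
have sW := incr_sqi HF HW t0 tt tT'; have sV := incr_sqi HF HV t0 tt tT'.
split; first by apply: measurable_funM; [exact: sW.1|exact: sV.1].
have [+ _] := indep_rv_mul sW.2 sV.2 (indep_rv_comp (exprn_measurable 2)
  (exprn_measurable 2) (indep_motions_rv WV (incr_meas_in (W := W) t0 tt tT')
   (incr_meas_in (W := V) t0 tt tT'))).
by apply: eq_integrable => // w _ /=; rewrite exprMn.
Qed.

Let ip_incr (U : R -> Omega -> R) (i j : 'I_m.+1) : brownian_motion T P F U ->
  ip P (incr U (t i) (t i.+1)) (incr U (t j) (t j.+1)) = if i == j then h else 0.
Proof.
move=> HU; case: (ltngtP i j) => ij.
- rewrite (_ : i == j = false); last by rewrite -val_eqE /= ltn_eqF.
  by apply: ip_incr_future => //; [exact: t_le|exact: t_le|exact: t_le|exact: tT].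
- rewrite (_ : i == j = false); last by rewrite -val_eqE /= gtn_eqF.
  rewrite ipC.
  by apply: ip_incr_future => //; [exact: t_le|exact: t_le|exact: t_le|exact: tT].
- have -> : j = i by apply/val_inj; rewrite /= ij.
  rewrite eqxx (incr_ip HF HU) ?tS//.
  + exact: t_le.
  + exact: tT.
Qed.

Let ip_prod (i j : 'I_m.+1) :
  ip P (fun w => incr W (t i) (t i.+1) w * incr V (t i) (t i.+1) w)
       (fun w => incr W (t j) (t j.+1) w * incr V (t j) (t j.+1) w) =
  if i == j then h ^+ 2 else 0.
Proof.
have [[t0 tt] tT'] := (t_ge0 i, t_le (leqnSn i), tT (ltn_ord i)).
have [[t0' tt'] tT''] := (t_ge0 j, t_le (leqnSn j), tT (ltn_ord j)).
have iU U (HU : brownian_motion T P F U) :=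
  sqi_mul_integrable (incr_sqi HF HU t0 tt tT') (incr_sqi HF HU t0' tt' tT'').
have mU (U : R -> Omega -> R) : meas_in (sigma_of_process T U)
    (fun w => incr U (t i) (t i.+1) w * incr U (t j) (t j.+1) w).
  apply: meas_inM; first exact: smallest_sigma_algebra.
    by apply: incr_meas_in.
  by apply: incr_meas_in.
have [_ E] := indep_rv_mul (iU _ HW) (iU _ HV) (indep_motions_rv WV (mU W) (mU V)).
transitivity (\int[P]_w (incr W (t i) (t i.+1) w * incr W (t j) (t j.+1) w *
    (incr V (t i) (t i.+1) w * incr V (t j) (t j.+1) w))).
  by apply: eq_Rintegral => w _; ring.
rewrite E; have := ip_incr i j HW; have := ip_incr i j HV; rewrite /ip => -> ->.
by case: eqP; rewrite ?mul0r ?expr2.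
Qed.

Let ip_covariation : ip P covariation covariation = m.+1%:R * h ^+ 2.
Proof.
have sqic : sqi P covariation by apply: sqi_sum => i _; exact: sqi_prod.
rewrite {1}/covariation ip_suml//.
rewrite (eq_bigr (fun=> h ^+ 2)).
  by rewrite sumr_const card_ord mulr_natl.
move=> i _; rewrite /covariation ip_sumr//.
rewrite (bigD1 i)//= ip_prod eqxx big1 ?addr0// => j ji.
by rewrite ip_prod eq_sym (negbTE ji).
Qed.

Let ip_increments :
  ip P (fun w => xi w * incr W a b w) (fun w => eta w * incr V a b w) =
  ip P (fun w => xi w * eta w) covariation.
Proof.
pose f i w := xi w * incr W (t i) (t i.+1) w.
pose g i w := eta w * incr V (t i) (t i.+1) w.
have hx i : (i <= m.+1)%N -> bounded_at (t i) xi.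
  by move=> im; apply: (bounded_at_le a0 (ta i) (tT im)).
have he i : (i <= m.+1)%N -> bounded_at (t i) eta.
  by move=> im; apply: (bounded_at_le a0 (ta i) (tT im)).
have sx := bounded_at_sqi aT hxi; have se := bounded_at_sqi aT heta.
have sf (i : 'I_m.+1) : sqi P (f i).
  apply: (sqi_step HF HW) => //; [exact: t_le|exact: tT|].
  by have [] := hx i (ltnW (ltn_ord i)).
have sg (i : 'I_m.+1) : sqi P (g i).
  apply: (sqi_step HF HV) => //; [exact: t_le|exact: tT|].
  by have [] := he i (ltnW (ltn_ord i)).
have tle (i : 'I_m.+1) : 0 <= t i <= T by rewrite t_ge0 tT// ltnW.
have mf (i j : 'I_m.+1) : (i < j)%N -> measurable_at F (t j) (f i).
  move=> ij; apply: (meas_inM (filtration_sigma HF (tle j))).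
    by have [] := hx j (ltnW (ltn_ord j)).
  apply: (measurable_at_le HF (t_ge0 i.+1)) => //; [exact: t_le|by have /andP[] := tle j|].
  by apply: (incr_measurable_at HF HW) => //; [exact: t_le|exact: tT].
have mg (i j : 'I_m.+1) : (i < j)%N -> measurable_at F (t j) (g i).
  move=> ij; apply: (meas_inM (filtration_sigma HF (tle j))).
    by have [] := he j (ltnW (ltn_ord j)).
  apply: (measurable_at_le HF (t_ge0 i.+1)) => //; [exact: t_le|by have /andP[] := tle j|].
  by apply: (incr_measurable_at HF HV) => //; [exact: t_le|exact: tT].
transitivity (ip P (fun w => \sum_(i < m.+1) f i w) (fun w => \sum_(i < m.+1) g i w)).
  by apply: eq_ip => w; rewrite incr_sum mulr_sumr.
rewrite ip_suml//; last by apply: sqi_sum.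
rewrite /covariation ip_sumr//; last first.
  exact: bounded_at_sqi aT (bounded_atM aT hxi heta).
apply: eq_bigr => i _; rewrite ip_sumr// (bigD1 i)//= big1 ?addr0.
  by apply: eq_Rintegral => w _; rewrite /f /g; ring.
move=> j ji; case: (ltngtP i j) => ij.
- apply: (ip_future HF HV) => //; [exact: t_le|exact: tT|exact: mf|].
  by have [] := he j (ltnW (ltn_ord j)).
- rewrite ipC; apply: (ip_future HF HW) => //; [exact: t_le|exact: tT|exact: mg|].
  by have [] := hx i (ltnW (ltn_ord i)).
- by case/eqP: ji; apply/val_inj.
Qed.

(** Each increment is independent of the past, but the pair of increments of W
and V over the same interval is not assumed to be, so the expectation does not
factorise directly. Over a partition of [a, b] into m + 1 steps only the
diagonal terms survive, and they sum to the discrete covariation of W and V,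
whose second moment is (b - a)^2 / (m + 1) as W and V are independent. *)
Lemma ip_increments_bound :
  m.+1%:R * ip P (fun w => xi w * incr W a b w) (fun w => eta w * incr V a b w) ^+ 2
  <= ip P (fun w => xi w * eta w) (fun w => xi w * eta w) * (b - a) ^+ 2.
Proof.
have sx := bounded_at_sqi aT (bounded_atM aT hxi heta).
have sc : sqi P covariation by apply: sqi_sum => i _; exact: sqi_prod.
rewrite ip_increments.
have := CauchySchwarz sx sc; rewrite ip_covariation => H.
have m0 : 0 < m.+1%:R :> R by rewrite ltr0n.
apply: le_trans (ler_wpM2l (ltW m0) H) _.
rewrite /h le_eqVlt; apply/orP; left; apply/eqP.
by field; rewrite gt_eqF.
Qed.

End Partition.

Lemma ip_present_indep :
  ip P (fun w => xi w * incr W a b w) (fun w => eta w * incr V a b w) = 0.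
Proof.
have H := ip_increments_bound; move: H.
set x := ip _ _ _; set K := ip _ _ _ * _ => H.
apply/eqP; rewrite -sqrf_eq0; apply/eqP/le_anti; rewrite sqr_ge0 andbT leNgt.
apply/negP => x0.
(* a partition with more than K / x^2 steps *)
have := H (Num.truncn (K / x ^+ 2)).
rewrite -ler_pdivlMr// leNgt => /negP; apply.
exact: truncnS_gt.
Qed.

End IndependentMotions.
End Bracket.

(** * Isometry for simple processes *)

Section Elementary.
Context {R : realType} {d : measure_display} {Omega : measurableType d}.
Variables (T : R) (P : probability Omega R) (F : R -> set (set Omega)).
Hypothesis HF : filtration T F.

(** The length of the intersection of ]a, b] and ]a', b']. *)
Definition overlap (a b a' b' : R) : R :=
  Num.max 0 (Num.min b b' - Num.max a a').

Lemma overlapC (a b a' b' : R) : overlap a b a' b' = overlap a' b' a b.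
Proof. by rewrite /overlap minC maxC (maxC 0) (maxC a) maxC. Qed.

(** The differential form d[W, V] = c dt, tested on bounded past variables: c = 1
for a single motion and c = 0 for independent ones. Keeping c free gives one
isometry for all pairs of integrals. *)
Definition bracket (c : R) (W V : R -> Omega -> R) : Prop :=
  forall a b xi eta, 0 <= a -> a <= b -> b <= T -> bounded_at F a xi -> bounded_at F a eta ->
  ip P (fun w => xi w * incr W a b w) (fun w => eta w * incr V a b w) =
  c * ((b - a) * ip P xi eta).

Lemma bracket_same (W : R -> Omega -> R) : brownian_motion T P F W ->
  bracket 1 W W.
Proof.
move=> HW a b xi eta a0 ab bT hxi heta.
have aT : 0 <= a <= T by rewrite a0 (le_trans ab).
have [[hx _] [he _]] := (hxi, heta).
by rewrite mul1r (ip_present HF HW)//; exact: (bounded_at_sqi P HF aT).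
Qed.

Lemma bracket_indep (W V : R -> Omega -> R) : brownian_motion T P F W ->
  brownian_motion T P F V -> indep_motions T P W V -> bracket 0 W V.
Proof.
move=> HW HV WV a b xi eta a0 ab bT hxi heta.
by rewrite mul0r (ip_present_indep HF HW HV WV).
Qed.

Lemma bracketC (c : R) (W V : R -> Omega -> R) : bracket c W V -> bracket c V W.
Proof.
by move=> h a b xi eta a0 ab bT hxi heta; rewrite ipC h// (ipC _ xi).
Qed.

Section Pair.
Variables W V : R -> Omega -> R.
Hypothesis HW : brownian_motion T P F W.
Hypothesis HV : brownian_motion T P F V.

Lemma ip_step_disjoint (a b a' b' : R) (xi eta : Omega -> R) :
  0 <= a -> a <= b -> b <= a' -> a' <= b' -> b' <= T ->
  bounded_at F a xi -> bounded_at F a' eta ->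
  ip P (fun w => xi w * incr W a b w) (fun w => eta w * incr V a' b' w) = 0.
Proof.
move=> a0 ab ba ab' bT hxi heta.
have a'0 : 0 <= a' by rewrite (le_trans a0)// (le_trans ab).
have a'T : a' <= T by exact: le_trans bT.
have bT' : b <= T by exact: le_trans a'T.
have aT : 0 <= a <= T by rewrite a0 (le_trans ab).
have ha' : 0 <= a' <= T by rewrite a'0.
apply: (ip_future HF HV) => //.
- apply: (meas_inM (filtration_sigma HF ha')).
    apply: (measurable_at_le HF a0 _ a'T) => //; first exact: le_trans ba.
    by have [] := hxi.
  apply: (measurable_at_le HF (le_trans a0 ab) ba a'T).
  exact: (incr_measurable_at HF HW).
- by apply: (sqi_step HF HW) => //; [have [] := hxi|exact: (bounded_at_sqi P HF aT)].
- by have [] := heta.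
- exact: (bounded_at_sqi P HF ha').
Qed.

Lemma sqi_step_bounded (U : R -> Omega -> R) (a b : R) (xi : Omega -> R) :
  brownian_motion T P F U ->
  0 <= a -> a <= b -> b <= T -> bounded_at F a xi ->
  sqi P (fun w => xi w * incr U a b w).
Proof.
move=> HU a0 ab bT hxi; have aT : 0 <= a <= T by rewrite a0 (le_trans ab).
by apply: (sqi_step HF HU) => //; [have [] := hxi|exact: (bounded_at_sqi P HF aT)].
Qed.

Lemma mul_incr_split (U : R -> Omega -> R) (xi : Omega -> R) (s u t : R) :
  (fun w => xi w * incr U s t w) =
  (fun w => xi w * incr U s u w + xi w * incr U u t w).
Proof. by apply/funext => w; rewrite (incr_split _ _ u) mulrDr. Qed.

End Pair.

(** Cut both intervals at b and at the larger of a and a': pieces over disjoint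
times are orthogonal, and the common piece is given by the bracket. *)
Lemma ip_step_le (c : R) (W V : R -> Omega -> R) (a b a' b' : R)
    (xi eta : Omega -> R) :
  brownian_motion T P F W -> brownian_motion T P F V -> bracket c W V ->
  0 <= a -> a <= b -> 0 <= a' -> a' <= b' -> b <= b' -> b' <= T ->
  bounded_at F a xi -> bounded_at F a' eta ->
  ip P (fun w => xi w * incr W a b w) (fun w => eta w * incr V a' b' w) =
  c * (overlap a b a' b' * ip P xi eta).
Proof.
move=> HW HV HWV a0 ab a'0 ab' bb' bT hxi heta.
have bT' := le_trans bb' bT; have aT := le_trans ab bT'.
have a'T := le_trans ab' bT; have b0 := le_trans a0 ab.
rewrite /overlap min_l//.
have [ba'|a'b] := leP b a'.
  rewrite (ip_step_disjoint HW HV)// max_l; last first.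
    by rewrite subr_le0 (le_trans ba')// le_max lexx orbT.
  by rewrite mul0r mulr0.
have a'b_ := ltW a'b.
have S1 := sqi_step_bounded HW a0 ab bT' hxi.
have S2 := sqi_step_bounded HV a'0 a'b_ bT' heta.
have heta' := bounded_at_le HF a'0 a'b_ bT' heta.
have S3 := sqi_step_bounded HV b0 bb' bT heta'.
rewrite (mul_incr_split V eta a' b b') ipDr//.
rewrite [X in _ + X](ip_step_disjoint HW HV)// addr0.
have [aa'|/ltW a'a] := leP a a'.
  rewrite max_r ?subr_ge0//.
  have hxi' := bounded_at_le HF a0 aa' a'T hxi.
  have S4 := sqi_step_bounded HW a0 aa' a'T hxi.
  have S5 := sqi_step_bounded HW a'0 a'b_ bT' hxi'.
  rewrite (mul_incr_split W xi a a' b) ipDl//.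
  by rewrite (ip_step_disjoint HW HV)// add0r HWV.
rewrite max_r ?subr_ge0//.
have heta2 := bounded_at_le HF a'0 a'a aT heta.
have S4 := sqi_step_bounded HV a'0 a'a aT heta.
have S5 := sqi_step_bounded HV a0 ab bT' heta2.
rewrite (mul_incr_split V eta a' a b) ipDr//.
by rewrite ipC (ip_step_disjoint HV HW)// add0r HWV.
Qed.

Lemma ip_step (c : R) (W V : R -> Omega -> R) (a b a' b' : R)
    (xi eta : Omega -> R) :
  brownian_motion T P F W -> brownian_motion T P F V -> bracket c W V ->
  0 <= a -> a <= b -> b <= T -> 0 <= a' -> a' <= b' -> b' <= T ->
  bounded_at F a xi -> bounded_at F a' eta ->
  ip P (fun w => xi w * incr W a b w) (fun w => eta w * incr V a' b' w) =
  c * (overlap a b a' b' * ip P xi eta).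
Proof.
move=> HW HV HWV a0 ab bT a'0 ab' b'T hxi heta.
have [bb'|/ltW bb'] := leP b b'; first exact: ip_step_le.
by rewrite ipC (ip_step_le HV HW (bracketC HWV))// overlapC (ipC _ xi).
Qed.

End Elementary.

Section SimpleProcesses.
Context {R : realType} {d : measure_display} {Omega : measurableType d}.
Variables (T : R) (P : probability Omega R) (F : R -> set (set Omega)).
Hypothesis HF : filtration T F.
Implicit Types S : @simple_process R d Omega.

Local Notation LP := (@lebesgue_measure R \x P)%E.

Lemma simple_time_le (t : R) S : simple_adapted F t S ->
  forall i j, (i <= j)%N -> (j <= sp_size S)%N -> sp_time S i <= sp_time S j.
Proof.
move=> [_ inc _ _] i j; elim: j => [|j IH].
  by rewrite leqn0 => /eqP ->.
rewrite leq_eqVlt => /predU1P[->//|]; rewrite ltnS => ij jS.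
by rewrite (le_trans (IH ij (ltnW jS)))// inc.
Qed.

Lemma simple_times (t : R) S (i : 'I_(sp_size S)) : simple_adapted F t S ->
  [/\ 0 <= sp_time S i, sp_time S i <= sp_time S i.+1 & sp_time S i.+1 <= t].
Proof.
move=> hS; have [h0 _ h1 _] := hS; have le := simple_time_le hS.
split.
- by rewrite (le_trans h0)// le// ltnW.
- exact: le.
- by rewrite (le_trans _ h1)// le.
Qed.

Lemma simple_bounded_at (t : R) S (i : 'I_(sp_size S)) : simple_adapted F t S ->
  bounded_at F (sp_time S i) (sp_val S i).
Proof. by move=> [_ _ _]; apply. Qed.

Lemma sp_integralE (W : R -> Omega -> R) S :
  sp_integral W S = fun w => \sum_(i < sp_size S)
    (sp_val S i w * incr W (sp_time S i) (sp_time S i.+1) w).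
Proof. by []. Qed.

Lemma sqi_sp_integral (W : R -> Omega -> R) (t : R) S :
  brownian_motion T P F W -> t <= T -> simple_adapted F t S ->
  sqi P (sp_integral W S).
Proof.
move=> HW tT hS; apply: sqi_sum => i _; have [h0 h1 h2] := simple_times i hS.
by apply: (sqi_step_bounded HF HW) => //; [exact: le_trans h2 tT|exact: simple_bounded_at hS].
Qed.

Lemma ip_sp_integral (c : R) (W V : R -> Omega -> R) (t t' : R) S S' :
  brownian_motion T P F W -> brownian_motion T P F V -> bracket T P F c W V ->
  t <= T -> t' <= T -> simple_adapted F t S -> simple_adapted F t' S' ->
  ip P (sp_integral W S) (sp_integral V S') =
  c * \sum_(i < sp_size S) \sum_(j < sp_size S')
    overlap (sp_time S i) (sp_time S i.+1) (sp_time S' j) (sp_time S' j.+1) *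
    ip P (sp_val S i) (sp_val S' j).
Proof.
move=> HW HV HWV tT t'T hS hS'.
have sV := sqi_sp_integral HV t'T hS'.
have sS (i : 'I_(sp_size S)) : sqi P (fun w => sp_val S i w *
    incr W (sp_time S i) (sp_time S i.+1) w).
  have [h0 h1 h2] := simple_times i hS.
  by apply: (sqi_step_bounded HF HW) => //; [exact: le_trans h2 tT|exact: simple_bounded_at hS].
have sS' (i : 'I_(sp_size S')) : sqi P (fun w => sp_val S' i w *
    incr V (sp_time S' i) (sp_time S' i.+1) w).
  have [h0 h1 h2] := simple_times i hS'.
  by apply: (sqi_step_bounded HF HV) => //; [exact: le_trans h2 t'T|exact: simple_bounded_at hS'].
rewrite [X in ip _ X _]sp_integralE ip_suml// mulr_sumr.
apply: eq_bigr => i _; rewrite sp_integralE ip_sumr// mulr_sumr.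
apply: eq_bigr => j _.
have [h0 h1 h2] := simple_times i hS; have [h0' h1' h2'] := simple_times j hS'.
apply: (ip_step HF HW HV HWV) => //.
- exact: le_trans h2 tT.
- exact: le_trans h2' t'T.
- exact: simple_bounded_at hS.
- exact: simple_bounded_at hS'.
Qed.

Definition joint (H : R -> Omega -> R) (z : measurableTypeR R * Omega) : R :=
  H z.1 z.2.

Lemma integral_indic_itv (a b a' b' : R) :
  \int[@lebesgue_measure R]_s (\1_(`]a, b]) s * \1_(`]a', b']) s) =
  overlap a b a' b'.
Proof.
transitivity (\int[@lebesgue_measure R]_s (\1_(`]Num.max a a', Num.min b b']%classic) s : R)).
  apply: eq_Rintegral => s _.
  have -> : `]Num.max a a', Num.min b b']%classic =
      `]a, b]%classic `&` `]a', b']%classic; last first.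
    by rewrite !indicE in_setI -natrM mulnb.
  apply/seteqP; split => x /=; rewrite !in_itv /= gt_max le_min.
    by move=> /andP[/andP[-> ->] /andP[-> ->]].
  by move=> [/andP[-> ->] /andP[-> ->]].
rewrite /Rintegral integral_indic//= setIT lebesgue_measure_itv/= lte_fin /overlap.
case: (ltP (Num.max a a') (Num.min b b')) => h.
  by rewrite [RHS]max_r// subr_ge0 ltW.
by rewrite [RHS]max_l// subr_le0.
Qed.

Lemma sqi_rect (a b : R) (xi : Omega -> R) : sqi P xi ->
  sqi LP (fun z => xi z.2 * \1_(`]a, b]) z.1).
Proof.
move=> sx; split.
  apply: measurable_funM.
    by apply: measurableT_comp; [exact: sx.1|exact: measurable_snd].
  by apply: measurableT_comp; [exact: measurable_indic|exact: measurable_fst].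
have := tensor_integrable (integrable_indic_itv a b false false) sx.2.
apply: eq_integrable => // z _ /=; congr EFin.
by rewrite exprMn mulrC; congr (_ * _); rewrite indicE; case: (_ \in _); rewrite ?expr1n ?expr0n.
Qed.

Lemma ip_rect (a b a' b' : R) (xi eta : Omega -> R) : sqi P xi -> sqi P eta ->
  ip LP (fun z => xi z.2 * \1_(`]a, b]) z.1)
        (fun z => eta z.2 * \1_(`]a', b']) z.1) =
  overlap a b a' b' * ip P xi eta.
Proof.
move=> sx se.
have i1 : (@lebesgue_measure R).-integrable setT
    (EFin \o (fun s => \1_(`]a, b]) s * \1_(`]a', b']) s : R)).
  apply: le_integrable (integrable_indic_itv a b false false) => //.
    apply/measurable_EFinP; apply: measurable_funM => //; exact: measurable_indic.
  move=> s _ /=; rewrite lee_fin !indicE.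
  by case: (_ \in _); case: (_ \in _); rewrite ?mul0r ?mul1r ?normr1 ?normr0.
have := tensor_integral i1 (sqi_mul_integrable sx se).
rewrite integral_indic_itv => /(congr1 fine) /= <-.
congr fine; apply: eq_integral => z _; congr EFin; ring.
Qed.

Lemma sqi_sp_eval (t : R) S : t <= T -> simple_adapted F t S ->
  sqi LP (joint (sp_eval S)).
Proof.
move=> tT hS.
apply: sqi_sum => i _; apply: sqi_rect; have [h0 h1 h2] := simple_times i hS.
apply: (bounded_at_sqi P HF) (simple_bounded_at i hS).
by rewrite h0 (le_trans h1)// (le_trans h2).
Qed.

Lemma ip_sp_eval (t t' : R) S S' : t <= T -> t' <= T ->
  simple_adapted F t S -> simple_adapted F t' S' ->
  ip LP (joint (sp_eval S)) (joint (sp_eval S')) =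
  \sum_(i < sp_size S) \sum_(j < sp_size S')
    overlap (sp_time S i) (sp_time S i.+1) (sp_time S' j) (sp_time S' j.+1) *
    ip P (sp_val S i) (sp_val S' j).
Proof.
move=> tT t'T hS hS'.
have sV := sqi_sp_eval t'T hS'.
have sS (i : 'I_(sp_size S)) : sqi P (sp_val S i).
  have [h0 h1 h2] := simple_times i hS.
  apply: (bounded_at_sqi P HF) (simple_bounded_at i hS).
  by rewrite h0 (le_trans h1)// (le_trans h2).
have sS' (i : 'I_(sp_size S')) : sqi P (sp_val S' i).
  have [h0 h1 h2] := simple_times i hS'.
  apply: (bounded_at_sqi P HF) (simple_bounded_at i hS').
  by rewrite h0 (le_trans h1)// (le_trans h2).
rewrite ip_suml//; last by move=> i _; exact: sqi_rect.
apply: eq_bigr => i _; rewrite ip_sumr//; last 2 first.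
- by move=> j _; exact: sqi_rect.
- exact: sqi_rect.
by apply: eq_bigr => j _; rewrite ip_rect.
Qed.

Lemma simple_isometry (c : R) (W V : R -> Omega -> R) (t t' : R) S S' :
  brownian_motion T P F W -> brownian_motion T P F V -> bracket T P F c W V ->
  t <= T -> t' <= T -> simple_adapted F t S -> simple_adapted F t' S' ->
  ip P (sp_integral W S) (sp_integral V S') =
  c * ip LP (joint (sp_eval S)) (joint (sp_eval S')).
Proof.
move=> HW HV HWV tT t'T hS hS'.
by rewrite (ip_sp_eval tT t'T hS hS') (ip_sp_integral HW HV HWV tT t'T hS hS').
Qed.

End SimpleProcesses.

(** * Stopping a simple process; Fatou in probability *)

Lemma sqi_indic_itv (R : realType) (a b : R) (x y : bool) :
  sqi (@lebesgue_measure R) (\1_([set` Interval (BSide x a) (BSide y b)]) : R -> R).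
Proof.
split; first exact: measurable_indic.
have := integrable_indic_itv a b x y.
apply: eq_integrable => // s _ /=; congr EFin.
by rewrite indicE; case: (_ \in _); rewrite ?expr1n ?expr0n.
Qed.

Section Stopping.
Context {R : realType} {d : measure_display} {Omega : measurableType d}.
Variables (T : R) (F : R -> set (set Omega)).
Hypothesis HF : filtration T F.
Implicit Types S : @simple_process R d Omega.
Local Notation leb := (@lebesgue_measure R).

Definition sp_energy S (n : nat) (w : Omega) : R :=
  \sum_(i < n) sp_val S i w ^+ 2 * (sp_time S i.+1 - sp_time S i).

Lemma sqi_path S (w : Omega) : sqi leb (fun s => sp_eval S s w).
Proof. by apply: sqi_sum => i _; apply: sqiZ; exact: sqi_indic_itv. Qed.

Lemma path_energy (t : R) S (w : Omega) : simple_adapted F t S ->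
  ip leb (fun s => sp_eval S s w) (fun s => sp_eval S s w) =
  sp_energy S (sp_size S) w.
Proof.
move=> hS; have le := simple_time_le hS.
have sI (i : 'I_(sp_size S)) : sqi leb
    (fun s => sp_val S i w * \1_(`]sp_time S i, sp_time S i.+1]) s).
  by apply: sqiZ; exact: sqi_indic_itv.
rewrite [X in ip _ X _](_ : _ = fun s => \sum_(i < sp_size S)
   sp_val S i w * \1_(`]sp_time S i, sp_time S i.+1]) s)//.
rewrite ip_suml//; last exact: sqi_path.
apply: eq_bigr => i _; rewrite ip_sumr// (bigD1 i)//= big1 ?addr0.
  rewrite ipZl ?ipZr//; try exact: sqi_indic_itv.
  rewrite /ip integral_indic_itv /overlap minxx maxxx max_r; first by ring.
  by rewrite subr_ge0 le.
move=> j ji; rewrite ipZl ?ipZr//; try exact: sqi_indic_itv.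
rewrite /ip integral_indic_itv /overlap max_l ?mulr0// subr_le0.
case: (ltngtP i j) => ij.
- by rewrite ge_min !le_max (le i.+1 j) ?orbT// ltnW.
- by rewrite ge_min !le_max (le j.+1 i) ?orbT// ltnW.
- by case/eqP: ji; apply/val_inj.
Qed.

(** The value on the i-th interval is dropped as soon as the energy accumulated up
to the end of that interval exceeds K. This energy is known at the beginning of
the interval, which keeps the process adapted. *)
Definition stop (K : R) S : simple_process :=
  SimpleProcess (sp_size S) (sp_time S)
    (fun i w => if sp_energy S i.+1 w <= K then sp_val S i w else 0).

Lemma energy_le (t : R) S : simple_adapted F t S ->
  forall i j w, (i <= j)%N -> (j <= sp_size S)%N -> sp_energy S i w <= sp_energy S j w.
Proof.
move=> hS i j w; elim: j => [|j IH]; first by rewrite leqn0 => /eqP ->.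
rewrite leq_eqVlt => /predU1P[->//|]; rewrite ltnS => ij jS.
rewrite (le_trans (IH ij (ltnW jS)))// /sp_energy big_ord_recr/= lerDl.
rewrite mulr_ge0 ?sqr_ge0// subr_ge0.
by have [_ h _ _] := hS; exact: h.
Qed.

Lemma stop_energy (t K : R) S w : 0 <= K -> simple_adapted F t S ->
  sp_energy (stop K S) (sp_size S) w <= K.
Proof.
move=> K0 hS.
suff : forall n, (n <= sp_size S)%N ->
    sp_energy (stop K S) n w <= K /\ sp_energy (stop K S) n w <= sp_energy S n w.
  by move=> /(_ (sp_size S) (leqnn _))[].
elim => [_|n IH nS]; first by rewrite /sp_energy !big_ord0.
have [h1 h2] := IH (ltnW nS).
have tt : 0 <= sp_time S n.+1 - sp_time S n.
  by rewrite subr_ge0; have [_ h _ _] := hS; exact: h.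
rewrite /sp_energy !big_ord_recr/= -!/(sp_energy _ _ _).
case: ifPn => hn; last first.
  by rewrite expr0n mul0r addr0; split=> //; rewrite ler_wpDr// mulr_ge0 ?sqr_ge0.
split; last by rewrite lerD2r.
apply: le_trans hn; rewrite [leRHS]/sp_energy big_ord_recr/= lerD2r.
exact: h2.
Qed.

Lemma stop_val (t K : R) S w : simple_adapted F t S ->
  sp_energy S (sp_size S) w <= K ->
  forall i, (i < sp_size S)%N -> sp_val (stop K S) i w = sp_val S i w.
Proof.
move=> hS hK i iS /=; rewrite ifT//.
by apply: le_trans hK; apply: (energy_le hS).
Qed.

Lemma stop_sp_eval (t K : R) S w s : simple_adapted F t S ->
  sp_energy S (sp_size S) w <= K -> sp_eval (stop K S) s w = sp_eval S s w.
Proof.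
move=> hS hK; apply: eq_bigr => i _.
by rewrite (stop_val hS hK).
Qed.

Lemma stop_sp_integral (t K : R) S w W : simple_adapted F t S ->
  sp_energy S (sp_size S) w <= K ->
  sp_integral W (stop K S) w = sp_integral W S w.
Proof.
move=> hS hK; apply: eq_bigr => i _.
by rewrite (stop_val hS hK).
Qed.

Lemma stop_adapted (t K : R) S : t <= T -> simple_adapted F t S ->
  simple_adapted F t (stop K S).
Proof.
move=> tT hS; have [h0 h1 h2 h3] := hS; split => // i /= iS.
have [m1 [M hM]] := h3 i iS.
have [t0 tt tt'] := simple_times (Ordinal iS) hS; rewrite /= in t0 tt tt'.
have ti : 0 <= sp_time S i <= T by rewrite t0 (le_trans tt)// (le_trans tt').
split; last first.
  exists M => w /=; case: ifPn => _; first exact: hM.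
  by rewrite normr0 (le_trans _ (hM w)).
apply: (meas_in_cut (filtration_sigma HF ti)) => //.
apply: (meas_in_sum (filtration_sigma HF ti)) => j _.
have mj : meas_in (F (sp_time S i)) (sp_val S j).
  have ji : (j <= i)%N by rewrite -ltnS.
  have jS := leq_ltn_trans ji iS.
  have [t0j _ _] := simple_times (Ordinal jS) hS.
  have [mj _] := h3 j jS.
  apply: (measurable_at_le HF t0j _ _ mj).
    exact: (simple_time_le hS ji (ltnW iS)).
  by have /andP[] := ti.
have := meas_inM (filtration_sigma HF ti) (meas_inM (filtration_sigma HF ti) mj mj)
  (meas_in_cst (filtration_sigma HF ti) (sp_time S j.+1 - sp_time S j)).
by congr meas_in; apply/funext => w; rewrite expr2.
Qed.

Lemma sp_eval_out (t : R) S w s : simple_adapted F t S ->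
  s \notin `[0, t] -> sp_eval S s w = 0.
Proof.
move=> hS st; apply: big1 => i _.
have [t0 tt tt'] := simple_times i hS.
rewrite indicE memNset ?mulr0//= in_itv/= => /andP[s1 s2].
move/negP : st; apply; rewrite in_itv/=.
by rewrite (le_trans t0 (ltW s1)) (le_trans s2).
Qed.

End Stopping.

Section InProbability.
Context {R : realType} {d : measure_display} {Omega : measurableType d}.
Variable P : probability Omega R.

Lemma measurable_dev (f g : Omega -> R) (e : R) : measurable_fun setT f ->
  measurable_fun setT g -> measurable [set w | e <= `|f w - g w|].
Proof.
move=> mf mg.
have m1 : measurable_fun setT (fun w => e <= `|f w - g w|).
  apply: measurable_fun_ler => //.
  by apply: measurableT_comp => //; exact: measurable_funB.
have := m1 measurableT [set true] I.
by rewrite setTI; congr measurable; apply/seteqP; split => z.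
Qed.

(** After truncation of f^2 at a level n, closeness in probability suffices to
compare with 2 g^2; then n tends to infinity. The factor 2 comes from
f^2 <= 2 g^2 + 2 (f - g)^2. *)
Lemma fatou_in_probability (f : Omega -> R) (B : R) : measurable_fun setT f ->
  (forall e, 0 < e -> exists g, [/\ sqi P g, ip P g g <= B &
     (P [set w | (e <= `|f w - g w|)%R] <= e%:E)%E]) ->
  sqi P f /\ ip P f f <= 2 * B.
Proof.
move=> mf H.
have mmin n : measurable_fun setT (fun w => (Num.min (f w ^+ 2) n%:R)%:E).
  apply/measurable_EFinP; apply: measurable_minr => //.
  exact: measurable_funX.
have min0 n w : 0 <= Num.min (f w ^+ 2) n%:R by rewrite le_min sqr_ge0 ler0n.
have trunc n : (\int[P]_w (Num.min (f w ^+ 2) n%:R)%:E <= (2 * B)%:E)%E.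
  apply/lee_addgt0Pr => e e0.
  pose dl := Num.min 1 (e / (2 + n%:R)).
  have n2 : 0 < 2 + n%:R :> R by rewrite ltr_pwDl.
  have dl0 : 0 < dl by rewrite lt_min ltr01 divr_gt0.
  have [g [sg gB Pg]] := H dl dl0.
  set A := [set w | _] in Pg.
  have mA : measurable A by apply: measurable_dev => //; exact: sg.1.
  apply: (@le_trans _ _ (\int[P]_w ((2 * g w ^+ 2 + 2 * dl ^+ 2)%:E + (n%:R * \1_A w)%:E))%E).
    apply: ge0_le_integral => //.
    - by move=> w _; rewrite lee_fin.
    - apply: emeasurable_funD.
        apply/measurable_EFinP; apply: measurable_funD => //.
        by apply: measurable_funM => //; apply: measurable_funX; exact: sg.1.
      by apply/measurable_EFinP; apply: measurable_funM => //; exact: measurable_indic.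
    - move=> w _; rewrite -EFinD lee_fin.
      have [wA|wA] := pselect (A w).
        rewrite indicE mem_set// mulr1 ge_min; apply/orP; right.
        rewrite ler_wpDl//.
        by rewrite addr_ge0// mulr_ge0// sqr_ge0.
      rewrite indicE memNset// mulr0 addr0 ge_min; apply/orP; left.
      have : `|f w - g w| < dl by rewrite ltNge; exact/negP.
      move=> /ltW h.
      have : (f w - g w) ^+ 2 <= dl ^+ 2.
        by rewrite -[leLHS]real_normK ?num_real// lerXn2r ?nnegrE// ltW.
      have : 0 <= (f w - 2 * g w) ^+ 2 by exact: sqr_ge0.
      by nra.
  rewrite ge0_integralD//; last 3 first.
  - by move=> w _; rewrite lee_fin addr_ge0// mulr_ge0// sqr_ge0.
  - apply/measurable_EFinP; apply: measurable_funD => //.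
    by apply: measurable_funM => //; apply: measurable_funX; exact: sg.1.
  - by apply/measurable_EFinP; apply: measurable_funM => //; exact: measurable_indic.
  have -> : (\int[P]_w (2 * g w ^+ 2 + 2 * dl ^+ 2)%:E = (2 * ip P g g + 2 * dl ^+ 2)%:E)%E.
    under eq_integral do rewrite EFinD.
    rewrite ge0_integralD//; last 3 first.
    - by move=> w _; rewrite lee_fin mulr_ge0// sqr_ge0.
    - by apply/measurable_EFinP; apply: measurable_funM => //; apply: measurable_funX; exact: sg.1.
    - by move=> w _; rewrite lee_fin mulr_ge0// sqr_ge0.
    rewrite integral_cst//= probability_setT mule1 EFinD; congr (_ + _)%E.
    rewrite EFinM -ip_ge0_EFin// -ge0_integralZl//.
      by apply/measurable_EFinP; apply: measurable_funX; exact: sg.1.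
    by move=> w _; rewrite lee_fin sqr_ge0.
  have -> : (\int[P]_w (n%:R * \1_A w)%:E = n%:R%:E * P A)%E.
    under eq_integral do rewrite EFinM.
    rewrite ge0_integralZl//; last first.
      by apply/measurable_EFinP; exact: measurable_indic.
    by rewrite integral_indic// setIT.
  apply: (@le_trans _ _ ((2 * B + 2 * dl ^+ 2)%:E + n%:R%:E * dl%:E)%E).
    apply: leeD; first by rewrite lee_fin lerD2r ler_wpM2l.
    by apply: lee_wpmul2l => //; rewrite lee_fin.
  rewrite -EFinM -!EFinD lee_fin -addrA lerD2l.
  have d1 : dl <= 1 by rewrite ge_min lexx.
  have : dl * (2 + n%:R) <= e by rewrite -ler_pdivlMr// ge_min lexx orbT.
  by nra.
have E : (\int[P]_w (f w ^+ 2)%:E <= (2 * B)%:E)%E.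
  rewrite (_ : (\int[P]_w (f w ^+ 2)%:E =
      limn (fun n => \int[P]_w (Num.min (f w ^+ 2) n%:R)%:E))%E); last first.
    rewrite -monotone_convergence//.
    - apply: eq_integral => w _; apply/esym/cvg_lim => //.
      apply/cvg_EFin; first by near=> n.
      apply: cvg_near_cst; near=> n => /=; rewrite min_l//.
      near: n; exact: nbhs_infty_ger.
    - by move=> n w _; rewrite lee_fin.
    - move=> w _ m n mn; rewrite lee_fin le_min !ge_min lexx/=.
      by rewrite ler_nat mn orbT.
  apply: lime_le.
    apply: ereal_nondecreasing_is_cvgn => m n mn; apply: ge0_le_integral => //.
    - by move=> w _; rewrite lee_fin.
    - move=> w _; rewrite lee_fin le_min !ge_min lexx/=.
      by rewrite ler_nat mn orbT.
  by near=> n; exact: trunc.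
have sf : sqi P f by apply: sqiP => //; exact: le_lt_trans E (ltry _).
by split=> //; rewrite -lee_fin -ip_ge0_EFin.
Unshelve. all: by end_near.
Qed.

End InProbability.

(** * Approximation of the Ito integral in mean square *)

Lemma cvge0_lt (R : realType) (u : nat -> \bar R) : u @ \oo --> 0%E ->
  forall e : R, 0 < e -> exists N, forall n, (N <= n)%N -> (u n < e%:E)%E.
Proof.
move=> u0 e e0.
have [] := u0 [set x | (x < e%:E)%E].
  apply: open_nbhs_nbhs; split; first exact: open_ereal_lt_ereal.
  by rewrite /= lte_fin.
by move=> N _ HN; exists N => n /HN.
Qed.

Section Tail.
Context {R : realType} {d : measure_display} {Omega : measurableType d}.
Variable P : probability Omega R.

Lemma measurable_above (q : Omega -> \bar R) (M : \bar R) : measurable_fun setT q ->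
  measurable [set w | (M < q w)%E].
Proof.
move=> mq; rewrite -[X in measurable X]setTI.
exact: emeasurable_fun_o_infty.
Qed.

Lemma measurable_atleast (q : Omega -> \bar R) (M : \bar R) : measurable_fun setT q ->
  measurable [set w | (M <= q w)%E].
Proof.
move=> mq; rewrite -[X in measurable X]setTI.
exact: emeasurable_fun_c_infty.
Qed.

Lemma integral_tail (q : Omega -> \bar R) : measurable_fun setT q ->
  (forall w, (0 <= q w)%E) -> (\int[P]_w q w < +oo)%E ->
  forall e : R, 0 < e -> exists n : nat,
   (\int[P]_w (q w * (\1_[set w | (n.+1%:R%:E < q w)%E] w)%:E) <= e%:E)%E.
Proof.
move=> mq q0 qoo e e0.
have iq : P.-integrable setT q.
  apply/integrableP; split => //.
  by under eq_integral do rewrite gee0_abs//.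
pose f n w := (q w * (\1_[set w | (n%:R%:E < q w)%E] w)%:E)%E.
have mf n : measurable_fun setT (f n).
  apply: emeasurable_funM => //; apply/measurable_EFinP.
  by apply: measurable_indic; exact: measurable_above.
have h1 : {ae P, forall w, setT w -> f ^~ w @ \oo --> cst 0%E w}.
  have := integrable_ae measurableT iq; apply: filterS => w /(_ I) qw _.
  apply: cvg_near_cst; near=> n.
  rewrite /f indicE memNset ?mule0//=; apply/negP; rewrite -leNgt.
  rewrite -(fineK qw) lee_fin; near: n; exact: nbhs_infty_ger.
have h2 : {ae P, forall w (n : nat), setT w -> (`|f n w| <= q w)%E}.
  apply/aeW => w n _; rewrite /f indicE.
  by case: (_ \in _); rewrite ?mule1 ?mule0 ?abse0 ?gee0_abs.
have [_ _] := @dominated_convergence _ _ _ P setT measurableT f (cst 0%E) q mf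
  (measurable_cst _) h1 iq h2.
rewrite integral_cst//= mul0e => /cvge0_lt /(_ _ e0) [N HN].
by exists N; apply/ltW/HN.
Unshelve. all: by end_near.
Qed.

End Tail.

Section ItoApproximation.
Context {R : realType} {d : measure_display} {Omega : measurableType d}.
Variables (T : R) (P : probability Omega R) (F : R -> set (set Omega)).
Hypothesis HF : filtration T F.
Implicit Types S : @simple_process R d Omega.
Local Notation leb := (@lebesgue_measure R).
Local Notation LP := (leb \x P)%E.

Definition cutoff (t : R) (H : R -> Omega -> R) (z : measurableTypeR R * Omega) : R :=
  \1_(`[0, t]) z.1 * H z.1 z.2.

Lemma simple_isometry_sub (t : R) (W : R -> Omega -> R) S S' :
  brownian_motion T P F W -> bracket T P F 1 W W -> t <= T ->
  simple_adapted F t S -> simple_adapted F t S' ->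
  ip P (fun w => sp_integral W S w - sp_integral W S' w)
       (fun w => sp_integral W S w - sp_integral W S' w) =
  ip LP (fun z => joint (sp_eval S) z - joint (sp_eval S') z)
        (fun z => joint (sp_eval S) z - joint (sp_eval S') z).
Proof.
move=> HW HWW tT hS hS'.
have iso := simple_isometry HF HW HW HWW tT tT.
have sS := sqi_sp_integral HF HW tT hS; have sS' := sqi_sp_integral HF HW tT hS'.
have seS := sqi_sp_eval P HF tT hS; have seS' := sqi_sp_eval P HF tT hS'.
by rewrite !ipBB// !iso// !mul1r.
Qed.

Section Fixed.
Variables (t : R) (W : R -> Omega -> R) (H : R -> Omega -> R).
Hypotheses (t0 : 0 <= t) (tT : t <= T).
Hypothesis HW : brownian_motion T P F W.
Hypothesis sH : sqi LP (cutoff t H).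

Let q (w : Omega) : \bar R := (\int[leb]_s (cutoff t H (s, w) ^+ 2)%:E)%E.

Definition path_dist S (w : Omega) : \bar R :=
  (\int[leb]_s ((sp_eval S s w - cutoff t H (s, w)) ^+ 2)%:E)%E.

Let q0 w : (0 <= q w)%E.
Proof. by apply: integral_ge0 => s _; rewrite lee_fin sqr_ge0. Qed.

Let mq : measurable_fun setT q.
Proof.
apply: (@measurable_fun_fubini_tonelli_G _ _ _ _ _ leb (fun z => (cutoff t H z ^+ 2)%:E)).
  by apply/measurable_EFinP; apply: measurable_funX; exact: sH.1.
by move=> z; rewrite lee_fin sqr_ge0.
Qed.

Let integral_q : (\int[P]_w q w = (ip LP (cutoff t H) (cutoff t H))%:E)%E.
Proof.
rewrite -ip_ge0_EFin// fubini_tonelli2//.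
  by apply/measurable_EFinP; apply: measurable_funX; exact: sH.1.
by move=> z; rewrite lee_fin sqr_ge0.
Qed.

Lemma sqi_diff S : simple_adapted F t S ->
  sqi LP (fun z => joint (sp_eval S) z - cutoff t H z).
Proof. by move=> hS; apply: sqiB => //; exact: (sqi_sp_eval P HF tT hS). Qed.

Lemma measurable_path_dist S : simple_adapted F t S ->
  measurable_fun setT (path_dist S).
Proof.
move=> hS; have [m _] := sqi_diff hS.
apply: (@measurable_fun_fubini_tonelli_G _ _ _ _ _ leb
   (fun z => ((joint (sp_eval S) z - cutoff t H z) ^+ 2)%:E)).
  by apply/measurable_EFinP; exact: measurable_funX.
by move=> z; rewrite lee_fin sqr_ge0.
Qed.

Lemma integral_path_dist S : simple_adapted F t S ->
  (\int[P]_w path_dist S w = (ip LP (fun z => joint (sp_eval S) z - cutoff t H z)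
     (fun z => joint (sp_eval S) z - cutoff t H z))%:E)%E.
Proof.
move=> hS; have sD := sqi_diff hS.
rewrite -ip_ge0_EFin// fubini_tonelli2//.
  by apply/measurable_EFinP; apply: measurable_funX; exact: sD.1.
by move=> z; rewrite lee_fin sqr_ge0.
Qed.

Lemma path_dist_def S w : simple_adapted F t S ->
  (\int[leb]_(s in `[0%R, t]) (`|sp_eval S s w - H s w| ^+ 2)%:E)%E = path_dist S w.
Proof.
move=> hS; rewrite integral_mkcond; apply: eq_integral => s _.
rewrite patchE /cutoff/= indicE; case: ifPn => hs.
  by rewrite mul1r real_normK ?num_real.
rewrite mul0r subr0 (sp_eval_out _ hS) ?expr0n//.
by move: hs; rewrite notin_setE /= => /negP.
Qed.

(** A path of H of energy at most M, approximated by a path of S within M, forces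
the energy of S below 2 M + 2 M; stopping at the level 4 M leaves such a path
unchanged. *)
Let path_alternatives S (M e : R) w : simple_adapted F t S ->
  0 < M -> 0 < e -> e <= M ->
  (q w <= M%:E)%E -> (path_dist S w < e%:E)%E ->
  sp_energy S (sp_size S) w <= 4 * M.
Proof.
move=> hS M0 e0 eM qM De.
have sf : sqi leb (fun s => cutoff t H (s, w)).
  apply: sqiP; last exact: le_lt_trans qM (ltry _).
  by apply: measurableT_comp; [exact: sH.1|exact: measurable_pair2].
have sa := sqi_path S w.
have := De; rewrite /path_dist ip_ge0_EFin ?lte_fin; last exact: sqiB.
have := qM; rewrite /q ip_ge0_EFin// lee_fin.
rewrite -(path_energy w hS).
have := ip_subsq_le (sqiB sa sf) (sqiN sf).
set x := ip _ _ _; set y := ip _ _ _; set z := ip _ _ _.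
have -> : y = ip leb (fun s => sp_eval S s w - cutoff t H (s, w))
  (fun s => sp_eval S s w - cutoff t H (s, w)) by [].
have -> : x = ip leb (fun s => sp_eval S s w) (fun s => sp_eval S s w).
  by apply: eq_ip => s; rewrite opprK subrK.
have -> : z = ip leb (fun s => cutoff t H (s, w)) (fun s => cutoff t H (s, w)).
  by apply: eq_Rintegral => s _; rewrite mulrNN.
by lra.
Qed.

(** Where the energy q of H exceeds M, the crude bound 8 M + 2 q is below 10 q;
where q is at most M but S is far from H it is below 10 M; elsewhere stopping changes nothing. *)
Let path_dist_stop S (M e : R) w : simple_adapted F t S ->
  0 < M -> 0 < e -> e <= M ->
  (path_dist (stop (4 * M) S) w <=
   10%:E * (q w * (\1_[set w | (M%:E < q w)%E] w)%:E) +
   (e + 10 * M * \1_[set w | (e%:E <= path_dist S w)%E] w)%:E)%E.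
Proof.
move=> hS M0 e0 eM.
have hS' := stop_adapted HF (4 * M) tT hS.
have [qoo|] := pselect (q w = +oo%E).
  rewrite qoo [X in (_ * (_ * X%:E))%E]indicE mem_set /=; last by rewrite qoo ltry.
  by rewrite mule1 gt0_muley ?lte_fin// addye// leey.
move=> /eqP; rewrite -ltey => qoo.
have sf : sqi leb (fun s => cutoff t H (s, w)).
  apply: sqiP => //.
  by apply: measurableT_comp; [exact: sH.1|exact: measurable_pair2].
have sb := sqi_path (stop (4 * M) S) w.
have qE : q w = (ip leb (fun s => cutoff t H (s, w)) (fun s => cutoff t H (s, w)))%:E.
  by rewrite /q ip_ge0_EFin.
have key : (path_dist (stop (4 * M) S) w <= (8 * M)%:E + 2%:E * q w)%E.
  rewrite qE /path_dist ip_ge0_EFin; last exact: sqiB.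
  rewrite -EFinM -EFinD lee_fin.
  apply: le_trans (ip_subsq_le sb sf) _; rewrite (path_energy w hS') lerD2r.
  have M4 : 0 <= 4 * M by rewrite mulr_ge0// ltW.
  have := stop_energy w M4 hS.
  by rewrite /=; set u := sp_energy _ _ _; lra.
have := ip_ge0 leb (fun s => cutoff t H (s, w)).
move: key; rewrite qE; set Q := ip _ _ _ => key Q0.
have [Mq|qM] := ltP M Q.
  rewrite [X in (_ * (_ * X%:E))%E]indicE mem_set /=; last by rewrite qE lte_fin.
  apply: (le_trans key); rewrite mule1 -!EFinM -!EFinD lee_fin.
  have : 0 <= 10 * M * \1_[set w | (e%:E <= path_dist S w)%E] w :> R.
    by rewrite !mulr_ge0// ltW.
  by lra.
rewrite [X in (_ * (_ * X%:E))%E]indicE memNset /=; last first.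
  by rewrite qE lte_fin; apply/negP; rewrite -leNgt.
rewrite mule0 mule0 add0e.
have [eD|De] := leP e%:E (path_dist S w).
  rewrite indicE mem_set// mulr1; apply: (le_trans key).
  by rewrite -EFinM -EFinD lee_fin; lra.
rewrite indicE memNset /=; last by apply/negP; rewrite -ltNge.
rewrite mulr0 addr0.
have qM' : (q w <= M%:E)%E by rewrite qE lee_fin.
have en := path_alternatives hS M0 e0 eM qM' De.
rewrite (_ : path_dist (stop _ S) w = path_dist S w); first exact: ltW.
by apply: eq_integral => s _; rewrite (stop_sp_eval _ hS).
Qed.

(** The approximants that define the integral are close to H in probability only.
Once they are stopped at a level 4 M, the path distance is dominated as in
[path_dist_stop] and becomes small in mean, while the integrals change only on
an event of small probability. *)
Lemma ito_approx_in_probability (I : Omega -> R) : ito_integral P F W H t I ->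
  forall e, 0 < e -> exists S, [/\ simple_adapted F t S,
   ip LP (fun z => joint (sp_eval S) z - cutoff t H z)
         (fun z => joint (sp_eval S) z - cutoff t H z) <= e &
   (P [set w | (e <= `|I w - sp_integral W S w|)%R] <= e%:E)%E].
Proof.
move=> [mI [S_ [hS D0 I0]]] e e0.
have qoo : (\int[P]_w q w < +oo)%E by rewrite integral_q ltry.
have e30 : 0 < e / 30 by rewrite divr_gt0.
have [n tail] := integral_tail mq q0 qoo e30.
pose M : R := n.+1%:R.
have M0 : 0 < M by rewrite ltr0n.
have M1 : 1 <= M by rewrite ler1n.
pose e' := Num.min 1 (e / 3).
have e'0 : 0 < e' by rewrite lt_min ltr01 divr_gt0.
have e'M : e' <= M by rewrite ge_min M1.
(* so that the three contributions 10 (e / 30), e' and 10 M dl are at most e / 3 each *)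
pose dl := e / (30 * M).
have dl0 : 0 < dl by rewrite divr_gt0// mulr_gt0.
have [N1 HN1] := cvge0_lt (D0 e' e'0) dl0.
have e3 : 0 < e / 3 by rewrite divr_gt0.
have [N2 HN2] := cvge0_lt (I0 e e0) e3.
pose S := S_ (maxn N1 N2).
have hS1 : simple_adapted F t S by exact: hS.
have P1 : (P [set w | (e'%:E <= path_dist S w)%E] <= dl%:E)%E.
  have := HN1 (maxn N1 N2) (leq_maxl _ _).
  rewrite (_ : [set w | _] = [set w | (e'%:E <= path_dist S w)%E]); first exact: ltW.
  by apply/seteqP; split => w /=; rewrite path_dist_def.
have P2 : (P [set w | (e <= `|sp_integral W S w - I w|)%R] <= (e / 3)%:E)%E.
  have := HN2 (maxn N1 N2) (leq_maxr _ _).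
  rewrite (_ : [set w | _] = [set w | (e <= `|sp_integral W S w - I w|)%R]); first exact: ltW.
  by apply/seteqP; split => w /=; rewrite lee_fin.
have mA : measurable [set w | (M%:E < q w)%E] by exact: measurable_above.
have mB : measurable [set w | (e'%:E <= path_dist S w)%E].
  exact: measurable_atleast (measurable_path_dist hS1).
have hS' := stop_adapted HF (4 * M) tT hS1.
have mqA : measurable_fun setT (fun w => q w * (\1_[set w | (M%:E < q w)%E] w)%:E)%E.
  by apply: emeasurable_funM => //; apply/measurable_EFinP; exact: measurable_indic.
have qA0 w : (0 <= q w * (\1_[set w | (M%:E < q w)%E] w)%:E)%E.
  by apply: mule_ge0 => //; rewrite lee_fin.
exists (stop (4 * M) S); split => //.
  rewrite -lee_fin -(integral_path_dist hS').
  apply: (@le_trans _ _ (\int[P]_w (10%:E * (q w * (\1_[set w | (M%:E < q w)%E] w)%:E) +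
   (e' + 10 * M * \1_[set w | (e'%:E <= path_dist S w)%E] w)%:E))%E).
    apply: ge0_le_integral => //.
    - by move=> w _; apply: integral_ge0 => s _; rewrite lee_fin sqr_ge0.
    - exact: measurable_path_dist.
    - apply: emeasurable_funD; first exact: measurable_funeM.
      apply/measurable_EFinP; apply: measurable_funD => //.
      by apply: measurable_funM => //; exact: measurable_indic.
    - by move=> w _; exact: path_dist_stop.
  rewrite ge0_integralD//; last 4 first.
  - by move=> w _; exact: mule_ge0.
  - exact: measurable_funeM.
  - move=> w _; rewrite lee_fin addr_ge0 ?(ltW e'0)// mulr_ge0//.
    by rewrite mulr_ge0// ltW.
  - apply/measurable_EFinP; apply: measurable_funD => //.
    by apply: measurable_funM => //; exact: measurable_indic.
  rewrite ge0_integralZl//.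
  under [X in (_ + X)%E]eq_integral do rewrite EFinD EFinM.
  rewrite [X in (_ + X)%E]ge0_integralD//; last 3 first.
  - by move=> w _; rewrite lee_fin ltW.
  - by move=> w _; rewrite -EFinM lee_fin mulr_ge0// mulr_ge0// ltW.
  - apply: measurable_funeM.
    by apply/measurable_EFinP; exact: measurable_indic.
  rewrite integral_cst//= probability_setT mule1 ge0_integralZl//; last 2 first.
  - by apply/measurable_EFinP; exact: measurable_indic.
  - by rewrite lee_fin mulr_ge0// ltW.
  rewrite integral_indic// setIT.
  apply: (@le_trans _ _ (10%:E * (e / 30)%:E + (e'%:E + (10 * M)%:E * dl%:E))%E).
    apply: leeD; first by apply: lee_wpmul2l.
    apply: leeD => //; apply: lee_wpmul2l => //.
    by rewrite lee_fin mulr_ge0// ltW.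
  rewrite -!EFinM -!EFinD lee_fin.
  have -> : 10 * M * dl = e / 3.
    by rewrite /dl; field; rewrite gt_eqF.
  have : e' <= e / 3 by rewrite ge_min lexx orbT.
  by lra.
have mIS : measurable_fun setT (sp_integral W S).
  by have [] := sqi_sp_integral HF HW tT hS1.
have mC : measurable [set w | e <= `|sp_integral W S w - I w|] by exact: measurable_dev.
have sub : [set w | e <= `|I w - sp_integral W (stop (4 * M) S) w|] `<=`
   [set w | e <= `|sp_integral W S w - I w|] `|`
   ([set w | (M%:E < q w)%E] `|` [set w | (e'%:E <= path_dist S w)%E]).
  move=> w /= hw.
  have [|qM] := ltP M%:E (q w); first by right; left.
  have [|De] := leP e'%:E (path_dist S w); first by right; right.
  left; have en := path_alternatives hS1 M0 e'0 e'M qM De.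
  by rewrite -(stop_sp_integral W hS1 en) distrC.
apply: le_trans (le_measure P _ _ sub) _; rewrite ?inE.
- apply: measurable_dev => //.
  by have [] := sqi_sp_integral HF HW tT hS'.
- by apply: measurableU => //; exact: measurableU.
apply: le_trans (measureU2 P mC (measurableU _ _ mA mB)) _.
apply: (@le_trans _ _ ((e / 3)%:E + (P [set w | (M%:E < q w)%E] +
   P [set w | (e'%:E <= path_dist S w)%E])))%E.
  by apply: leeD => //; exact: measureU2.
have PA : (P [set w | (M%:E < q w)%E] <= (e / 30)%:E)%E.
  apply: le_trans tail.
  rewrite -[X in P X]setIT -integral_indic//.
  apply: ge0_le_integral => //.
  - by apply/measurable_EFinP; exact: measurable_indic.
  - move=> w _; rewrite indicE; case: (boolP (_ \in _)); last by rewrite mule0.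
    rewrite inE /= => Mq; rewrite mule1; apply: le_trans (ltW Mq).
    by rewrite lee_fin.
apply: (@le_trans _ _ ((e / 3)%:E + ((e / 30)%:E + dl%:E))%E).
  by apply: leeD => //; exact: leeD.
rewrite -!EFinD lee_fin.
have : dl <= e / 30.
  by rewrite /dl ler_pM2l// lef_pV2 ?posrE ?mulr_gt0// ler_peMr.
by lra.
Qed.

(** Two approximants are close in mean square by the isometry for simple processes,
and [fatou_in_probability] transfers this to the distance of one of them to
their limit I. *)
Lemma ito_approx (I : Omega -> R) : ito_integral P F W H t I ->
  sqi P I /\
  forall e, 0 < e -> exists S, [/\ simple_adapted F t S,
   nrm LP (fun z => cutoff t H z - joint (sp_eval S) z) <= e &
   nrm P (fun w => I w - sp_integral W S w) <= e].
Proof.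
move=> hI; have mI : measurable_fun setT I by case: hI.
have HWW := bracket_same HF HW.
have main e : 0 < e -> exists S, [/\ simple_adapted F t S,
   ip LP (fun z => joint (sp_eval S) z - cutoff t H z)
         (fun z => joint (sp_eval S) z - cutoff t H z) <= e,
   sqi P (fun w => I w - sp_integral W S w) &
   ip P (fun w => I w - sp_integral W S w) (fun w => I w - sp_integral W S w) <= 8 * e].
  move=> e0; have [S [hS SH _]] := ito_approx_in_probability hI e0.
  exists S.
  have sS := sqi_sp_integral HF HW tT hS.
  have seS := sqi_sp_eval P HF tT hS.
  have [sIS h] : sqi P (fun w => I w - sp_integral W S w) /\
      ip P (fun w => I w - sp_integral W S w) (fun w => I w - sp_integral W S w) <= 2 * (4 * e).
    apply: fatou_in_probability.
      by apply: measurable_funB => //; exact: sS.1.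
    move=> dl dl0.
    have m0 : 0 < Num.min e dl by rewrite lt_min e0.
    have [S' [hS' SH' PS']] := ito_approx_in_probability hI m0.
    have sS' := sqi_sp_integral HF HW tT hS'.
    have seS' := sqi_sp_eval P HF tT hS'.
    exists (fun w => sp_integral W S' w - sp_integral W S w); split.
    - exact: sqiB.
    - rewrite (simple_isometry_sub HW HWW tT hS' hS).
      have h := ip_subsq_le (sqi_diff hS') (sqi_diff hS).
      rewrite (_ : ip LP _ _ = ip LP
        (fun z => joint (sp_eval S') z - cutoff t H z - (joint (sp_eval S) z - cutoff t H z))
        (fun z => joint (sp_eval S') z - cutoff t H z - (joint (sp_eval S) z - cutoff t H z))).
        apply: le_trans h _.
        have : Num.min e dl <= e by rewrite ge_min lexx.
        by move=> mine; have := le_trans SH' mine; lra.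
      by apply: eq_ip => z; ring.
    - apply: (@le_trans _ _ (P [set w | Num.min e dl <= `|I w - sp_integral W S' w|])).
        apply: le_measure; rewrite ?inE.
        + apply: measurable_dev; first by apply: measurable_funB => //; exact: sS.1.
          by apply: measurable_funB; [exact: sS'.1|exact: sS.1].
        + by apply: measurable_dev => //; exact: sS'.1.
        move=> w /=; rewrite (_ : I w - _ - _ = I w - sp_integral W S' w); last by ring.
        by apply: le_trans; rewrite ge_min lexx orbT.
      by apply: le_trans PS' _; rewrite lee_fin ge_min lexx orbT.
  split => //; by lra.
split.
  have [S [hS _ sIS _]] := main 1 ltr01.
  have sS := sqi_sp_integral HF HW tT hS.
  have := sqiD sIS sS; congr sqi; apply/funext => w; by rewrite subrK.
move=> e e0.
have e8 : 0 < e ^+ 2 / 8 by rewrite divr_gt0// exprn_gt0.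
have [S [hS h1 h2 h3]] := main _ e8.
exists S; split => //.
  rewrite -(@ler_pXn2r _ 2)// ?nnegrE ?nrm_ge0 ?(ltW e0)// nrm_sqr.
  apply: le_trans (le_trans h1 _); last by rewrite ler_pdivrMr// ler_peMr ?sqr_ge0// ler1n.
  rewrite le_eqVlt; apply/orP; left; apply/eqP.
  by apply: eq_Rintegral => z _; rewrite -mulrNN !opprB.
rewrite -(@ler_pXn2r _ 2)// ?nnegrE ?nrm_ge0 ?(ltW e0)// nrm_sqr.
apply: le_trans h3 _; rewrite mulrCA divff ?mulr1//.
Qed.

End Fixed.
End ItoApproximation.

(** * Ito isometry *)

Section Limit.
Context {d1 : measure_display} {S1 : measurableType d1} {R : realType}.
Variable mu : {measure set S1 -> \bar R}.

Lemma nrmB_le (f g : S1 -> R) : sqi mu f -> sqi mu g ->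
  nrm mu g <= nrm mu f + nrm mu (fun x => f x - g x).
Proof.
move=> sf sg; have sfg := sqiB sf sg.
have := nrmD_le sf (sqiN sfg).
rewrite (_ : (fun x => f x - (f x - g x)) = g); last first.
  by apply/funext => x; rewrite subKr.
rewrite (_ : nrm mu (fun x => - (f x - g x)) = nrm mu (fun x => f x - g x))//.
by congr Num.sqrt; apply: eq_Rintegral => x _; rewrite mulrNN.
Qed.

Lemma ip_near (f g f' g' : S1 -> R) (e : R) : sqi mu f -> sqi mu g -> sqi mu f' ->
  sqi mu g' -> 0 < e -> e <= 1 ->
  nrm mu (fun x => f x - f' x) <= e -> nrm mu (fun x => g x - g' x) <= e ->
  `|ip mu f g - ip mu f' g'| <= e * (nrm mu f + nrm mu g + 1).
Proof.
move=> sf sg sf' sg' e0 e1 ff gg.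
apply: le_trans (ip_sub_le sf sg sf' sg') _.
have := nrmB_le sg sg'.
have := nrm_ge0 mu f; have := nrm_ge0 mu g'; have := nrm_ge0 mu (fun x => f x - f' x).
by move: ff gg; nra.
Qed.

End Limit.

Lemma ip_limit d1 d2 (S1 : measurableType d1) (S2 : measurableType d2) (R : realType)
  (mu : {measure set S1 -> \bar R}) (nu : {measure set S2 -> \bar R})
  (c : R) (f g : S1 -> R) (u v : S2 -> R) :
  sqi mu f -> sqi mu g -> sqi nu u -> sqi nu v ->
  (forall e, 0 < e -> exists f' g' u' v',
    [/\ sqi mu f', sqi mu g', sqi nu u' & sqi nu v'] /\
    [/\ nrm mu (fun x => f x - f' x) <= e, nrm mu (fun x => g x - g' x) <= e,
       nrm nu (fun x => u x - u' x) <= e, nrm nu (fun x => v x - v' x) <= e &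
       ip mu f' g' = c * ip nu u' v']) ->
  ip mu f g = c * ip nu u v.
Proof.
move=> sf sg su sv H.
pose C := nrm mu f + nrm mu g + 1 + `|c| * (nrm nu u + nrm nu v + 1).
have C0 : 0 < C.
  by rewrite ltr_pwDl ?ltr_wpDl ?mulr_ge0 ?addr_ge0 ?nrm_ge0.
have key e : 0 < e -> e <= 1 -> `|ip mu f g - c * ip nu u v| <= e * C.
  move=> e0 e1; have [f' [g' [u' [v' [[sf' sg' su' sv'] [ff gg uu vv E]]]]]] := H e e0.
  have := ip_near sf sg sf' sg' e0 e1 ff gg.
  have := ip_near su sv su' sv' e0 e1 uu vv.
  rewrite E => h1 h2.
  have -> : ip mu f g - c * ip nu u v = (ip mu f g - c * ip nu u' v') -
    c * (ip nu u v - ip nu u' v') by ring.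
  apply: le_trans (ler_normB _ _) _; rewrite normrM /C mulrDr lerD//.
  by rewrite mulrCA ler_wpM2l.
apply/eqP; rewrite -subr_eq0 -normr_eq0; apply/eqP/le_anti; rewrite normr_ge0 andbT.
rewrite leNgt; apply/negP; set x := `|_| => x0.
have m0 : 0 < Num.min 1 (x / (2 * C)) by rewrite lt_min ltr01 divr_gt0// mulr_gt0.
have m1 : Num.min 1 (x / (2 * C)) <= 1 by rewrite ge_min lexx.
have := key _ m0 m1; rewrite -/x leNgt => /negP; apply.
apply: (@le_lt_trans _ _ (x / (2 * C) * C)).
  by rewrite ler_pM2r// ge_min lexx orbT.
by rewrite invfM mulrA divfK ?gt_eqF// ltr_pdivrMr// mulrDr mulr1 ltrDl.
Qed.

Section ItoIsometry.
Context {R : realType} {d : measure_display} {Omega : measurableType d}.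
Variables (T : R) (P : probability Omega R) (F : R -> set (set Omega)).
Hypothesis HF : filtration T F.
Local Notation leb := (@lebesgue_measure R).
Local Notation LP := (leb \x P)%E.

Lemma ito_isometry (c t t' : R) (W V H H' : R -> Omega -> R) (I I' : Omega -> R) :
  brownian_motion T P F W -> brownian_motion T P F V -> bracket T P F c W V ->
  0 <= t -> t <= T -> 0 <= t' -> t' <= T ->
  sqi LP (cutoff t H) -> sqi LP (cutoff t' H') ->
  ito_integral P F W H t I -> ito_integral P F V H' t' I' ->
  ip P I I' = c * ip LP (cutoff t H) (cutoff t' H').
Proof.
move=> HW HV HWV t0 tT t'0 t'T sH sH' iI iI'.
have [sI aI] := ito_approx HF tT HW sH iI.
have [sI' aI'] := ito_approx HF t'T HV sH' iI'.
apply: ip_limit => // e e0.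
have [S [hS h1 h2]] := aI e e0; have [S' [hS' h1' h2']] := aI' e e0.
exists (sp_integral W S), (sp_integral V S'), (joint (sp_eval S)), (joint (sp_eval S')).
split; split => //.
- exact: (sqi_sp_integral HF HW tT hS).
- exact: (sqi_sp_integral HF HV t'T hS').
- exact: (sqi_sp_eval P HF tT hS).
- exact: (sqi_sp_eval P HF t'T hS').
- exact: (simple_isometry HF HW HV HWV tT t'T hS hS').
Qed.

Lemma ito_sqi (t : R) (W H : R -> Omega -> R) (I : Omega -> R) :
  brownian_motion T P F W -> t <= T -> sqi LP (cutoff t H) ->
  ito_integral P F W H t I -> sqi P I.
Proof. by move=> HW tT sH iI; have [] := ito_approx HF tT HW sH iI. Qed.

(** Every step of a simple process starts at or after time 0, so its increment is
orthogonal to the past of 0. *)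
Lemma ito_initial (t : R) (W H : R -> Omega -> R) (I xi : Omega -> R) :
  brownian_motion T P F W -> 0 <= t -> t <= T ->
  sqi LP (cutoff t H) -> ito_integral P F W H t I ->
  measurable_at F 0 xi -> sqi P xi -> ip P xi I = 0.
Proof.
move=> HW t0 tT sH iI mxi sxi.
have [sI aI] := ito_approx HF tT HW sH iI.
rewrite (@ip_limit _ _ _ _ _ P P 0 xi I (fun=> 0) (fun=> 0)) ?mul0r//; try exact: sqi0.
move=> e e0; have [S [hS h1 h2]] := aI e e0.
have n0 d1 (S1 : measurableType d1) (mu : {measure set S1 -> \bar R}) (f : S1 -> R) :
   nrm mu (fun x => f x - f x) <= e.
  rewrite /nrm (_ : ip _ _ _ = 0) ?sqrtr0 ?ltW// -[RHS](ip0l mu (fun=> 0)).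
  by apply: eq_ip => x; rewrite subrr.
have sS := sqi_sp_integral HF HW tT hS.
exists xi, (sp_integral W S), (fun=> 0), (fun=> 0).
split; split => //; try exact: sqi0; try exact: n0.
rewrite mul0r sp_integralE ip_sumr//; last first.
  move=> i _; have [s0 s1 s2] := simple_times i hS.
  by apply: (sqi_step_bounded HF HW) => //; [exact: le_trans s2 tT|exact: simple_bounded_at hS].
apply: big1 => i _; have [s0 s1 s2] := simple_times i hS.
have s2T := le_trans s2 tT; have s1T := le_trans s1 s2T.
have [mv bv] := simple_bounded_at i hS.
apply: (ip_future HF HW) => //.
- exact: (measurable_at_le HF (lexx 0) s0 s1T).
- by apply: (bounded_at_sqi P HF _ (simple_bounded_at i hS)); rewrite s0.
Qed.

End ItoIsometry.

(** * Fubini for real integrals and the square of an integral *)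

Lemma Rintegral_indic d (S : measurableType d) (R : realType)
    (mu : {measure set S -> \bar R}) (A : set S) (f : S -> R) :
  \int[mu]_x (\1_A x * f x) = \int[mu]_(x in A) f x.
Proof.
rewrite [RHS]Rintegral_mkcond; apply: eq_Rintegral => r _.
by rewrite patchE indicE; case: ifPn => _; rewrite ?mul1r ?mul0r.
Qed.

Lemma integrable_indicM d (S : measurableType d) (R : realType)
    (mu : {measure set S -> \bar R}) (A : set S) (f : S -> R) : measurable A ->
  mu.-integrable setT (EFin \o f) ->
  mu.-integrable setT (EFin \o (fun s => \1_A s * f s)).
Proof.
move=> mA fi.
have mf : measurable_fun setT f by apply/measurable_EFinP; exact: measurable_int fi.
apply: le_integrable fi => //.
  by apply/measurable_EFinP; apply: measurable_funM => //; exact: measurable_indic.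
by move=> s _ /=; rewrite lee_fin indicE; case: (_ \in _); rewrite ?mul0r ?mul1r ?normr0.
Qed.

Section FubiniReal.
Context d1 d2 (T1 : measurableType d1) (T2 : measurableType d2) (R : realType).
Variable m1 : {sigma_finite_measure set T1 -> \bar R}.
Variable m2 : {sigma_finite_measure set T2 -> \bar R}.
Variable f : T1 * T2 -> R.
Hypothesis fi : (m1 \x m2)%E.-integrable setT (EFin \o f).

Lemma Rfubini1_integrable : (forall x, m2.-integrable setT (EFin \o (fun y => f (x, y)))) ->
  m1.-integrable setT (EFin \o (fun x => \int[m2]_y f (x, y))).
Proof.
move=> h; have := integrable_fubini_F fi.
by apply: eq_integrable => // x _ /=; rewrite /fubini_F -integral_EFin.
Qed.

Lemma Rfubini1 : (forall x, m2.-integrable setT (EFin \o (fun y => f (x, y)))) ->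
  \int[m1]_x (\int[m2]_y f (x, y)) = \int[(m1 \x m2)%E]_z f z.
Proof.
move=> h.
have E : EFin \o (fun x => \int[m2]_y f (x, y)) = fubini_F m2 (EFin \o f).
  by apply/funext => x /=; rewrite /fubini_F -integral_EFin.
by rewrite /Rintegral -(integral12_prod_meas1 fi); congr fine; rewrite -E.
Qed.

Lemma Rfubini2 : (forall y, m1.-integrable setT (EFin \o (fun x => f (x, y)))) ->
  \int[m2]_y (\int[m1]_x f (x, y)) = \int[(m1 \x m2)%E]_z f z.
Proof.
move=> h.
have E : EFin \o (fun y => \int[m1]_x f (x, y)) = fubini_G m1 (EFin \o f).
  by apply/funext => x /=; rewrite /fubini_G -integral_EFin.
rewrite /Rintegral -(integral21_prod_meas1 fi); congr fine.
by rewrite -E.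
Qed.

End FubiniReal.

Section Primitive.
Context {R : realType}.
Local Notation leb := (@lebesgue_measure R).
Variables (g : R -> R).
Hypothesis gi : leb.-integrable setT (EFin \o g).

(** The square splits along the diagonal into two triangles of equal integral; in
differential form, (G^2)' = 2 G' G. *)
Lemma sqr_integral : (\int[leb]_s g s) ^+ 2 =
  2 * \int[leb]_s (g s * \int[leb]_r (\1_(`]-oo, s]) r * g r)).
Proof.
pose D : set (measurableTypeR R * measurableTypeR R) := [set z | z.2 <= z.1].
have mD : measurable D.
  have m1 : measurable_fun setT
      (fun z : measurableTypeR R * measurableTypeR R => z.2 <= z.1).
    by apply: measurable_fun_ler; [exact: measurable_snd|exact: measurable_fst].
  have := m1 measurableT [set true] I.
  by rewrite setTI; congr measurable; apply/seteqP; split => z.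
have inD (s r : measurableTypeR R) : ((s, r) \in D) = (r <= s).
  by apply/idP/idP; rewrite inE.
have inI (s r : R) : (r \in `]-oo, s]%classic) = (r <= s).
  by apply/idP/idP; rewrite inE /= in_itv.
have inO (s r : R) : (s \in `]-oo, r[%classic) = (s < r).
  by apply/idP/idP; rewrite inE /= in_itv.
have gg := tensor_integrable gi gi.
have iD (A : set (measurableTypeR R * measurableTypeR R)) : measurable A ->
    (leb \x leb)%E.-integrable setT
      (EFin \o (fun z : measurableTypeR R * measurableTypeR R => \1_A z * (g z.1 * g z.2))).
  by move=> mA; apply: integrable_indicM.
have -> : (\int[leb]_s g s) ^+ 2 = \int[(leb \x leb)%E]_z (g z.1 * g z.2).
  by rewrite expr2 [RHS]/Rintegral tensor_integral.
have sp (z : measurableTypeR R * measurableTypeR R) : g z.1 * g z.2 =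
    \1_D z * (g z.1 * g z.2) + \1_(~` D) z * (g z.1 * g z.2).
  have [zD|zD] := pselect (D z).
    by rewrite !indicE mem_set// memNset//= mul1r mul0r addr0.
  by rewrite !indicE memNset// mem_set//= mul1r mul0r add0r.
transitivity (\int[(leb \x leb)%E]_z (\1_D z * (g z.1 * g z.2) + \1_(~` D) z * (g z.1 * g z.2))).
  by apply: eq_Rintegral => z _; exact: sp.
rewrite RintegralD//; [|exact: iD|by apply: iD; exact: measurableC].
rewrite mulr_natl mulr2n; congr (_ + _).
  rewrite -(Rfubini1 (iD D mD)); last first.
    move=> s /=.
    have := integrableZl measurableT (g s)
      (@integrable_indicM _ _ _ leb `]-oo, s]%classic _ (measurable_itv _) gi).
    apply: eq_integrable => // r _ /=; rewrite -EFinM; congr EFin.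
    by rewrite mulrCA !indicE inD inI.
  apply: eq_Rintegral => s _.
  rewrite -RintegralZl//; last by apply: integrable_indicM.
  by apply: eq_Rintegral => r _; rewrite mulrCA !indicE inD inI.
have ndiag : \int[(leb \x leb)%E]_z (\1_(~` D) z * (g z.1 * g z.2)) =
    \int[leb]_r (g r * \int[leb]_s (\1_(`]-oo, r[) s * g s)).
  have indE s r : \1_(~` D) ((s, r) : measurableTypeR R * measurableTypeR R) = \1_(`]-oo, r[) s :> R.
    by rewrite !indicE in_setC inD inO ltNge.
  rewrite -(Rfubini2 (iD _ (measurableC mD))); last first.
    move=> r /=.
    have := integrableZl measurableT (g r)
      (@integrable_indicM _ _ _ leb `]-oo, r[%classic _ (measurable_itv _) gi).
    apply: eq_integrable => // s _ /=; rewrite -EFinM; congr EFin.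
    by rewrite indE; ring.
  apply: eq_Rintegral => r _.
  rewrite -RintegralZl//; last by apply: integrable_indicM.
  by apply: eq_Rintegral => s _; rewrite indE /=; ring.
rewrite ndiag; apply: eq_Rintegral => s _; congr (_ * _).
(* the diagonal is negligible *)
rewrite !Rintegral_indic; apply: Rintegral_itv_bndo_bndc.
exact: integrableS gi.
Qed.

End Primitive.

(** * Energy identity of a linear Volterra equation *)

Lemma Rintegral_le0 d (S : measurableType d) (R : realType)
    (mu : {measure set S -> \bar R}) (f : S -> R) :
  (forall x, f x <= 0) -> \int[mu]_x f x <= 0.
Proof.
move=> f0; rewrite /Rintegral fine_le0// integralE.
rewrite integral0_eq ?sub0e ?oppe_le0; last first.
  by move=> x _; rewrite funeposE max_r// lee_fin.
by apply: integral_ge0.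
Qed.

Lemma maxr_split (R : realType) (x : R) : x = Num.max x 0 - Num.max (- x) 0.
Proof.
have [x0|x0] := leP 0 x.
  by rewrite (max_r (_ : - x <= 0)) ?subr0// oppr_le0.
by rewrite max_l ?sub0r ?opprK// oppr_ge0 ltW.
Qed.

Lemma measurable_slab_le (R : realType) d (Omega : measurableType d) (t : R) :
  measurable ([set z | z.1 <= t] : set (measurableTypeR R * Omega)).
Proof.
have m1 : measurable_fun setT (fun z : measurableTypeR R * Omega => z.1 <= t).
  by apply: measurable_fun_ler => //; exact: measurable_fst.
have := m1 measurableT [set true] I.
by rewrite setTI; congr measurable; apply/seteqP; split => z.
Qed.

Lemma indic_sqr (R : realType) (S : Type) (A : set S) (x : S) :
  \1_A x ^+ 2 = \1_A x :> R.
Proof. by rewrite indicE; case: (_ \in _); rewrite ?expr1n ?expr0n. Qed.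

Section Volterra.
Context {R : realType} {d : measure_display} {Omega : measurableType d}.
Variable P : probability Omega R.
Local Notation leb := (@lebesgue_measure R).
Local Notation LP := (leb \x P)%E.
Variables (y : measurableTypeR R * Omega -> R) (dd T : R).
Hypotheses (dd0 : 0 <= dd) (T0 : 0 <= T).
Hypothesis sy : sqi LP y.
Hypothesis ysupp : forall s w, ~~ (0 <= s <= T) -> y (s, w) = 0.
Hypothesis ypath : forall w, sqi leb (fun s => y (s, w)).

Definition primitive (t : R) (w : Omega) : R :=
  \int[leb]_s (\1_(`]-oo, t]) s * y (s, w)).
Local Notation Z := primitive.

Let indI (s t : R) : \1_(`]-oo, t]) s = ((s <= t)%R)%:R :> R.
Proof.
by rewrite indicE; congr (nat_of_bool _)%:R; apply/idP/idP; rewrite inE /= in_itv.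
Qed.

Let yT s w : y (s, w) = \1_(`[0, T]) s * y (s, w).
Proof.
rewrite indicE; case: (boolP (_ \in _)); first by rewrite mul1r.
by rewrite notin_setE /= in_itv => /negP/ysupp ->; rewrite mulr0.
Qed.

Let sI : sqi leb (\1_(`[0, T]) : R -> R).
Proof.
exact: sqi_indic_itv.
Qed.

Let ipI : ip leb (\1_(`[0, T]) : R -> R) (\1_(`[0, T]) : R -> R) = T.
Proof.
transitivity (\int[leb]_s (\1_(`[0, T]) s : R)).
  by apply: eq_Rintegral => s _; rewrite indicE; case: (_ \in _); rewrite ?mulr1 ?mulr0.
rewrite /Rintegral integral_indic//= setIT lebesgue_measure_itv/= lte_fin.
case: ltP => h; first by rewrite oppr0 addr0.
by apply/le_anti; rewrite h T0.
Qed.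

Let path_int w : leb.-integrable setT (EFin \o (fun s => y (s, w))).
Proof.
have := sqi_mul_integrable sI (ypath w).
by apply: eq_integrable => // s _ /=; rewrite -yT.
Qed.

Let path_indic t w : leb.-integrable setT (EFin \o (fun s => \1_(`]-oo, t]) s * y (s, w))).
Proof. by apply: integrable_indicM. Qed.

Let energy (w : Omega) : R := ip leb (fun s => y (s, w)) (fun s => y (s, w)).

Let energy_int : P.-integrable setT (EFin \o energy).
Proof.
have my2 : measurable_fun setT (fun z => (y z ^+ 2)%:E).
  by apply/measurable_EFinP; apply: measurable_funX; exact: sy.1.
have y20 z : (0 <= (y z ^+ 2)%:E)%E by rewrite lee_fin sqr_ge0.
have E w : (energy w)%:E = (\int[leb]_s (y (s, w) ^+ 2)%:E)%E.
  by rewrite ip_ge0_EFin.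
apply/integrableP; split.
  rewrite (_ : EFin \o energy = fubini_G leb (fun z => (y z ^+ 2)%:E)).
    exact: measurable_fun_fubini_tonelli_G.
  by apply/funext => w; rewrite /= E.
rewrite (eq_integral (fubini_G leb (fun z => (y z ^+ 2)%:E))).
  by rewrite -fubini_tonelli2// ip_ge0_EFin// ltry.
by move=> w _; rewrite /= ger0_norm ?ip_ge0// E.
Qed.

Let Z_bound t w : Z t w ^+ 2 <= T * energy w.
Proof.
have -> : Z t w = ip leb (fun s => \1_(`]-oo, t]) s * \1_(`[0, T]) s) (fun s => y (s, w)).
  by apply: eq_Rintegral => s _; rewrite -mulrA -yT.
have sJ : sqi leb (fun s => \1_(`]-oo, t]) s * \1_(`[0, T]) s : R).
  split; first by apply: measurable_funM; exact: measurable_indic.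
  have := @integrable_indicM _ _ _ leb `]-oo, t]%classic _ (measurable_itv _) sI.2.
  apply: eq_integrable => // s _ /=; congr EFin.
  by rewrite exprMn; congr (_ * _); rewrite indicE; case: (_ \in _); rewrite ?expr1n ?expr0n.
apply: le_trans (CauchySchwarz sJ (ypath w)) _.
rewrite ler_wpM2r ?ip_ge0// -[leRHS]ipI.
apply: le_Rintegral => //; try exact: sqi_mul_integrable.
move=> s _; rewrite !indicE.
by case: (_ \in _); case: (_ \in _); rewrite ?mul1r ?mulr1 ?mul0r ?mulr0.
Qed.

Let measurable_Z : measurable_fun setT (fun z : measurableTypeR R * Omega => Z z.1 z.2).
Proof.
pose u (x : (measurableTypeR R * Omega) * measurableTypeR R) : R :=
  if x.2 <= x.1.1 then y (x.2, x.1.2) else 0.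
have mu : measurable_fun setT u.
  apply: measurable_fun_ifT => //.
    apply: measurable_fun_ler; first exact: measurable_snd.
    by apply: measurableT_comp; [exact: measurable_fst|exact: measurable_fst].
  apply: (@measurableT_comp _ _ _ _ _ _ y); first exact: sy.1.
  apply: measurable_fun_pair; first exact: measurable_snd.
  by apply: measurableT_comp; [exact: measurable_snd|exact: measurable_fst].
have m1 : measurable_fun setT (fun x => (Num.max (u x) 0)%:E).
  by apply/measurable_EFinP; apply: measurable_maxr.
have m2 : measurable_fun setT (fun x => (Num.max (- u x) 0)%:E).
  by apply/measurable_EFinP; apply: measurable_maxr => //; exact: measurableT_comp.
have p1 x : (0 <= (Num.max (u x) 0)%:E)%E by rewrite lee_fin le_max lexx orbT.
have p2 x : (0 <= (Num.max (- u x) 0)%:E)%E by rewrite lee_fin le_max lexx orbT.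
have mm1 := @measurable_fun_fubini_tonelli_F _ _ _ _ _ leb _ m1 p1.
have mm2 := @measurable_fun_fubini_tonelli_F _ _ _ _ _ leb _ m2 p2.
(* measurability of parametrised integrals is for nonnegative integrands,
   hence the splitting into positive and negative parts *)
have ZE : (fun z : measurableTypeR R * Omega => Z z.1 z.2) =
    (fun z => fine (fubini_F leb (fun x => (Num.max (u x) 0)%:E) z) -
              fine (fubini_F leb (fun x => (Num.max (- u x) 0)%:E) z)).
  apply/funext => z.
  have iu : leb.-integrable setT (EFin \o (fun r => u (z, r))).
    have := path_indic z.1 z.2; apply: eq_integrable => // r _ /=.
    by rewrite indI /u /=; case: (_ <= _); rewrite ?mul1r ?mul0r.
  have mur : measurable_fun setT (fun r => u (z, r)).
    by apply/measurable_EFinP; exact: measurable_int iu.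
  have i1 : leb.-integrable setT (EFin \o (fun r => Num.max (u (z, r)) 0)).
    apply: le_integrable iu => //.
      by apply/measurable_EFinP; apply: measurable_maxr.
    move=> r _ /=; rewrite lee_fin ger0_norm ?le_max ?lexx ?orbT//.
    by rewrite ge_max ler_norm normr_ge0.
  have i2 : leb.-integrable setT (EFin \o (fun r => Num.max (- u (z, r)) 0)).
    apply: le_integrable iu => //.
      by apply/measurable_EFinP; apply: measurable_maxr => //; exact: measurableT_comp.
    move=> r _ /=; rewrite lee_fin ger0_norm ?le_max ?lexx ?orbT//.
    by rewrite ge_max -normrN ler_norm normr_ge0.
  rewrite -[RHS](RintegralB measurableT i1 i2).
  apply: eq_Rintegral => r _; rewrite indI.
  have -> : ((r <= z.1)%R)%:R * y (r, z.2) = u (z, r).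
    by rewrite /u /=; case: (_ <= _); rewrite ?mul1r ?mul0r.
  exact: maxr_split.
rewrite ZE; apply: measurable_funB.
  by apply: measurableT_comp.
by apply: measurableT_comp.
Qed.

Lemma sqi_primitive t : sqi P (Z t).
Proof.
have mZ : measurable_fun setT (Z t).
  exact: (@measurableT_comp _ _ _ _ _ _ (fun z : measurableTypeR R * Omega => Z z.1 z.2)
    _ (pair t) measurable_Z (measurable_pair1 t)).
split => //; have := integrableZl measurableT T energy_int.
apply: le_integrable => //.
  by apply/measurable_EFinP; exact: measurable_funX.
move=> w _ /=; rewrite lee_fin [leLHS]ger0_norm ?sqr_ge0// (le_trans (Z_bound t w))//.
exact: ler_norm.
Qed.

Let sqi_ZT : sqi LP (fun z => \1_(`[0, T]) z.1 * Z z.1 z.2).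
Proof.
have m1 : measurable_fun setT (fun z : measurableTypeR R * Omega => \1_(`[0, T]) z.1 * Z z.1 z.2).
  apply: measurable_funM; last exact: measurable_Z.
  by apply: measurableT_comp; [exact: measurable_indic|exact: measurable_fst].
split => //.
have := tensor_integrable (integrable_indic_itv 0 T true false) (integrableZl measurableT T energy_int).
apply: le_integrable => //.
  by apply/measurable_EFinP; exact: measurable_funX.
move=> z _ /=; rewrite lee_fin [leLHS]ger0_norm ?sqr_ge0// exprMn.
apply: le_trans (ler_norm _).
rewrite [X in X ^+ 2 * _ <= _]indicE [X in _ <= X * _]indicE.
case: (_ \in _); rewrite ?expr1n ?expr0n ?mul1r ?mul0r//.
Qed.

Let sqi_Zpath w : sqi leb (fun s => \1_(`[0, T]) s * Z s w).
Proof.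
have m1 : measurable_fun setT (fun s : measurableTypeR R => \1_(`[0, T]) s * Z s w).
  apply: measurable_funM; first exact: measurable_indic.
  exact: (@measurableT_comp _ _ _ _ _ _ (fun z : measurableTypeR R * Omega => Z z.1 z.2)
    _ (fun s => (s, w)) measurable_Z (measurable_pair2 w)).
split => //.
have := integrableZl measurableT (T * energy w) (integrable_indic_itv 0 T true false).
apply: le_integrable => //.
  by apply/measurable_EFinP; exact: measurable_funX.
move=> s _ /=; rewrite lee_fin [leLHS]ger0_norm ?sqr_ge0// exprMn.
apply: le_trans (ler_norm _).
rewrite [X in X ^+ 2 * _ <= _]indicE [X in _ <= _ * X]indicE.
case: (_ \in _); rewrite ?expr1n ?expr0n ?mul1r ?mul0r ?mulr1 ?mulr0//.
Qed.

Let N (t : R) (w : Omega) : R := y (t, w) + dd * Z t w.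

Hypothesis sN : forall t, 0 <= t <= T -> sqi P (N t).
Hypothesis mart : forall s t, 0 <= s -> s <= t -> t <= T ->
  ip P (N s) (N t) = ip P (N s) (N s).

Lemma sqi_slice t : sqi P (fun w => y (t, w)).
Proof.
have [tT|tT] := boolP (0 <= t <= T).
  have := sqiB (sN tT) (sqiZ dd (sqi_primitive t)).
  by congr sqi; apply/funext => w; rewrite /N addrK.
rewrite (_ : (fun _ => _) = fun=> 0); first exact: sqi0.
by apply/funext => w; rewrite ysupp.
Qed.

Let test_int (xi : Omega -> R) : sqi P xi ->
  LP.-integrable setT (EFin \o (fun z => xi z.2 * y z)).
Proof.
move=> sx.
have sxI : sqi LP (fun z => xi z.2 * \1_(`[0, T]) z.1).
  split.
    apply: measurable_funM.
      by apply: measurableT_comp; [exact: sx.1|exact: measurable_snd].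
    by apply: measurableT_comp; [exact: measurable_indic|exact: measurable_fst].
  have := tensor_integrable (integrable_indic_itv 0 T true false) sx.2.
  apply: eq_integrable => // z _ /=; congr EFin.
  by rewrite exprMn mulrC; congr (_ * _); rewrite indicE; case: (_ \in _); rewrite ?expr1n ?expr0n.
have := sqi_mul_integrable sxI sy.
apply: eq_integrable => // -[s w] _ /=.
by rewrite -mulrA -yT.
Qed.

Let mslab (t : R) : measurable ([set z | z.1 <= t] : set (measurableTypeR R * Omega)).
Proof.
exact: measurable_slab_le.
Qed.

Let indS (t s : R) (w : Omega) :
  \1_([set z | z.1 <= t] : set (measurableTypeR R * Omega)) (s, w) = \1_(`]-oo, t]) s :> R.
Proof.
by rewrite indI indicE; congr (nat_of_bool _)%:R; apply/idP/idP; rewrite inE.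
Qed.

Let test_slice_int (xi : Omega -> R) : sqi P xi ->
  leb.-integrable setT (EFin \o (fun s => ip P xi (fun w => y (s, w)))).
Proof.
move=> sx; apply: (Rfubini1_integrable (test_int sx)) => s.
exact: sqi_mul_integrable sx (sqi_slice s).
Qed.

Let ip_primitive (xi : Omega -> R) t : sqi P xi ->
  ip P xi (Z t) = \int[leb]_s (\1_(`]-oo, t]) s * ip P xi (fun w => y (s, w))).
Proof.
move=> sx.
have fi := integrable_indicM (mslab t) (test_int sx).
transitivity (\int[P]_w \int[leb]_s
   (\1_[set z : measurableTypeR R * Omega | z.1 <= t] (s, w) * (xi w * y (s, w)))).
  apply: eq_Rintegral => w _; rewrite -RintegralZl//.
  by apply: eq_Rintegral => s _; rewrite indS mulrCA.
rewrite (Rfubini2 fi); last first.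
  move=> w /=; have := integrableZl measurableT (xi w) (path_indic t w).
  by apply: eq_integrable => // s _ /=; rewrite -EFinM indS mulrCA.
rewrite -(Rfubini1 fi).
  apply: eq_Rintegral => s _ /=.
  by rewrite -RintegralZl//; exact: sqi_mul_integrable sx (sqi_slice s).
move=> s /=.
have := integrableZl measurableT (\1_(`]-oo, t]) s) (sqi_mul_integrable sx (sqi_slice s)).
by apply: eq_integrable => // w _ /=; rewrite -EFinM indS.
Qed.

(** With phi(s) = E (N_t - N_r) y_s and Phi its primitive, the orthogonality of
N_t - N_r to N_s for s <= r reads phi = - dd Phi on [0, r]. Hence
Phi(r)^2 = 2 \int_0^r phi Phi <= 0, so Phi(r) = 0 and then phi(r) = 0. *)
Let slice_future (r t : R) : 0 <= r -> r <= t -> t <= T ->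
  ip P (fun w => N t w - N r w) (fun w => y (r, w)) = 0.
Proof.
move=> r0 rt tT.
have ht : 0 <= t <= T by rewrite tT (le_trans r0).
have hr : 0 <= r <= T by rewrite r0 (le_trans rt).
pose xi w := N t w - N r w.
have sx : sqi P xi by apply: sqiB; exact: sN.
pose phi s := ip P xi (fun w => y (s, w)).
have iphi := test_slice_int sx.
pose Phi s := \int[leb]_u (\1_(`]-oo, s]) u * phi u).
have phiE s : 0 <= s -> s <= r -> phi s = - (dd * Phi s).
  move=> s0 sr; have hs : 0 <= s <= T by rewrite s0 (le_trans sr)// (le_trans rt).
  have : ip P xi (N s) = 0.
    rewrite ipC ipBr//; try exact: sN.
    by rewrite (mart s0 (le_trans sr rt) tT) (mart s0 sr (le_trans rt tT)) subrr.
  rewrite /N ipDr//; [|exact: sqi_slice|exact: sqiZ (sqi_primitive s)].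
  rewrite ipZr//; last exact: sqi_primitive.
  by rewrite ip_primitive// -/(phi s) -/(Phi s) => h; lra.
have phi_neg s : s < 0 -> phi s = 0.
  move=> s0; rewrite /phi ipC -[RHS](ip0l P xi); apply: eq_ip => // w.
  by apply: ysupp; rewrite negb_and -ltNge s0.
pose g s := \1_(`]-oo, r]) s * phi s.
have ig : leb.-integrable setT (EFin \o g) by exact: integrable_indicM.
have := sqr_integral ig.
rewrite (_ : \int[leb]_s g s = Phi r)// => E.
have : Phi r ^+ 2 <= 0.
  rewrite E pmulr_rle0//; apply: Rintegral_le0 => s; rewrite /g indI.
  have [sr|] := leP s r; last by rewrite !mul0r.
  have [s0|s0] := ltP s 0; first by rewrite phi_neg// mulr0 mul0r.
  rewrite (_ : \int[leb]_u _ = Phi s); last first.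
    apply: eq_Rintegral => u _; rewrite !indI.
    have [us|] := leP u s; last by rewrite !mul0r.
    by rewrite (le_trans us sr) !mul1r.
  by rewrite mul1r phiE// mulNr -mulrA oppr_le0 mulr_ge0// -expr2 sqr_ge0.
rewrite -[LHS]/(phi r) phiE// => Phi0.
have /eqP : Phi r ^+ 2 = 0 by apply/le_anti; rewrite Phi0 sqr_ge0.
by rewrite sqrf_eq0 => /eqP ->; rewrite mulr0 oppr0.
Qed.

Let cross_int t : LP.-integrable setT
  (EFin \o (fun z => \1_[set z : measurableTypeR R * Omega | z.1 <= t] z * (y z * Z z.1 z.2))).
Proof.
apply: integrable_indicM => //.
have := sqi_mul_integrable sy sqi_ZT; apply: eq_integrable => // -[s w] _ /=.
by congr EFin; rewrite mulrCA -[y (s, w) in RHS]/(y (s, w)) [in RHS]yT mulrA.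
Qed.

Let cross_slice t s : P.-integrable setT (EFin \o (fun w =>
  \1_[set z : measurableTypeR R * Omega | z.1 <= t] (s, w) * (y (s, w) * Z s w))).
Proof.
have := integrableZl measurableT (\1_(`]-oo, t]) s) (sqi_mul_integrable (sqi_slice s) (sqi_primitive s)).
by apply: eq_integrable => // w _ /=; rewrite -EFinM indS.
Qed.

Let ip_primitive_self t :
  ip P (Z t) (Z t) = 2 * \int[leb]_s (\1_(`]-oo, t]) s * ip P (fun w => y (s, w)) (Z s)).
Proof.
have E w : Z t w * Z t w = 2 * \int[leb]_s
    (\1_[set z : measurableTypeR R * Omega | z.1 <= t] (s, w) * (y (s, w) * Z s w)).
  rewrite -expr2 (sqr_integral (path_indic t w)); congr (_ * _).
  apply: eq_Rintegral => s _; rewrite indS -mulrA indI.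
  have [st|] := leP s t; rewrite ?mul0r// !mul1r; congr (_ * _).
  apply: eq_Rintegral => u _; rewrite !indI mulrA -natrM mulnb.
  by congr ((nat_of_bool _)%:R * _); have [us|] := leP u s; rewrite //= (le_trans us).
transitivity (\int[P]_w (2 * \int[leb]_s
    (\1_[set z : measurableTypeR R * Omega | z.1 <= t] (s, w) * (y (s, w) * Z s w)))).
  by apply: eq_Rintegral => w _; rewrite E.
have zz := sqi_mul_integrable (sqi_primitive t) (sqi_primitive t).
rewrite RintegralZl//; last first.
  have := integrableZl measurableT 2^-1 zz.
  apply: eq_integrable => // w _ /=; rewrite -EFinM E; congr EFin.
  by rewrite mulKf// pnatr_eq0.
congr (_ * _).
rewrite (Rfubini2 (cross_int t)); last first.
  move=> w /=; apply: (@integrable_indicM _ _ _ leb [set s | s <= t] (fun s => y (s, w) * Z s w)) => //.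
    by rewrite -set_itvNyc.
  have := sqi_mul_integrable (ypath w) (sqi_Zpath w); apply: eq_integrable => // s _ /=.
  by congr EFin; rewrite mulrCA [in RHS]yT mulrA.
rewrite -(Rfubini1 (cross_int t)); last by move=> s; exact: cross_slice.
apply: eq_Rintegral => s _ /=.
by rewrite -RintegralZl//; exact: sqi_mul_integrable (sqi_slice s) (sqi_primitive s).
Qed.

(** Expanding |N_t|^2 = |y_t + dd Z_t|^2 and using |Z_t|^2 = 2 \int_0^t <y_s, Z_s>,
everything is expressed by pairings; [slice_future] replaces <N_t, y_s> by
<N_s, y_s>, which closes the computation. *)
Lemma volterra_energy t : 0 <= t <= T ->
  ip P (fun w => y (t, w)) (fun w => y (t, w)) +
  2 * dd * \int[leb]_s (\1_(`]-oo, t]) s * ip P (fun w => y (s, w)) (fun w => y (s, w))) =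
  ip P (N t) (N t).
Proof.
move=> ht; have /andP[t0 tT] := ht.
have sZ := sqi_primitive t; have sy' := sqi_slice t; have sNt := sN ht.
have b := ip_primitive_self t.
have a := ip_primitive t sNt.
have iyy : leb.-integrable setT (EFin \o (fun s =>
    \1_(`]-oo, t]) s * ip P (fun w => y (s, w)) (fun w => y (s, w)))).
  apply: integrable_indicM => //.
  apply: (@Rfubini1_integrable _ _ _ _ _ leb P (fun z => y z * y z)).
    exact: sqi_mul_integrable.
  move=> s; exact: sqi_mul_integrable (sqi_slice s) (sqi_slice s).
have iyZ : leb.-integrable setT (EFin \o (fun s => \1_(`]-oo, t]) s * ip P (fun w => y (s, w)) (Z s))).
  have := Rfubini1_integrable (cross_int t) (cross_slice t).
  apply: eq_integrable => // s _ /=; congr EFin.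
  by rewrite -RintegralZl//; exact: sqi_mul_integrable (sqi_slice s) (sqi_primitive s).
have aE : \int[leb]_s (\1_(`]-oo, t]) s * ip P (N t) (fun w => y (s, w))) =
  \int[leb]_s (\1_(`]-oo, t]) s * ip P (fun w => y (s, w)) (fun w => y (s, w))) +
  dd * \int[leb]_s (\1_(`]-oo, t]) s * ip P (fun w => y (s, w)) (Z s)).
  rewrite -RintegralZl// -RintegralD//; last first.
    have := integrableZl measurableT dd iyZ.
    by apply: eq_integrable.
  apply: eq_Rintegral => s _; rewrite indI.
  have [st|] := leP s t; rewrite ?mul0r ?mulr0 ?addr0// !mul1r.
  have [s0|s0] := ltP s 0.
    have E0 : (fun w => y (s, w)) = fun=> 0.
      by apply/funext => w; apply: ysupp; rewrite negb_and -ltNge s0.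
    by rewrite E0 ipC !ip0l mulr0 addr0.
  have hs : 0 <= s <= T by rewrite s0 (le_trans st).
  have := slice_future s0 st tT; rewrite ipBl//; [|exact: sN|exact: sqi_slice].
  move=> /eqP; rewrite subr_eq0 => /eqP ->.
  rewrite /N ipDl//; [|exact: sqi_slice|exact: sqiZ (sqi_primitive s)|exact: sqi_slice].
  by rewrite ipZl ?(ipC _ (Z s))//; [exact: sqi_primitive|exact: sqi_slice].
rewrite aE in a.
have c : ip P (N t) (Z t) = ip P (fun w => y (t, w)) (Z t) + dd * ip P (Z t) (Z t).
  by rewrite /N ipDl ?ipZl//; exact: sqiZ.
have e : ip P (N t) (N t) = ip P (fun w => y (t, w)) (fun w => y (t, w)) +
   2 * dd * ip P (fun w => y (t, w)) (Z t) + dd ^+ 2 * ip P (Z t) (Z t).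
  have sdZ := sqiZ dd sZ.
  by rewrite {1 2}/N ipDD// ipZl// !ipZr//; ring.
rewrite e; move: a b c.
set v := \int[leb]_s _; set x := \int[leb]_s _.
set nz := ip _ _ _; set zz := ip _ _ _; set yz := ip P _ (Z t).
move=> a b c.
have -> : yz = v + dd * x - dd * zz by lra.
rewrite b; ring.
Qed.

End Volterra.

(** * Equation for the second moments of the components *)

Section AlmostEverywhere.
Context {d : measure_display} {S : measurableType d} {R : realType}.
Variable mu : {measure set S -> \bar R}.

Lemma sqi_ae (f f' : S -> R) : measurable_fun setT f' -> sqi mu f ->
  {ae mu, forall x, f x = f' x} -> sqi mu f'.
Proof.
move=> mf' sf ff'; apply: sqiP => //.
have -> : (\int[mu]_x (f' x ^+ 2)%:E = \int[mu]_x (f x ^+ 2)%:E)%E; last first.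
  by rewrite ip_ge0_EFin// ltry.
apply/esym/ae_eq_integral => //.
- by apply/measurable_EFinP; apply: measurable_funX; exact: sf.1.
- by apply/measurable_EFinP; exact: measurable_funX.
- by move: ff'; apply: filterS => x /= -> _.
Qed.

Lemma ip_ae (f f' g : S -> R) : sqi mu f -> sqi mu f' -> sqi mu g ->
  {ae mu, forall x, f x = f' x} -> ip mu f g = ip mu f' g.
Proof.
move=> sf sf' sg ff'; rewrite /ip /Rintegral; congr fine.
apply: ae_eq_integral => //.
- by apply/measurable_EFinP; apply: measurable_funM; [exact: sf.1|exact: sg.1].
- by apply/measurable_EFinP; apply: measurable_funM; [exact: sf'.1|exact: sg.1].
- by move: ff'; apply: filterS => x /= -> _.
Qed.

End AlmostEverywhere.

Section Cutoff.
Context {R : realType} {d : measure_display} {Omega : measurableType d}.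
Variable P : probability Omega R.
Local Notation leb := (@lebesgue_measure R).
Local Notation LP := (leb \x P)%E.

Lemma cutoff_le (s t : R) (H : R -> Omega -> R) : s <= t ->
  cutoff s H = fun z => \1_([set z | z.1 <= s] : set (measurableTypeR R * Omega)) z * cutoff t H z.
Proof.
move=> st; apply/funext => -[u w]; rewrite /cutoff mulrA /=; congr (_ * _).
rewrite !indicE -natrM mulnb; congr (nat_of_bool _)%:R.
apply/idP/andP; rewrite !inE /= !in_itv/=.
  by move=> /andP[-> us]; rewrite us (le_trans us).
by move=> [-> /andP[->]].
Qed.

Lemma sqi_cutoff_le (s t : R) (H : R -> Omega -> R) : s <= t ->
  sqi LP (cutoff t H) -> sqi LP (cutoff s H).
Proof.
move=> st sH; rewrite (cutoff_le H st); split.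
  by apply: measurable_funM; [exact: measurable_indic (measurable_slab_le s)|exact: sH.1].
have := integrable_indicM (measurable_slab_le s) sH.2.
apply: eq_integrable => // z _ /=; congr EFin.
by rewrite [RHS]exprMn indic_sqr.
Qed.

Lemma ip_cutoff_le (s t : R) (H : R -> Omega -> R) : s <= t ->
  ip LP (cutoff s H) (cutoff t H) = ip LP (cutoff s H) (cutoff s H).
Proof.
move=> st; rewrite (cutoff_le H st); apply: eq_Rintegral => z _.
by rewrite indicE; case: (_ \in _); rewrite ?mul1r ?mul0r.
Qed.

End Cutoff.

Section MomentEquation.
Context {R : realType} {d : measure_display} {Omega : measurableType d}.
Variables (lam T : R) (P : probability Omega R).
Variables (F : R -> set (set Omega)) (W : nat -> R -> Omega -> R).
Variables (X0 : Omega -> nat -> R) (X : R -> Omega -> nat -> R).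
Local Notation leb := (@lebesgue_measure R).
Local Notation LP := (leb \x P)%E.
Hypothesis T0 : 0 <= T.
Hypothesis HB : stochastic_basis T P F W.
Hypothesis HS : componentwise_solution lam 0 T P F W X0 X.
Hypothesis sX0 : forall n, sqi P (fun w => X0 w n).

Let x (n : nat) (s : R) (w : Omega) : R := X s w n.

Hypothesis sx : forall n, sqi LP (cutoff T (x n)).

Let HF : filtration T F. Proof. by case: HB. Qed.

Let HW n : brownian_motion T P F (W n). Proof. by case: HB. Qed.

Lemma basis_indep (n m : nat) : n != m -> indep_motions T P (W n) (W m).
Proof.
move=> nm A B hA hB; have [_ _ hI] := HB.
have := hI [:: n; m] (fun j => if j == n then A else B).
rewrite !big_cons !big_nil /= setIT mule1 eqxx eq_sym (negbTE nm).
apply; first by rewrite /= inE andbT.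
move=> j; rewrite !inE => /orP[/eqP->|/eqP->]; first by rewrite eqxx.
by rewrite eq_sym (negbTE nm).
Qed.

Let bracket_WW n : bracket T P F 1 (W n) (W n).
Proof. exact: bracket_same. Qed.

Let bracket_WS n : bracket T P F 0 (W n) (W n.+1).
Proof. by apply: bracket_indep => //; apply: basis_indep; rewrite ltn_eqF. Qed.

Let cutoff_gain n t : cutoff t (gain lam 0 X n) =
  fun z => (if n is 0 then 0 else k lam n) * cutoff t (x n.-1) z.
Proof.
apply/funext => z; rewrite /cutoff /gain /x; case: n => [|n] /=; first by rewrite mulr0 mul0r.
by rewrite mulrCA.
Qed.

Let cutoff_loss n t : cutoff t (loss lam X n) =
  fun z => k lam n.+1 * cutoff t (x n.+1) z.
Proof. by apply/funext => z; rewrite /cutoff /loss /x mulrCA. Qed.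

Let sqi_gain n t : t <= T -> sqi LP (cutoff t (gain lam 0 X n)).
Proof. by move=> tT; rewrite cutoff_gain; apply: sqiZ; exact: sqi_cutoff_le (sx _). Qed.

Let sqi_loss n t : t <= T -> sqi LP (cutoff t (loss lam X n)).
Proof. by move=> tT; rewrite cutoff_loss; apply: sqiZ; exact: sqi_cutoff_le (sx _). Qed.

Section Component.
Variable n : nat.
Local Notation Z := (primitive (cutoff T (x n))).
Local Notation dn := (damping lam n).

Let dn0 : 0 <= dn.
Proof.
rewrite /damping mulr_ge0// addr_ge0 ?sqr_ge0//.
by case: n => // m; exact: sqr_ge0.
Qed.

Let x_path (w : Omega) : sqi leb (fun s => cutoff T (x n) (s, w)).
Proof.
have mp : measurable_fun setT (fun s : measurableTypeR R => cutoff T (x n) (s, w)).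
  exact: (@measurableT_comp _ _ _ _ _ _ (cutoff T (x n)) _ (fun s => (s, w))
    (sx n).1 (measurable_pair2 w)).
split => //.
have ct : {within `[0, T], continuous (fun t => X t w n)} := cs_continuous HS (n := n) (w := w).
have ct2 : {within `[0, T], continuous (fun t => X t w n ^+ 2)}.
  rewrite (_ : (fun t => _) = (fun t => X t w n) \* (fun t => X t w n)).
    by move=> t; exact: continuousM (ct t) (ct t).
  by apply/funext => t /=; rewrite expr2.
have := continuous_compact_integrable (@segment_compact _ 0 T) ct2.
have mI : measurable (`[0, T]%classic : set (measurableTypeR R)) by exact: measurable_itv.
move=> h0; have := (integrable_mkcond _ mI).1 h0.
apply: eq_integrable => // s _; rewrite /cutoff /= patchE indicE.
by case: (_ \in _); rewrite ?mul1r ?mul0r ?expr0n.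
Qed.

Let x_supp (s : R) (w : Omega) : ~~ (0 <= s <= T) -> cutoff T (x n) (s, w) = 0.
Proof.
move=> hs; rewrite /cutoff indicE memNset ?mul0r//= in_itv/=.
exact/negP.
Qed.

Let x_in (s : R) (w : Omega) : 0 <= s <= T -> cutoff T (x n) (s, w) = X s w n.
Proof. by move=> hs; rewrite /cutoff indicE mem_set ?mul1r//= in_itv. Qed.

Let Z_drift t w : 0 <= t <= T ->
  \int[leb]_(s in `[0, t]) (dn * X s w n) = dn * Z t w.
Proof.
move=> /andP[t0 tT].
have ip1 : leb.-integrable setT (EFin \o (fun s => cutoff T (x n) (s, w))).
  have sI : sqi leb (\1_(`[0, T]) : R -> R) by exact: sqi_indic_itv.
  have := sqi_mul_integrable sI (x_path w).
  apply: eq_integrable => // s _ /=; congr EFin.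
  by rewrite /cutoff indicE; case: (_ \in _); rewrite ?mul1r ?mul0r.
rewrite /primitive -RintegralZl//; last exact: integrable_indicM.
rewrite -Rintegral_indic; apply: eq_Rintegral => s _.
rewrite /cutoff /x /=.
have -> : \1_(`[0, t]) s = \1_(`]-oo, t]) s * \1_(`[0, T]) s :> R; last by ring.
rewrite !indicE -natrM mulnb; congr (nat_of_bool _)%:R.
apply/idP/andP; rewrite !inE /= !in_itv/=.
  by move=> /andP[-> st]; rewrite st (le_trans st).
by move=> [-> /andP[->]].
Qed.

Let N t w : R := cutoff T (x n) (t, w) + dn * Z t w.

Let equation t : 0 <= t <= T -> exists I J : Omega -> R,
  [/\ ito_integral P F (W n) (gain lam 0 X n) t I,
      ito_integral P F (W n.+1) (loss lam X n) t J &
      {ae P, forall w, X0 w n + I w - J w = N t w}].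
Proof.
move=> ht; have [I [J [hI hJ h]]] := cs_equation HS n ht.
exists I, J; split => //; move: h; apply: filterS => w /= E.
by rewrite /N x_in// E Z_drift// subrK.
Qed.

Let measurable_N t : measurable_fun setT (N t).
Proof.
apply: measurable_funD.
  exact: (@measurableT_comp _ _ _ _ _ _ (cutoff T (x n)) _ (pair t)
    (sx n).1 (measurable_pair1 t)).
apply: measurable_funM => //.
by have [] := sqi_primitive T0 (sx n) x_supp x_path t.
Qed.

Let martingale_part s t I J I' J' : 0 <= s -> s <= t -> t <= T ->
  ito_integral P F (W n) (gain lam 0 X n) s I ->
  ito_integral P F (W n.+1) (loss lam X n) s J ->
  ito_integral P F (W n) (gain lam 0 X n) t I' ->
  ito_integral P F (W n.+1) (loss lam X n) t J' ->
  ip P (fun w => X0 w n + I w - J w) (fun w => X0 w n + I' w - J' w) =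
  ip P (fun w => X0 w n) (fun w => X0 w n) +
  ip LP (cutoff s (gain lam 0 X n)) (cutoff s (gain lam 0 X n)) +
  ip LP (cutoff s (loss lam X n)) (cutoff s (loss lam X n)).
Proof.
move=> s0 st tT hI hJ hI' hJ'.
have sT := le_trans st tT; have t0 := le_trans s0 st.
have [gs gt ls lt] := And4 (sqi_gain n sT) (sqi_gain n tT) (sqi_loss n sT) (sqi_loss n tT).
have sI := ito_sqi HF (HW n) sT gs hI; have sJ := ito_sqi HF (HW n.+1) sT ls hJ.
have sI' := ito_sqi HF (HW n) tT gt hI'; have sJ' := ito_sqi HF (HW n.+1) tT lt hJ'.
have m0 := cs_initial_measurable HS n.
have xI := ito_initial HF (HW n) s0 sT gs hI m0 (sX0 n).
have xJ := ito_initial HF (HW n.+1) s0 sT ls hJ m0 (sX0 n).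
have xI' := ito_initial HF (HW n) t0 tT gt hI' m0 (sX0 n).
have xJ' := ito_initial HF (HW n.+1) t0 tT lt hJ' m0 (sX0 n).
have II' := ito_isometry HF (HW n) (HW n) (bracket_WW n) s0 sT t0 tT gs gt hI hI'.
have JJ' := ito_isometry HF (HW n.+1) (HW n.+1) (bracket_WW n.+1) s0 sT t0 tT ls lt hJ hJ'.
have IJ' := ito_isometry HF (HW n) (HW n.+1) (@bracket_WS n) s0 sT t0 tT gs lt hI hJ'.
have I'J := ito_isometry HF (HW n) (HW n.+1) (@bracket_WS n) t0 tT s0 sT gt ls hI' hJ.
rewrite mul1r ip_cutoff_le// in II'; rewrite mul1r ip_cutoff_le// in JJ'.
rewrite mul0r in IJ'; rewrite mul0r in I'J.
have sx0 := sX0 n.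
have a1 := sqiD sx0 sI; have a2 := sqiD sx0 sI'; have a3 := sqiB a2 sJ'.
rewrite ipBl// ipDl// !ipBr// !ipDr//.
rewrite II' JJ' IJ' xI' xJ' (ipC P I) xI (ipC P J) xJ (ipC P J) I'J.
ring.
Qed.

Let sqi_N t : 0 <= t <= T -> sqi P (N t).
Proof.
move=> ht; have [I [J [hI hJ E]]] := equation ht; have /andP[t0 tT] := ht.
apply: (sqi_ae (measurable_N t) _ E).
apply: sqiB; last exact: (ito_sqi HF (HW n.+1) tT (sqi_loss n tT) hJ).
by apply: sqiD => //; exact: (ito_sqi HF (HW n) tT (sqi_gain n tT) hI).
Qed.

Let ip_N s t : 0 <= s -> s <= t -> t <= T -> ip P (N s) (N t) =
  ip P (fun w => X0 w n) (fun w => X0 w n) +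
  ip LP (cutoff s (gain lam 0 X n)) (cutoff s (gain lam 0 X n)) +
  ip LP (cutoff s (loss lam X n)) (cutoff s (loss lam X n)).
Proof.
move=> s0 st tT; have sT := le_trans st tT; have t0 := le_trans s0 st.
have hs : 0 <= s <= T by rewrite s0.
have ht : 0 <= t <= T by rewrite t0.
have [I [J [hI hJ E]]] := equation hs.
have [I' [J' [hI' hJ' E']]] := equation ht.
rewrite -(martingale_part s0 st tT hI hJ hI' hJ').
have M : sqi P (fun w => X0 w n + I w - J w).
  apply: sqiB; last exact: (ito_sqi HF (HW n.+1) sT (sqi_loss n sT) hJ).
  by apply: sqiD => //; exact: (ito_sqi HF (HW n) sT (sqi_gain n sT) hI).
have M' : sqi P (fun w => X0 w n + I' w - J' w).
  apply: sqiB; last exact: (ito_sqi HF (HW n.+1) tT (sqi_loss n tT) hJ').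
  by apply: sqiD => //; exact: (ito_sqi HF (HW n) tT (sqi_gain n tT) hI').
rewrite -(ip_ae M (sqi_N hs) (sqi_N ht) E) ipC.
by rewrite -(ip_ae M' (sqi_N ht) M E') ipC.
Qed.

Lemma sqi_component t : 0 <= t <= T -> sqi P (fun w => X t w n).
Proof.
move=> ht; have := sqi_slice T0 (sx n) x_supp x_path (dd := dn) sqi_N t.
by congr sqi; apply/funext => w; rewrite x_in.
Qed.

(** The coefficient of the damping is half the sum of the squared noise
coefficients, and [volterra_energy] doubles it. The isometry supplies the gains
from the two neighbours; the integrals against W_n and W_(n+1) are orthogonal
to each other and to the initial value. *)
Lemma moment_equation t : 0 <= t <= T ->
  ip P (fun w => X t w n) (fun w => X t w n) +
  ((if n is 0 then 0 else k lam n ^+ 2) + k lam n.+1 ^+ 2) *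
    ip LP (cutoff t (x n)) (cutoff t (x n)) =
  ip P (fun w => X0 w n) (fun w => X0 w n) +
  (if n is 0 then 0 else k lam n ^+ 2) *
    ip LP (cutoff t (x n.-1)) (cutoff t (x n.-1)) +
  k lam n.+1 ^+ 2 * ip LP (cutoff t (x n.+1)) (cutoff t (x n.+1)).
Proof.
move=> ht; have /andP[t0 tT] := ht.
have mart s u : 0 <= s -> s <= u -> u <= T -> ip P (N s) (N u) = ip P (N s) (N s).
  move=> s0 su uT; rewrite ip_N// ip_N//; exact: le_trans uT.
have := volterra_energy dn0 T0 (sx n) x_supp x_path sqi_N mart ht.
rewrite (ip_N t0 (lexx t) tT).
rewrite cutoff_gain cutoff_loss.
have sc m := sqi_cutoff_le tT (sx m).
rewrite !ipZl ?ipZr//; try by apply: sqiZ.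
have -> : ip P (fun w => cutoff T (x n) (t, w)) (fun w => cutoff T (x n) (t, w)) =
    ip P (fun w => X t w n) (fun w => X t w n).
  by apply: eq_ip => w; exact: x_in.
have sl s := sqi_slice T0 (sx n) x_supp x_path (dd := dn) sqi_N s.
have -> : \int[leb]_s (\1_(`]-oo, t]) s * ip P (fun w => cutoff T (x n) (s, w))
    (fun w => cutoff T (x n) (s, w))) = ip LP (cutoff t (x n)) (cutoff t (x n)).
  have fi := integrable_indicM (measurable_slab_le (Omega := Omega) t) (sqi_mul_integrable (sx n) (sx n)).
  transitivity (\int[LP]_z (\1_([set z : measurableTypeR R * Omega | z.1 <= t]) z *
      (cutoff T (x n) z * cutoff T (x n) z))); last first.
    rewrite (cutoff_le (x n) tT); apply: eq_Rintegral => z _.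
    by rewrite indicE; case: (_ \in _); rewrite ?mul1r ?mul0r.
  rewrite -(Rfubini1 fi).
    apply: eq_Rintegral => s _ /=.
    by rewrite -RintegralZl//; exact: sqi_mul_integrable (sl s) (sl s).
  move=> s /=.
  have := integrableZl measurableT (\1_(`]-oo, t]) s) (sqi_mul_integrable (sl s) (sl s)).
  by apply: eq_integrable.
rewrite /damping /=; case: (n) => [|m] /=; set v := ip P _ _; set u := ip LP _ _.
  by set v0 := ip P _ _; set b := ip LP _ _; lra.
by set v0 := ip P _ _; set a := ip LP _ _; set b := ip LP _ _; lra.
Qed.

End Component.
End MomentEquation.

(** * Weights, component energies and summation of the flux *)

Section Weights.
Context {R : realType}.
Variable lam : R.
Hypothesis lam1 : 1 < lam.

(** The weight of the component x n in the square of the norm of H^s. *)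
Definition wt (s : R) (n : nat) : R := k lam n.+1 `^ (2 * s).

Let lam0 : 0 < lam. Proof. exact: lt_trans lam1. Qed.

Lemma k_gt0 n : 0 < k lam n. Proof. exact: exprn_gt0. Qed.

Lemma k_ge1 n : 1 <= k lam n. Proof. by rewrite exprn_ege1// ltW. Qed.

Lemma k_le n m : (n <= m)%N -> k lam n <= k lam m.
Proof. by move=> nm; rewrite ler_weXn2l// ltW. Qed.

Lemma wt_gt0 s n : 0 < wt s n. Proof. by rewrite powR_gt0// k_gt0. Qed.

Lemma wt_ge0 s n : 0 <= wt s n. Proof. exact: ltW (wt_gt0 s n). Qed.

Lemma wt0 n : wt 0 n = 1. Proof. by rewrite /wt mulr0 powRr0. Qed.

Lemma wtD s u n : wt (s + u) n = wt s n * wt u n.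
Proof.
by rewrite /wt mulrDr powRD//; apply/implyP => _; rewrite gt_eqF// k_gt0.
Qed.

Lemma wtN1 n : wt (-1) n = (k lam n.+1 ^+ 2)^-1.
Proof. by rewrite /wt mulrN1 powR_invn// ltW// k_gt0. Qed.

Lemma wt_le s u n : s <= u -> wt s n <= wt u n.
Proof. by move=> su; rewrite ler_powR ?k_ge1// ler_pM2l. Qed.

Lemma wt_homo s n m : 0 <= s -> (n <= m)%N -> wt s n <= wt s m.
Proof.
move=> s0 nm; have kp j := ltW (k_gt0 j).
by apply: ge0_ler_powR; rewrite ?nnegrE ?kp ?mulr_ge0// k_le.
Qed.

Lemma wt_anti s n m : s <= 0 -> (n <= m)%N -> wt s m <= wt s n.
Proof.
move=> s0 nm.
have E j : wt s j = (wt (- s) j)^-1 by rewrite /wt mulrN powRN invrK.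
by rewrite !E lef_pV2 ?posrE ?wt_gt0// wt_homo// oppr_ge0.
Qed.

Lemma wt_summable s : s < 0 -> (\sum_(0 <= n <oo) (wt s n)%:E < +oo)%E.
Proof.
move=> s0.
pose r := lam `^ (2 * s).
have r0 : 0 < r by rewrite powR_gt0.
have r1 : r < 1.
  have -> : r = (lam `^ (- (2 * s)))^-1 by rewrite powRN invrK.
  have s2 : 0 < - (2 * s) by rewrite -mulrN mulr_gt0// oppr_gt0.
  rewrite invf_lt1 ?powR_gt0//.
  have := gt0_ltr_powR s2 (_ : 1 \is Num.nneg) (_ : lam \is Num.nneg) lam1.
  by rewrite powR1; apply; rewrite nnegrE// ltW.
have E n : wt s n = r ^+ n.+1.
  by rewrite /wt /k -powR_mulrn ?ltW// -powRrM mulrC powRrM powR_mulrn// powR_ge0.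
have : cvgn (series (geometric r r)).
  by apply: is_cvg_geometric_series; rewrite ger0_norm// ltW.
move=> /cvg_ex[l hl].
have : (\sum_(0 <= i < n) (wt s i)%:E)%E @[n --> \oo] --> l%:E.
  rewrite (_ : (fun n => _) = EFin \o series (geometric r r)).
    by apply: cvg_EFin => //; exact: nearW.
  apply/funext => n /=; rewrite /series/= sumEFin; congr EFin.
  by apply: eq_bigr => i _; rewrite E exprS.
by move=> /cvg_lim -> //; rewrite ltry.
Qed.

End Weights.

Section ComponentEnergy.
Context {d : measure_display} {S : measurableType d} {R : realType}.
Variables (mu : {measure set S -> \bar R}) (D : set S).
Hypothesis mD : measurable D.
Variable lam : R.
Hypothesis lam1 : 1 < lam.
Implicit Types x y : S -> nat -> R.
Local Open Scope ereal_scope.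

Definition cenergy (x : S -> nat -> R) (n : nat) : \bar R :=
  \int[mu]_(z in D) (x z n ^+ 2)%:E.

Lemma cenergy_ge0 x n : 0 <= cenergy x n.
Proof. by apply: integral_ge0 => z _; rewrite lee_fin sqr_ge0. Qed.

Lemma L2Hnorm_sqr (s : R) x : (forall n, measurable_fun D (fun z => x z n)) ->
  L2Hnorm mu D lam s x ^+ 2 = \sum_(0 <= n <oo) (wt lam s n)%:E * cenergy x n.
Proof.
move=> mx; rewrite /L2Hnorm sqr_sqrte; last first.
  by apply: integral_ge0 => z _; exact: sqre_ge0.
have t0 n z : (0 <= wt lam s n * x z n ^+ 2)%R by rewrite mulr_ge0 ?sqr_ge0 ?wt_ge0.
transitivity (\int[mu]_(z in D) \sum_(0 <= n <oo) (wt lam s n * x z n ^+ 2)%:E).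
  apply: eq_integral => z _; rewrite /Hnorm sqr_sqrte//.
  by apply: nneseries_ge0 => n _ _; rewrite lee_fin; exact: t0.
rewrite integral_nneseries//; last 2 first.
- move=> n; apply/measurable_EFinP; apply: measurable_funM => //.
  exact: measurable_funX.
- by move=> n z _; rewrite lee_fin.
apply: eq_eseriesr => n _.
under eq_integral do rewrite EFinM.
rewrite ge0_integralZl//.
- by apply/measurable_EFinP; exact: measurable_funX.
- by move=> z _; rewrite lee_fin sqr_ge0.
- by rewrite lee_fin wt_ge0.
Qed.

Lemma L2Hnorm_ge0 (s : R) x : 0 <= L2Hnorm mu D lam s x.
Proof. exact: sqrte_ge0. Qed.

Lemma L2Hnorm_lty (s : R) x : (forall n, measurable_fun D (fun z => x z n)) ->
  (L2Hnorm mu D lam s x < +oo) =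
  (\sum_(0 <= n <oo) (wt lam s n)%:E * cenergy x n < +oo).
Proof.
move=> mx; rewrite -L2Hnorm_sqr//.
have := L2Hnorm_ge0 s x; case: (L2Hnorm _ _ _ _ _) => [r| |] //= r0.
by rewrite -EFinM !ltry.
Qed.

Lemma wcenergy_le (s : R) x n :
  (wt lam s n)%:E * cenergy x n <= \sum_(0 <= n <oo) (wt lam s n)%:E * cenergy x n.
Proof.
have t0 i : 0 <= (wt lam s i)%:E * cenergy x i.
  by rewrite mule_ge0 ?cenergy_ge0 ?lee_fin ?wt_ge0.
rewrite (nneseriesD1 (n := n))//; first by rewrite leeDl// nneseries_ge0.
Qed.

Lemma cenergy_lty (s : R) x n : in_L2H mu D lam s x -> cenergy x n < +oo.
Proof.
move=> [mx]; rewrite L2Hnorm_lty// => h.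
have := le_lt_trans (wcenergy_le s x n) h.
have := cenergy_ge0 x n; case: (cenergy x n) => [r| |] //= _.
  by move=> _; rewrite ltry.
by rewrite gt0_muley// lte_fin wt_gt0.
Qed.

Lemma cenergy_double x y n : (forall n, measurable_fun D (fun z => x z n)) ->
  (forall n, measurable_fun D (fun z => y z n)) ->
  cenergy x n <= 2%:E * cenergy y n + 2%:E * cenergy (fun z n => y z n - x z n)%R n.
Proof.
move=> mx my.
have m2 : measurable_fun D (fun z => ((y z n - x z n) ^+ 2)%:E).
  by apply/measurable_EFinP; apply: measurable_funX; exact: measurable_funB.
have m1 : measurable_fun D (fun z => (y z n ^+ 2)%:E).
  by apply/measurable_EFinP; exact: measurable_funX.
rewrite /cenergy -!ge0_integralZl//; try by move=> z _; rewrite lee_fin sqr_ge0.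
rewrite -ge0_integralD//; try by move=> z _; rewrite -EFinM lee_fin mulr_ge0// sqr_ge0.
- apply: ge0_le_integral => //.
  + by move=> z _; rewrite lee_fin sqr_ge0.
  + by apply/measurable_EFinP; exact: measurable_funX.
  + by apply: emeasurable_funD; exact: measurable_funeM.
  + move=> z _; rewrite -!EFinM -EFinD lee_fin.
    by have := sqr_ge0 (2 * y z n - x z n)%R; nra.
- exact: measurable_funeM.
- exact: measurable_funeM.
Qed.

End ComponentEnergy.

Section Telescope.
Context {R : realType}.
Variable lam : R.
Hypothesis lam1 : 1 < lam.

(** Up to the factor [geom_sum], the Green function of the system
k_(n+1)^2 (u n - u n.+1) = \sum_(j <= n) a j with u vanishing at infinity. *)
Definition green (n j : nat) : R := (k lam (maxn n j).+1 ^+ 2)^-1.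

(** The sum of the geometric series with ratio lam^(-2). *)
Definition geom_sum : R := (1 - (lam ^+ 2)^-1)^-1.

Let lam0 : 0 < lam. Proof. exact: lt_trans lam1. Qed.

Let lam2 : (lam ^+ 2)^-1 < 1.
Proof. by rewrite invf_lt1 ?exprn_gt0// exprn_egt1. Qed.

Lemma geom_sum_ge0 : 0 <= geom_sum.
Proof. by rewrite invr_ge0 subr_ge0 ltW. Qed.

Lemma green_ge0 n j : 0 <= green n j.
Proof. by rewrite invr_ge0 sqr_ge0. Qed.

Lemma green_wt n j : green n j = wt lam (-1) (maxn n j).
Proof. by rewrite wtN1. Qed.

Lemma green_le n j : green n j <= wt lam (-1) j.
Proof. by rewrite green_wt wt_anti// ?leq_maxr// lerN10. Qed.

(** Summing u i - u i.+1 from n to J gives a j the coefficient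
\sum_(i >= max(n, j)) k_(i+1)^(-2), a geometric tail. In the proof the right
hand side R_n is compared with u step by step, as R_n - R_n.+1 is exactly the
bound for u n - u n.+1. *)
Lemma telescope_bound (u a : nat -> R) :
  (forall n, 0 <= u n) -> (forall n, 0 <= a n) ->
  (forall n, k lam n.+1 ^+ 2 * (u n - u n.+1) <= \sum_(j < n.+1) a j) ->
  forall J n, (n <= J)%N ->
  u n <= u J + geom_sum * \sum_(j < J) green n j * a j.
Proof.
move=> u0 a0 H J.
pose Rn n := geom_sum * \sum_(j < J) green n j * a j.
have step n : (n < J)%N -> u n - Rn n <= u n.+1 - Rn n.+1.
  move=> nJ.
  have kn : 0 < k lam n.+1 ^+ 2 by rewrite exprn_gt0// k_gt0.
  suff -> : Rn n = Rn n.+1 + (k lam n.+1 ^+ 2)^-1 * \sum_(j < n.+1) a j.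
    have : u n - u n.+1 <= (k lam n.+1 ^+ 2)^-1 * \sum_(j < n.+1) a j.
      by rewrite mulrC ler_pdivlMr// mulrC.
    by lra.
  have E : geom_sum * ((k lam n.+1 ^+ 2)^-1 - (k lam n.+2 ^+ 2)^-1) = (k lam n.+1 ^+ 2)^-1.
    have h1 : k lam n.+1 != 0 by rewrite gt_eqF// k_gt0.
    have h2 : lam != 0 by rewrite gt_eqF.
    have h3 : lam ^+ 2 - 1 != 0 by rewrite gt_eqF// subr_gt0 exprn_egt1.
    have -> : k lam n.+2 = lam * k lam n.+1 by rewrite /k exprS.
    by rewrite /geom_sum; field; rewrite h1 h2 h3.
  apply/eqP; rewrite addrC -subr_eq -mulrBr; apply/eqP.
  rewrite -[in RHS]E -mulrA; congr (_ * _).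
  rewrite -sumrB (big_ord_widen J (fun j => a j) nJ) mulr_sumr.
  rewrite [RHS]big_mkcond; apply: eq_bigr => j _; rewrite -mulrBl.
  case: ltnP => jn.
    rewrite ltnS in jn.
    by rewrite /green (maxn_idPl jn) (maxn_idPl (leqW jn)).
  by rewrite /green (maxn_idPr jn) (maxn_idPr (ltnW jn)) subrr mul0r.
have main i : (i <= J)%N -> u (J - i)%N - Rn (J - i)%N <= u J - Rn J.
  elim: i => [|i IH] iJ; first by rewrite subn0.
  have e : (J - i = (J - i.+1).+1)%N by rewrite subnSK.
  have := IH (ltnW iJ); rewrite e => h; apply: le_trans h.
  by apply: step; rewrite -subn_gt0 subKn.
move=> n nJ; have := main (J - n)%N (leq_subr _ _); rewrite subKn// => h.
have : 0 <= Rn J.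
  by rewrite mulr_ge0 ?geom_sum_ge0// sumr_ge0// => j _; rewrite mulr_ge0// green_ge0.
by rewrite -/(Rn n); lra.
Qed.

End Telescope.

(** * Energy estimates for proper solutions *)

Section Slabs.
Context {R : realType} {d : measure_display} {Omega : measurableType d}.
Variable P : probability Omega R.
Local Notation LP := ((@lebesgue_measure R) \x P)%E.

(** Half-open, so that it complements the slab over [0, t] in the slab over [0, T]. *)
Definition late (t T : R) : set (measurableTypeR R * Omega) := `]t, T] `*` setT.

Lemma measurable_slab a b : measurable (slab a b : set (measurableTypeR R * Omega)).
Proof. by apply: measurableX => //; exact: measurable_itv. Qed.

Lemma measurable_late a b : measurable (late a b).
Proof. by apply: measurableX => //; exact: measurable_itv. Qed.

Lemma cutoff_restrict (t : R) (H : R -> Omega -> R) :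
  cutoff t H = (fun z : measurableTypeR R * Omega => H z.1 z.2) \_ (slab 0 t).
Proof.
apply/funext => -[s w]; rewrite /cutoff patchE indicE /=.
have -> : ((s, w) \in (slab 0 t : set (measurableTypeR R * Omega))) = (s \in `[0, t]%classic).
  by apply/idP/idP; rewrite !inE /slab/=; [case|split].
by case: ifP => _; rewrite ?mul1r ?mul0r.
Qed.

Lemma cenergy_cutoff (X : R -> Omega -> nat -> R) t n :
  sqi LP (cutoff t (fun s w => X s w n)) ->
  cenergy LP (slab 0 t) (proc X) n =
  (ip LP (cutoff t (fun s w => X s w n)) (cutoff t (fun s w => X s w n)))%:E.
Proof.
move=> sx; rewrite -ip_ge0_EFin// /cenergy integral_mkcond.
apply: eq_integral => z _; rewrite cutoff_restrict !patchE.
by case: ifP => _ //; rewrite expr0n.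
Qed.

Lemma cenergy_subset (D D' : set (measurableTypeR R * Omega)) (x : _ -> nat -> R) n :
  measurable D -> measurable D' -> D `<=` D' ->
  measurable_fun D' (fun z => x z n) ->
  (cenergy LP D x n <= cenergy LP D' x n)%E.
Proof.
move=> mD mD' DD' mx; apply: ge0_subset_integral => //.
  by apply/measurable_EFinP; exact: measurable_funX.
by move=> z _; rewrite lee_fin sqr_ge0.
Qed.

Lemma cenergy_split (x : _ -> nat -> R) (s T : R) n : 0 <= s <= T ->
  measurable_fun (slab 0 T : set (measurableTypeR R * Omega)) (fun z => x z n) ->
  (cenergy LP (slab 0 T) x n =
   cenergy LP (slab 0 s) x n + cenergy LP (late s T) x n)%E.
Proof.
move=> /andP[s0 sT] mx.
have E : slab 0 T = slab 0 s `|` late s T.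
  apply/seteqP; split => -[u w]; rewrite /slab /late /= !in_itv/=.
    move=> [/andP[u0 uT] _]; case: (leP u s) => us; [left|right] => //.
    by split => //; rewrite u0.
  move=> [[/andP[u0 us] _]|[/andP[us uT] _]]; split=> //.
    by rewrite u0 (le_trans us).
  by rewrite uT (le_trans s0 (ltW us)).
rewrite /cenergy E ge0_integral_setU//; rewrite -?E.
- exact: measurable_slab.
- exact: measurable_late.
- by apply/measurable_EFinP; exact: measurable_funX.
- by move=> z _; rewrite lee_fin sqr_ge0.
- apply/disj_setPS => -[u w] [] /=; rewrite /slab /late /= !in_itv/=.
  by move=> [/andP[_ us] _] [/andP[su _] _]; have := lt_le_trans su us; rewrite ltxx.
Qed.

Lemma cenergy_slices (x : R -> Omega -> nat -> R) (t : R) n : 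
  measurable_fun (slab 0 t : set (measurableTypeR R * Omega)) (fun z => proc x z n) ->
  cenergy LP (slab 0 t) (proc x) n =
  (\int[@lebesgue_measure R]_(s in `[0%R, t]) cenergy P setT (x s) n)%E /\
  measurable_fun `[0, t] (fun s : measurableTypeR R => cenergy P setT (x s) n).
Proof.
move=> mx.
pose f (z : measurableTypeR R * Omega) : \bar R := ((cutoff t (fun s w => x s w n) z) ^+ 2)%:E.
have mf : measurable_fun setT f.
  apply/measurable_EFinP/measurable_funX.
  rewrite cutoff_restrict; apply/(measurable_restrictT _ _).1 => //.
  exact: measurable_slab.
have f0 z : (0 <= f z)%E by rewrite lee_fin sqr_ge0.
have FE : (fun s : measurableTypeR R => cenergy P setT (x s) n) \_ `[0, t] =
    fubini_F P f.
  apply/funext => s; rewrite /fubini_F /f /cutoff /= patchE indicE.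
  case: ifP => hs.
    by apply: eq_integral => w _; rewrite mul1r.
  by rewrite integral0_eq// => w _; rewrite mul0r expr0n.
split.
  rewrite [RHS]integral_mkcond FE -fubini_tonelli1//.
  rewrite /cenergy integral_mkcond; apply: eq_integral => z _.
  rewrite /f cutoff_restrict !patchE; case: ifP => _ //; by rewrite expr0n.
apply/(measurable_restrictT _ _).2; first exact: measurable_itv.
by rewrite FE; exact: measurable_fun_fubini_tonelli_F.
Qed.

End Slabs.

Section ProperEnergy.
Context {R : realType} {d : measure_display} {Omega : measurableType d}.
Variables (lam T : R) (P : probability Omega R) (F : R -> set (set Omega)).
Variables (W : nat -> R -> Omega -> R).
Variables (X0 : Omega -> nat -> R) (X : R -> Omega -> nat -> R).
Hypothesis lam1 : 1 < lam.
Hypothesis T0 : 0 <= T.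
Hypothesis HB : stochastic_basis T P F W.
Hypothesis HP : proper_solution lam 0 T P F W X0 X.
Hypothesis H0 : in_L2H P setT lam (-1) X0.
Local Notation LP := ((@lebesgue_measure R) \x P)%E.
Let x (n : nat) (s : R) (w : Omega) := X s w n.

Let mX n : measurable_fun (slab 0 T : set (measurableTypeR R * Omega)) (fun z => proc X z n).
Proof. exact: (ps_L2 HP).1. Qed.

Let sX0 n : sqi P (fun w => X0 w n).
Proof. by apply: sqiP; [exact: H0.1|exact: (cenergy_lty measurableT lam1 n H0)]. Qed.

Let sx n : sqi LP (cutoff T (x n)).
Proof.
have E : cutoff T (x n) = (fun z => proc X z n) \_ (slab 0 T) by rewrite cutoff_restrict.
apply: sqiP.
  rewrite E; apply/(measurable_restrictT _ _).1 => //; exact: measurable_slab.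
apply: le_lt_trans (cenergy_lty (measurable_slab 0 T) lam1 n (ps_L2 HP)).
rewrite /cenergy [leRHS]integral_mkcond le_eqVlt; apply/orP; left; apply/eqP.
apply: eq_integral => z _; rewrite E !patchE.
by case: ifP => _ //; rewrite expr0n.
Qed.

Let U n t := ip LP (cutoff t (x n)) (cutoff t (x n)).
Let v n t := ip P (fun w => X t w n) (fun w => X t w n).
Let a n := ip P (fun w => X0 w n) (fun w => X0 w n).

Let UE n t : t <= T -> cenergy LP (slab 0 t) (proc X) n = (U n t)%:E.
Proof. by move=> tT; apply: cenergy_cutoff; exact: (sqi_cutoff_le tT (sx n)). Qed.

Let vE n t : 0 <= t <= T -> cenergy P setT (X t) n = (v n t)%:E.
Proof.
move=> ht; rewrite /cenergy ip_ge0_EFin//.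
exact: (sqi_component T0 HB (ps_solution HP) sX0 sx n ht).
Qed.

Let aE n : cenergy P setT X0 n = (a n)%:E.
Proof. by rewrite /cenergy ip_ge0_EFin//; exact: sX0. Qed.

Let partial_sum n t : 0 <= t <= T ->
  \sum_(j < n.+1) v j t + k lam n.+1 ^+ 2 * (U n t - U n.+1 t) = \sum_(j < n.+1) a j.
Proof.
move=> ht; elim: n => [|n IH].
  have := moment_equation T0 HB (ps_solution HP) sX0 sx 0 ht.
  by rewrite !big_ord_recl !big_ord0 /U /v /a /x /=; lra.
have h := moment_equation T0 HB (ps_solution HP) sX0 sx n.+1 ht; move: h.
rewrite [\sum_(j < n.+2) v j t]big_ord_recr [\sum_(j < n.+2) a j]big_ord_recr /=.
move: IH; rewrite -/(v n.+1 t) -/(a n.+1) -/(U n.+1 t) -/(U n t) -/(U n.+2 t).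
set s1 := \sum_(i < _) _; set s2 := \sum_(i < _) _.
by lra.
Qed.

(** No energy flows in from infinity: this is where square integrability of
proper solutions in l^2 enters. *)
Let tail_vanish : forall e : R, 0 < e -> exists N, forall n, (N <= n)%N -> U n T < e.
Proof.
move=> e e0.
have S : (\sum_(0 <= n <oo) (U n T)%:E < +oo)%E.
  have [_] := ps_L2 HP; rewrite (L2Hnorm_lty _ (measurable_slab 0 T) lam1)//.
  congr (_ < _)%E; apply: eq_eseriesr => n _.
  by rewrite wt0 mul1e UE.
have [N HN] := cvge0_lt (nneseries_tail_cvg S (fun n _ => ip_ge0 LP (cutoff T (x n)))) e0.
exists N => n nN; rewrite -lte_fin; apply: le_lt_trans (HN n nN).
have := @nneseries_lim_ge R (fun i => (U i T)%:E) xpredT n n.+1 (fun i _ _ => ip_ge0 LP (cutoff T (x i))).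
by rewrite big_nat1.
Qed.

Let vanish_le (c u : R) n (b : nat -> R) (B : \bar R) : 0 <= c ->
  (forall J, ((b J)%:E <= B)%E) ->
  (forall J, (n <= J)%N -> u <= c * U J T + b J) -> (u%:E <= B)%E.
Proof.
move=> c0 bB ub; apply/lee_addgt0Pr => e e0.
have e1 : 0 < e / (c + 1) by rewrite divr_gt0// ltr_pwDr.
have [N HN] := tail_vanish e1.
have := HN (maxn N n) (leq_maxl _ _); have := ub _ (leq_maxr N n).
set J := maxn N n => uJ UJ.
apply: (@le_trans _ _ (b J + e)%:E).
  rewrite lee_fin (le_trans uJ)// addrC lerD2l.
  rewrite ltr_pdivlMr ?ltr_pwDr// in UJ.
  have := ip_ge0 LP (cutoff T (x J)); rewrite -/(U J T); nra.
by rewrite EFinD leeD2r.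
Qed.

Let partial_le (c : nat -> R) n J : (forall j, 0 <= c j) ->
  ((geom_sum lam * \sum_(j < J) green lam n j * c j)%:E <=
   (geom_sum lam)%:E * \sum_(0 <= j <oo) (green lam n j)%:E * (c j)%:E)%E.
Proof.
move=> c0; rewrite EFinM lee_wpmul2l ?lee_fin ?geom_sum_ge0//.
rewrite -sumEFin -(big_mkord xpredT (fun j => (green lam n j * c j)%:E)).
apply: nneseries_lim_ge => j _ _.
by rewrite lee_fin mulr_ge0// green_ge0.
Qed.

(** The flux through an edge is at most the initial energy below it, and the bound
for the telescoping sum applies with u vanishing at infinity. *)
Lemma proper_energy n :
  (cenergy LP (slab 0 T) (proc X) n <=
   (geom_sum lam)%:E * \sum_(0 <= j <oo) (green lam n j)%:E * cenergy P setT X0 j)%E.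
Proof.
have TT : 0 <= T <= T by rewrite T0 lexx.
rewrite UE//; under eq_eseriesr do rewrite aE.
apply: (@vanish_le 1 _ n (fun J => geom_sum lam * \sum_(j < J) green lam n j * a j)) => // [J|J nJ].
  by apply: partial_le => j; exact: ip_ge0.
rewrite mul1r; apply: (telescope_bound lam1 (u := fun n => U n T)) nJ => [j|j|j].
- exact: ip_ge0.
- exact: ip_ge0.
- rewrite -(partial_sum j TT) lerDr sumr_ge0// => i _; exact: ip_ge0.
Qed.

Let U_mono n s t : s <= t -> t <= T -> U n s <= U n t.
Proof.
move=> st tT; rewrite -lee_fin -!UE ?(le_trans st)//.
apply: cenergy_subset; try exact: measurable_slab.
  move=> [u w] []; rewrite /slab /= !in_itv/= => /andP[-> us] _.
  by rewrite (le_trans us).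
apply: measurable_funS (mX n); first exact: measurable_slab.
move=> [u w] []; rewrite /slab /= !in_itv/= => /andP[-> us] _.
by rewrite (le_trans us).
Qed.

(** On [s, T] the flux is bounded by the energies at time s, and shortening the
time interval to [t, T] only decreases the left hand side. The freedom in s is
used to average. *)
Let late_le s t n J : 0 <= s -> s <= t -> t <= T -> (n <= J)%N ->
  U n T - U n t <= U J T + geom_sum lam * \sum_(j < J) green lam n j * v j s.
Proof.
move=> s0 st tT nJ; have sT := le_trans st tT.
have hs : 0 <= s <= T by rewrite s0.
have TT : 0 <= T <= T by rewrite T0 lexx.
apply: (@le_trans _ _ (U n T - U n s)); first by rewrite lerB// U_mono.
apply: (@le_trans _ _ ((U J T - U J s) + geom_sum lam * \sum_(j < J) green lam n j * v j s)).
  apply: (telescope_bound lam1 (u := fun n => U n T - U n s) (a := fun j => v j s)) nJ => [j|j|j].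
  - by rewrite subr_ge0 U_mono.
  - exact: ip_ge0.
  - have := partial_sum j TT; rewrite -(partial_sum j hs).
    have : 0 <= \sum_(i < j.+1) v i T by rewrite sumr_ge0// => i _; exact: ip_ge0.
    by set s1 := \sum_(i < _) _; set s2 := \sum_(i < _) _; lra.
by rewrite lerD2r gerBl ip_ge0.
Qed.

(** The average over s in [0, t] of [late_le] replaces the values of the energies
at one time by their time integrals. *)
Lemma proper_late_energy t n : 0 <= t <= T ->
  (t%:E * cenergy LP (late t T) (proc X) n <=
   (geom_sum lam)%:E * \sum_(0 <= j <oo) (green lam n j)%:E * cenergy LP (slab 0 t) (proc X) j)%E.
Proof.
move=> /andP[t0 tT].
have ht : 0 <= t <= T by rewrite t0.
have mXt j : measurable_fun (slab 0 t : set (measurableTypeR R * Omega)) (fun z => proc X z j).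
  apply: measurable_funS (mX j); first exact: measurable_slab.
  move=> [u w] []; rewrite /slab /= !in_itv/= => /andP[-> us] _.
  by rewrite (le_trans us).
have -> : cenergy LP (late t T) (proc X) n = (U n T - U n t)%:E.
  have := cenergy_split P ht (mX n); rewrite !UE// EFinB => ->.
  by rewrite addeAC subee ?add0e.
under eq_eseriesr do rewrite (UE _ tT).
rewrite -EFinM.
apply: (@vanish_le t _ n (fun J => geom_sum lam * \sum_(j < J) green lam n j * U j t)) => // [J|J nJ].
  by apply: partial_le => j; exact: ip_ge0.
pose h s : \bar R := (\sum_(j < J) (green lam n j)%:E * cenergy P setT (X s) j)%E.
have k0 j : (0 <= (green lam n j)%:E)%E by rewrite lee_fin green_ge0.
have mc j := (cenergy_slices P (mXt j)).2.
have mh : measurable_fun `[0, t] h.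
  by apply: emeasurable_sum => j; apply: measurable_funeM; exact: mc.
have h0 s : (0 <= h s)%E by apply: sume_ge0 => j _; rewrite mule_ge0// cenergy_ge0.
have mt : measurable (`[0, t] : set R) by exact: measurable_itv.
have lt : lebesgue_measure (`[0, t] : set R) = t%:E.
  by rewrite lebesgue_measure_itv/= lte_fin; case: ltgtP t0 => // [_ _|<- _]; rewrite ?oppr0 ?adde0 ?subr0.
have lc c : (\int[@lebesgue_measure R]_(s in `[0%R, t]) c%:E = (c * t)%:E)%E.
  by rewrite integral_cst// EFinM; congr (_ * _)%E; exact: lt.
have : (\int[@lebesgue_measure R]_(s in `[0%R, t]) (U n T - U n t)%:E <=
   \int[@lebesgue_measure R]_(s in `[0%R, t]) ((U J T)%:E + (geom_sum lam)%:E * h s))%E.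
  apply: ge0_le_integral => //.
  - by move=> s _; rewrite lee_fin subr_ge0 U_mono.
  - by apply: emeasurable_funD => //; exact: measurable_funeM.
  - move=> s /=; rewrite in_itv/= => /andP[s0 st].
    have hs : 0 <= s <= T by rewrite s0 (le_trans st).
    have -> : h s = (\sum_(j < J) green lam n j * v j s)%:E.
      by rewrite -sumEFin; apply: eq_bigr => j _; rewrite vE.
    by rewrite -EFinM -EFinD lee_fin late_le.
rewrite ge0_integralD//; first last.
- exact: measurable_funeM.
- by move=> s _; rewrite mule_ge0// lee_fin geom_sum_ge0.
- by move=> s _; rewrite lee_fin ip_ge0.
rewrite !lc ge0_integralZl//; last by rewrite lee_fin geom_sum_ge0.
rewrite ge0_integral_sum//; first last.
- by move=> j s _; rewrite mule_ge0// cenergy_ge0.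
- by move=> j; apply: measurable_funeM; exact: mc.
have -> : (\sum_(j < J) \int[@lebesgue_measure R]_(s in `[0%R, t])
    ((green lam n j)%:E * cenergy P setT (X s) j) =
   (\sum_(j < J) green lam n j * U j t)%:E)%E.
  rewrite -sumEFin; apply: eq_bigr => j _.
  rewrite ge0_integralZl//; [|exact: mc|by move=> s _; exact: cenergy_ge0].
  by rewrite -(cenergy_slices P (mXt j)).1 UE.
by rewrite -EFinM -EFinD lee_fin (mulrC (U n T - U n t)) (mulrC (U J T)).
Qed.

End ProperEnergy.

(** * Stability under limits, weighted sums and dependence on the law *)

Section EnergyLimit.
Context {R : realType}.
Variable lam : R.
Hypothesis lam1 : 1 < lam.
Local Open Scope ereal_scope.

Lemma sqr_cvg0 (u : nat -> \bar R) (e : R) : (forall n, 0 <= u n) ->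
  u @ \oo --> 0 -> (0 < e)%R -> exists N, forall n, (N <= n)%N -> u n ^+ 2 <= e%:E.
Proof.
move=> u0 cu e0.
have [|N HN] := cvge0_lt cu (e := Num.sqrt e); first by rewrite sqrtr_gt0.
exists N => n /HN; move: (u0 n); case: (u n) => [r| |] //=.
rewrite lee_fin lte_fin => r0 re; rewrite -EFinM lee_fin -expr2.
by rewrite -(sqr_sqrtr (ltW e0)) ler_pXn2r// ?nnegrE ?sqrtr_ge0// ltW.
Qed.

(** The inequality |x|^2 <= 2 |y|^2 + 2 |x - y|^2 is used once on each side, whence
the factor 4; the errors are controlled by the norm of H^(-1) because w is
dominated by its weight. *)
Lemma energy_limit {d1 d2 : measure_display} {S1 : measurableType d1}
    {S2 : measurableType d2} (mu1 : {measure set S1 -> \bar R})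
    (mu2 : {measure set S2 -> \bar R}) (D1 : set S1) (D2 : set S2)
    (x : S1 -> nat -> R) (z : S2 -> nat -> R)
    (xN : nat -> S1 -> nat -> R) (zN : nat -> S2 -> nat -> R)
    (a c : R) (w : nat -> R) n :
  measurable D1 -> measurable D2 -> (0 <= a)%R -> (0 <= c)%R ->
  (forall j, 0 <= w j <= wt lam (-1) j)%R ->
  (forall j, measurable_fun D1 (fun s => x s j)) ->
  (forall j, measurable_fun D2 (fun s => z s j)) ->
  (forall N j, measurable_fun D1 (fun s => xN N s j)) ->
  (forall N j, measurable_fun D2 (fun s => zN N s j)) ->
  (forall e : R, (0 < e)%R -> exists N,
    \sum_(0 <= j <oo) (wt lam (-1) j)%:E *
       cenergy mu1 D1 (fun s i => xN N s i - x s i)%R j <= e%:E /\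
    \sum_(0 <= j <oo) (wt lam (-1) j)%:E *
       cenergy mu2 D2 (fun s i => zN N s i - z s i)%R j <= e%:E) ->
  (forall N, a%:E * cenergy mu1 D1 (xN N) n <=
     c%:E * \sum_(0 <= j <oo) (w j)%:E * cenergy mu2 D2 (zN N) j) ->
  a%:E * cenergy mu1 D1 x n <=
    (4 * c)%:E * \sum_(0 <= j <oo) (w j)%:E * cenergy mu2 D2 z j.
Proof.
move=> mD1 mD2 a0 c0 wb mx mz mxN mzN small H.
apply/lee_addgt0Pr => e e0.
pose b := (2 * a * (wt lam (-1) n)^-1)%R.
have wn0 : (0 < wt lam (-1) n)%R := wt_gt0 lam1 _ _.
have b0 : (0 <= b)%R by rewrite !mulr_ge0// invr_ge0 ltW.
have cb1 : (0 < 4 * c + b + 1)%R by rewrite ltr_wpDl// addr_ge0// mulr_ge0.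
have [|N [h1 h2]] := small (e / (4 * c + b + 1))%R; first by rewrite divr_gt0.
set dl := (e / (4 * c + b + 1))%R in h1 h2.
have dl0 : (0 < dl)%R by rewrite divr_gt0.
have dlE : ((4 * c + b + 1) * dl = e)%R by rewrite mulrC divfK// gt_eqF.
clearbody dl.
have w0 j : 0 <= (w j)%:E by rewrite lee_fin; case/andP: (wb j).
have a0' : 0 <= a%:E by rewrite lee_fin.
have c0' : 0 <= c%:E by rewrite lee_fin.
have g0 d (S : measurableType d) (mu : {measure set S -> \bar R}) D y j :
  0 <= cenergy mu D y j by exact: cenergy_ge0.
have s0 y : 0 <= \sum_(0 <= j <oo) (w j)%:E * cenergy mu2 D2 y j.
  by apply: nneseries_ge0 => j _ _; rewrite mule_ge0.
set y1 := (fun s i => xN N s i - x s i)%R in h1.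
set y2 := (fun s i => zN N s i - z s i)%R in h2.
have d1' : a%:E * cenergy mu1 D1 x n <=
    2%:E * (a%:E * cenergy mu1 D1 (xN N) n) + (b * dl)%:E.
  apply: (le_trans (lee_wpmul2l a0' (cenergy_double mu1 mD1 n mx (mxN N)))).
  rewrite ge0_muleDr ?mule_ge0// muleCA leeD2l// muleCA.
  have : cenergy mu1 D1 y1 n <= ((wt lam (-1) n)^-1 * dl)%:E.
    rewrite EFinM lee_pdivlMl//; apply: le_trans h1.
    exact: (wcenergy_le mu1 D1 lam1).
  have t0 : 0 <= 2%:E :> \bar R by rewrite lee_fin.
  move=> /(lee_wpmul2l a0') /(lee_wpmul2l t0) h; apply: (le_trans h).
  by rewrite -!EFinM lee_fin /b; lra.
have d2' : \sum_(0 <= j <oo) (w j)%:E * cenergy mu2 D2 (zN N) j <=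
    2%:E * (\sum_(0 <= j <oo) (w j)%:E * cenergy mu2 D2 z j) + (2 * dl)%:E.
  apply: (@le_trans _ _ (\sum_(0 <= j <oo)
    (2%:E * ((w j)%:E * cenergy mu2 D2 z j) +
     2%:E * ((wt lam (-1) j)%:E * cenergy mu2 D2 y2 j)))).
    apply: lee_nneseries => [j _ _|j _]; first by rewrite mule_ge0.
    apply: (le_trans (lee_wpmul2l (w0 j) (cenergy_double mu2 mD2 j (mzN N) mz))).
    rewrite ge0_muleDr ?mule_ge0// muleCA leeD2l// muleCA.
    rewrite lee_wpmul2l//.
    have -> : cenergy mu2 D2 (fun s i => z s i - zN N s i)%R j = cenergy mu2 D2 y2 j.
      by apply: eq_integral => s _; rewrite /y2 -sqrrN opprB.
    by rewrite lee_wpmul2r// lee_fin; case/andP: (wb j).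
  have v0 j : 0 <= (wt lam (-1) j)%:E by rewrite lee_fin wt_ge0.
  rewrite nneseriesD; [|by move=> j _ _; rewrite !mule_ge0..].
  rewrite !nneseriesZl; [|by move=> j _; rewrite !mule_ge0..].
  by rewrite leeD2l// EFinM lee_wpmul2l.
apply: (le_trans d1').
have d3 := le_trans (H N) (lee_wpmul2l c0' d2').
apply: (@le_trans _ _ (2%:E * (c%:E *
  (2%:E * (\sum_(0 <= j <oo) (w j)%:E * cenergy mu2 D2 z j) + (2 * dl)%:E)) + (b * dl)%:E)).
  by rewrite leeD2r// lee_wpmul2l.
have B0 := s0 z; set B := \sum_(0 <= j <oo) _ in B0 *.
rewrite ge0_muleDr ?mule_ge0 ?lee_fin ?mulr_ge0// ?(ltW dl0)//.
rewrite ge0_muleDr ?mule_ge0 ?lee_fin ?mulr_ge0// ?(ltW dl0)//.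
rewrite -addeA leeD//.
  by rewrite !muleA -!EFinM lee_wpmul2r// lee_fin; lra.
rewrite -!EFinM -EFinD lee_fin.
by nra.
Qed.

End EnergyLimit.

Section WeightSums.
Context {R : realType}.
Variable lam : R.
Hypothesis lam1 : 1 < lam.
Local Open Scope ereal_scope.

(** Bound the factor k_n^(2 (s + 1)) of the weight by its value at the maximum of n
and j; multiplied by the kernel it leaves a power 2 s <= 0 there, which is
largest at j. *)
Lemma green_wt_le (s u : R) n j : (-1 <= s <= 0)%R ->
  (wt lam u n * green lam n j <= wt lam (u - s - 1) n * wt lam s j)%R.
Proof.
move=> /andP[s1 s0]; rewrite green_wt//; set m := maxn n j.
have -> : wt lam u n = (wt lam (u - s - 1) n * wt lam (s + 1) n)%R.
  by rewrite -wtD//; congr wt; ring.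
rewrite -mulrA ler_wpM2l ?wt_ge0//.
apply: (@le_trans _ _ (wt lam (s + 1) m * wt lam (-1) m)%R).
  by rewrite ler_wpM2r ?wt_ge0// wt_homo ?leq_maxl// -lerBlDr sub0r.
by rewrite -wtD// addrK wt_anti// leq_maxr.
Qed.

Lemma green_sum_lty (s u : R) (e : nat -> \bar R) : (-1 <= s <= 0)%R ->
  (u < s + 1)%R -> (forall j, 0 <= e j) ->
  \sum_(0 <= j <oo) (wt lam s j)%:E * e j < +oo ->
  \sum_(0 <= n <oo) (wt lam u n)%:E *
     \sum_(0 <= j <oo) (green lam n j)%:E * e j < +oo.
Proof.
move=> hs us e0 fin_e.
have w0 v j : 0 <= (wt lam v j)%:E by rewrite lee_fin wt_ge0.
have f0 : 0 <= \sum_(0 <= j <oo) (wt lam s j)%:E * e j.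
  by apply: nneseries_ge0 => j _ _; rewrite mule_ge0.
have fE : (fine (\sum_(0 <= j <oo) (wt lam s j)%:E * e j))%:E = \sum_(0 <= j <oo) (wt lam s j)%:E * e j.
  by rewrite fineK// ge0_fin_numE.
have us0 : (u - s - 1 < 0)%R by lra.
apply: (@le_lt_trans _ _ (\sum_(0 <= n <oo) (wt lam (u - s - 1) n)%:E *
  \sum_(0 <= j <oo) (wt lam s j)%:E * e j)).
  apply: lee_nneseries => [n _ _|n _].
    by rewrite mule_ge0// nneseries_ge0// => j _ _; rewrite mule_ge0// lee_fin green_ge0.
  rewrite -!nneseriesZl; try by move=> j _; rewrite mule_ge0// lee_fin green_ge0.
    apply: lee_nneseries => [j _ _|j _].
      by rewrite !mule_ge0// lee_fin green_ge0.
    by rewrite !muleA -!EFinM lee_wpmul2r// lee_fin green_wt_le.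
rewrite -fE; under eq_eseriesr do rewrite muleC.
rewrite nneseriesZl; last by move=> n _; exact: w0.
have := wt_summable lam1 us0.
have : 0 <= \sum_(0 <= n <oo) (wt lam (u - s - 1) n)%:E by exact: nneseries_ge0.
by case: (\sum_(0 <= n <oo) _) => [r| |] // _ _; rewrite -EFinM ltry.
Qed.

End WeightSums.

Section Law.
Context {R : realType} {d : measure_display} {Omega : measurableType d}.
Variable P : probability Omega R.

Lemma measurable_coordinate j : measurable_fun setT (fun y : @Rseq R => (y : nat -> R) j).
Proof.
move=> _ B mB; rewrite setTI; apply: sub_sigma_algebra.
by exists j, B.
Qed.

Lemma cenergy_law (Y : Omega -> nat -> R) (mu : probability (@Rseq R) R) j :
  (forall n, measurable_fun setT (fun w => Y w n)) -> has_law P Y mu ->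
  cenergy P setT Y j = cenergy mu setT (fun y : Rseq => (y : nat -> R)) j.
Proof.
move=> mY law.
have mYs : measurable_fun setT (Y : Omega -> @Rseq R).
  apply: (@measurability _ _ _ (@Rseq R) setT Y (@cylinders R)) => // _ [_ [n [B [mB ->]]] <-].
  by rewrite setTI; have := mY n measurableT B mB; rewrite setTI.
have mc : measurable_fun setT (fun y : @Rseq R => ((y : nat -> R) j ^+ 2)%:E).
  apply/measurable_EFinP/measurable_funX; exact: measurable_coordinate.
rewrite /cenergy.
rewrite [RHS](eq_measure_integral (pushforward P (Y : Omega -> @Rseq R))); last first.
  by move=> A mA _; apply/esym; exact: law.
rewrite ge0_integral_pushforward//.
by move=> y _; rewrite lee_fin sqr_ge0.
Qed.

End Law.

(** * Moderate solutions and regularity *)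

Section ModerateEnergy.
Context {R : realType} {d : measure_display} {Omega : measurableType d}.
Variables (lam T : R) (P : probability Omega R) (F : R -> set (set Omega)).
Variables (W : nat -> R -> Omega -> R).
Variables (X0 : Omega -> nat -> R) (X : R -> Omega -> nat -> R).
Hypothesis lam1 : 1 < lam.
Hypothesis T0 : 0 <= T.
Hypothesis HB : stochastic_basis T P F W.
Hypothesis HM : moderate_solution lam 0 T P F W X0 X.
Local Notation LP := ((@lebesgue_measure R) \x P)%E.

Let mX n : measurable_fun (slab 0 T : set (measurableTypeR R * Omega)) (fun z => proc X z n).
Proof. exact: (ms_L2 HM).1. Qed.

Lemma moderate_energy n :
  (cenergy LP (slab 0 T) (proc X) n <=
   (4 * geom_sum lam)%:E * \sum_(0 <= j <oo) (green lam n j)%:E * cenergy P setT X0 j)%E.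
Proof.
have [Y0 [Y [HY HY0 cY cY0]]] := ms_approx HM.
have mS := measurable_slab 0 T : measurable (slab 0 T : set (measurableTypeR R * Omega)).
have mY N j := (ps_L2 (HY N)).1 j.
have mdY N j := measurable_funB (mY N j) (mX j).
have mdY0 N j := measurable_funB ((HY0 N).1 j) ((ms_initial HM).1 j).
rewrite -[leLHS]mul1e.
apply: (energy_limit lam1 (xN := fun N => proc (Y N)) (zN := Y0)) => //.
- exact: geom_sum_ge0.
- by move=> j; rewrite green_ge0 green_le.
- exact: (ms_initial HM).1.
- by move=> N; exact: (HY0 N).1.
- move=> e e0.
  have [N1 h1] := sqr_cvg0 (fun N => L2Hnorm_ge0 _ _ _ _ _) cY e0.
  have [N2 h2] := sqr_cvg0 (fun N => L2Hnorm_ge0 _ _ _ _ _) cY0 e0.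
  exists (maxn N1 N2).
  have := h1 _ (leq_maxl N1 N2); have := h2 _ (leq_maxr N1 N2).
  rewrite (L2Hnorm_sqr P measurableT lam1 (-1) (mdY0 _)).
  by rewrite (L2Hnorm_sqr LP mS lam1 (-1) (mdY _)).
- move=> N; rewrite mul1e.
  exact: (proper_energy lam1 T0 HB (HY N) (HY0 N)).
Qed.

Lemma slab_sub t : t <= T -> slab 0 t `<=` (slab 0 T : set (measurableTypeR R * Omega)).
Proof.
move=> tT [u w] []; rewrite /slab /= !in_itv/= => /andP[-> us] _.
by rewrite (le_trans us).
Qed.

Lemma late_sub t : 0 <= t -> late t T `<=` (slab 0 T : set (measurableTypeR R * Omega)).
Proof.
move=> t0 [u w] []; rewrite /slab /late /= !in_itv/= => /andP[tu ->] _.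
by rewrite (le_trans t0 (ltW tu)).
Qed.

(** Convergence on the slab over [0, T] implies convergence on both of its parts,
so one approximating sequence serves for the two sides of the bound. *)
Lemma moderate_late_energy t n : 0 <= t <= T ->
  (t%:E * cenergy LP (late t T) (proc X) n <=
   (4 * geom_sum lam)%:E *
   \sum_(0 <= j <oo) (green lam n j)%:E * cenergy LP (slab 0 t) (proc X) j)%E.
Proof.
move=> ht; have /andP[t0 tT] := ht.
have [Y0 [Y [HY HY0 cY cY0]]] := ms_approx HM.
have mS := measurable_slab 0 T : measurable (slab 0 T : set (measurableTypeR R * Omega)).
have mSt := measurable_slab 0 t : measurable (slab 0 t : set (measurableTypeR R * Omega)).
have mL := measurable_late t T : measurable (late t T : set (measurableTypeR R * Omega)).
have mY N j := (ps_L2 (HY N)).1 j.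
have mdY N j := measurable_funB (mY N j) (mX j).
have subS := slab_sub tT; have subL := late_sub t0.
apply: (energy_limit lam1 (xN := fun N => proc (Y N)) (zN := fun N => proc (Y N))) => //.
- exact: geom_sum_ge0.
- by move=> j; rewrite green_ge0 green_le.
- by move=> j; apply: measurable_funS (mX j).
- by move=> j; apply: measurable_funS (mX j).
- by move=> N j; apply: measurable_funS (mY N j).
- by move=> N j; apply: measurable_funS (mY N j).
- move=> e e0.
  have [N h] := sqr_cvg0 (fun N => L2Hnorm_ge0 _ _ _ _ _) cY e0.
  exists N; have := h _ (leqnn N).
  rewrite (L2Hnorm_sqr LP mS lam1 (-1) (mdY _)) => h'.
  have w0 j : (0 <= (wt lam (-1) j)%:E)%E by rewrite lee_fin wt_ge0.
  split; apply: le_trans h'; apply: lee_nneseries => [j _ _|j _];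
    rewrite ?mule_ge0 ?cenergy_ge0// lee_wpmul2l//; apply: cenergy_subset => //; exact: mdY.
- move=> N; exact: (proper_late_energy lam1 T0 HB (HY N) (HY0 N)).
Qed.

End ModerateEnergy.

Section Regularity.
Context {R : realType} {d : measure_display} {S : measurableType d}.
Variables (mu : {measure set S -> \bar R}) (D : set S) (lam : R).
Hypothesis mD : measurable D.
Hypothesis lam1 : 1 < lam.
Local Open Scope ereal_scope.

Lemma green_regularity (x : S -> nat -> R) (c s u : R) (e : nat -> \bar R) :
  (0 <= c)%R -> (-1 <= s <= 0)%R -> (u < s + 1)%R -> (forall j, 0 <= e j) ->
  (forall n, measurable_fun D (fun z => x z n)) ->
  \sum_(0 <= j <oo) (wt lam s j)%:E * e j < +oo ->
  (forall n, cenergy mu D x n <= c%:E * \sum_(0 <= j <oo) (green lam n j)%:E * e j) ->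
  in_L2H mu D lam u x /\
  L2Hnorm mu D lam u x <=
    (fine (sqrte (c%:E * \sum_(0 <= n <oo) (wt lam u n)%:E *
       \sum_(0 <= j <oo) (green lam n j)%:E * e j)))%:E.
Proof.
move=> c0 hs us e0 mx fe H.
have k0 n : 0 <= \sum_(0 <= j <oo) (green lam n j)%:E * e j.
  by apply: nneseries_ge0 => j _ _; rewrite mule_ge0// lee_fin green_ge0.
have w0 n : 0 <= (wt lam u n)%:E by rewrite lee_fin wt_ge0.
have fin := green_sum_lty lam1 hs us e0 fe.
have S0 : 0 <= \sum_(0 <= n <oo) (wt lam u n)%:E *
    \sum_(0 <= j <oo) (green lam n j)%:E * e j.
  by apply: nneseries_ge0 => n _ _; rewrite mule_ge0.
have B : L2Hnorm mu D lam u x ^+ 2 <= c%:E * \sum_(0 <= n <oo) (wt lam u n)%:E *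
    \sum_(0 <= j <oo) (green lam n j)%:E * e j.
  rewrite L2Hnorm_sqr// -nneseriesZl; last by move=> n _; rewrite mule_ge0.
  apply: lee_nneseries => [n _ _|n _]; first by rewrite mule_ge0// cenergy_ge0.
  by rewrite muleCA lee_wpmul2l.
move: B; set M := c%:E * _ => B.
have M0 : 0 <= M by rewrite mule_ge0// lee_fin.
have Moo : M < +oo.
  move: fin S0; rewrite /M; case: (\sum_(0 <= n <oo) _) => [r| |] // _ _.
  by rewrite -EFinM ltry.
have Mf : sqrte M \is a fin_num by rewrite sqrte_fin_num// ge0_fin_numE.
have le : L2Hnorm mu D lam u x <= (fine (sqrte M))%:E.
  rewrite fineK// -[leLHS]gee0_abs ?L2Hnorm_ge0// -sqrte_sqr lee_sqrt//.
by split => //; split => //; rewrite (le_lt_trans le)// ltry.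
Qed.

Lemma in_L2H_weaken (s u : R) (x : S -> nat -> R) : (s <= u)%R ->
  in_L2H mu D lam u x -> \sum_(0 <= j <oo) (wt lam s j)%:E * cenergy mu D x j < +oo.
Proof.
move=> su [mx]; rewrite L2Hnorm_lty//; apply: le_lt_trans.
apply: lee_nneseries => [n _ _|n _]; first by rewrite mule_ge0 ?cenergy_ge0// lee_fin wt_ge0.
by rewrite lee_wpmul2r ?cenergy_ge0// lee_fin wt_le.
Qed.

End Regularity.

Unset Implicit Arguments.
Theorem theorem25 (R : realType) (lam : R) (lam_gt1 : 1 < lam) :
  (forall (beta : R) (mu : probability (@Rseq R) R),
    exists C : R,
    forall (d : measure_display) (Omega : measurableType d)
      (P : probability Omega R) (T : R) (F : R -> set (set Omega))
      (W : nat -> R -> Omega -> R)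
      (X0 : Omega -> nat -> R) (X : R -> Omega -> nat -> R) (alpha : R),
    0 < T -> stochastic_basis T P F W ->
    moderate_solution lam 0 T P F W X0 X ->
    has_law P X0 mu ->
    -1 <= alpha -> in_L2H P setT lam alpha X0 ->
    beta < Num.min 1 (alpha + 1) ->
    in_L2H (timeP P) (slab 0 T) lam beta (proc X) /\
    (L2Hnorm (timeP P) (slab 0 T) lam beta (proc X) <= C%:E)%E) /\
  (forall (d : measure_display) (Omega : measurableType d)
      (P : probability Omega R) (T : R) (F : R -> set (set Omega))
      (W : nat -> R -> Omega -> R)
      (X0 : Omega -> nat -> R) (X : R -> Omega -> nat -> R),
    0 < T -> stochastic_basis T P F W ->
    moderate_solution lam 0 T P F W X0 X ->
    [/\ forall beta : R, beta < 0 ->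
          in_L2H (timeP P) (slab 0 T) lam beta (proc X),
        (exists2 alpha : R, -1 < alpha & in_L2H P setT lam alpha X0) ->
          in_L2H (timeP P) (slab 0 T) lam 0 (proc X),
        in_L2H P setT lam 0 X0 ->
          forall beta : R, beta < 1 ->
          in_L2H (timeP P) (slab 0 T) lam beta (proc X) &
        forall eps beta : R, 0 < eps -> beta < 1 ->
          in_L2H (timeP P) (slab eps T) lam beta (proc X)]).

Proof.
have lam0 : 0 < lam := lt_trans ltr01 lam_gt1.
have g0 : 0 <= 4 * geom_sum lam by rewrite mulr_ge0// geom_sum_ge0.
have mS (d : measure_display) (Omega : measurableType d) (a b : R) :
  measurable (slab a b : set (measurableTypeR R * Omega)) by exact: measurable_slab.
have main (d : measure_display) (Omega : measurableType d)
    (P : probability Omega R) (T : R) (F : R -> set (set Omega))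
    (W : nat -> R -> Omega -> R) (X0 : Omega -> nat -> R)
    (X : R -> Omega -> nat -> R) (alpha beta : R) :
    0 < T -> stochastic_basis T P F W -> moderate_solution lam 0 T P F W X0 X ->
    -1 <= alpha -> in_L2H P setT lam alpha X0 -> beta < Num.min 1 (alpha + 1) ->
    in_L2H (timeP P) (slab 0 T) lam beta (proc X) /\
    (L2Hnorm (timeP P) (slab 0 T) lam beta (proc X) <=
      (fine (sqrte ((4 * geom_sum lam)%:E * \sum_(0 <= n <oo) (wt lam beta n)%:E *
        \sum_(0 <= j <oo) (green lam n j)%:E * cenergy P setT X0 j)))%:E)%E.
  move=> T0 HB HM a1 Ha; rewrite lt_min => /andP[b1 ba].
  (* the exponent of the initial condition is lowered to 0 if it is larger *)
  apply: (@green_regularity _ _ _ _ _ _ _ _ _ _ (Num.min alpha 0)) => //.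
  - exact: mS.
  - by rewrite le_min a1 ge_min lexx orbT lerN10.
  - by case: (lerP alpha 0) => _; rewrite ?add0r.
  - by move=> j; exact: cenergy_ge0.
  - exact: (ms_L2 HM).1.
  - by apply: in_L2H_weaken Ha => //; rewrite ge_min lexx.
  - by move=> n; exact: (moderate_energy lam_gt1 (ltW T0) HB HM).
split.
  move=> beta mu.
  exists (fine (sqrte ((4 * geom_sum lam)%:E * \sum_(0 <= n <oo) (wt lam beta n)%:E *
    \sum_(0 <= j <oo) (green lam n j)%:E *
      cenergy mu setT (fun y : Rseq => (y : nat -> R)) j)%E)).
  move=> d Omega P T F W X0 X alpha T0 HB HM law a1 Ha ba.
  have := main _ _ _ _ _ _ _ _ _ _ T0 HB HM a1 Ha ba.
  suff -> : (\sum_(0 <= n <oo) (wt lam beta n)%:E *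
      \sum_(0 <= j <oo) (green lam n j)%:E * cenergy P setT X0 j =
    \sum_(0 <= n <oo) (wt lam beta n)%:E *
      \sum_(0 <= j <oo) (green lam n j)%:E *
        cenergy mu setT (fun y : Rseq => (y : nat -> R)) j)%E by [].
  apply: eq_eseriesr => n _; congr (_ * _)%E; apply: eq_eseriesr => j _.
  by rewrite (cenergy_law j Ha.1 law).
move=> d Omega P T F W X0 X T0 HB HM.
have H1 := ms_initial HM.
have reg0 beta : beta < 0 -> in_L2H (timeP P) (slab 0 T) lam beta (proc X).
  move=> b0; apply: (main _ _ _ _ _ _ _ _ (-1) beta T0 HB HM _ H1 _).1 => //.
  by rewrite addNr lt_min b0 (lt_trans b0).
split => //.
- move=> [alpha a1 Ha]; apply: (main _ _ _ _ _ _ _ _ alpha 0 T0 HB HM _ Ha _).1.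
    exact: ltW.
  by rewrite lt_min ltr01 -ltrBlDr sub0r.
- move=> H0 beta b1; apply: (main _ _ _ _ _ _ _ _ 0 beta T0 HB HM _ H0 _).1.
    by rewrite lerN10.
  by rewrite add0r lt_min b1.
- move=> eps beta e0 b1.
  (* half of the minimum, since eps may exceed T *)
  pose t := Num.min eps T / 2.
  have m0 : 0 < Num.min eps T by rewrite lt_min e0.
  have t0 : 0 < t by rewrite divr_gt0.
  have tm : t < Num.min eps T by rewrite /t; lra.
  have [te tT] : t < eps /\ t < T by move: tm; rewrite lt_min => /andP.
  have ht : 0 <= t <= T by rewrite !ltW.
  (* a negative exponent above beta - 1: the energies on [0, t] are finite there *)
  pose a := Num.max (-1) ((beta - 1) / 2).
  have a0 : a < 0 by rewrite gt_max; apply/andP; split; lra.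
  have ha : -1 <= a <= 0 by rewrite (ltW a0) andbT le_max lexx.
  have ba : beta < a + 1.
    have : (beta - 1) / 2 <= a by rewrite le_max lexx orbT.
    by clearbody a; lra.
  have mX j := (ms_L2 HM).1 j.
  have subT := slab_sub (Omega := Omega) (ltW tT).
  have subL := late_sub (Omega := Omega) (T := T) (ltW t0).
  have subE : slab eps T `<=` (late t T : set (measurableTypeR R * Omega)).
    move=> [u w] []; rewrite /slab /late /= !in_itv/= => /andP[eu ->] _.
    by rewrite (lt_le_trans te).
  have subET := subset_trans subE subL.
  have mL := measurable_late t T : measurable (late t T : set (measurableTypeR R * Omega)).
  have mX' D : measurable D -> D `<=` slab 0 T -> forall j,
      measurable_fun D (fun z : measurableTypeR R * Omega => proc X z j).
    by move=> mD DT j; apply: measurable_funS (mX j) => //; exact: mS.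
  apply: (@green_regularity _ _ _ _ _ _ _ _ _ (4 * geom_sum lam / t) a _
    (fun j => cenergy (timeP P) (slab 0 t) (proc X) j) _ ha ba _ _ _ _).1 => //.
  - exact: mS.
  - by rewrite divr_ge0// ltW.
  - by move=> j; exact: cenergy_ge0.
  - by apply: mX' => //; exact: mS.
  - have := in_L2H_weaken (mS _ _ _ _) lam_gt1 (lexx a) (reg0 a a0).
    apply: le_lt_trans; apply: lee_nneseries => [j _ _|j _].
      by rewrite mule_ge0 ?cenergy_ge0// lee_fin wt_ge0.
    by rewrite lee_wpmul2l ?lee_fin ?wt_ge0//; apply: cenergy_subset.
  - move=> n; apply: (@le_trans _ _ (cenergy (timeP P) (late t T) (proc X) n)).
      by apply: cenergy_subset => //; exact: mX'.
    rewrite mulrC EFinM -muleA lee_pdivlMl//.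
    exact: (moderate_late_energy lam_gt1 (ltW T0) HB HM n ht).
Qed.
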